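(* Let $0<M<N$ be integers, let $(a_{ij})_{i,j=1}^N$ be a real matrix, let $g_i\in\mathbb{R}$ ($i=1,\dots,M$), and assume that $$\sum_{j=1}^N a_{ij}\ge 0,\quad i=1,\dots,M,\qquad\qquad \sum_{i,j=1}^M v_i\,a_{ij}\,v_j>0\quad\forall\,(v_1,\dots,v_M)\in\mathbb{R}^M\setminus\{0\}.$$ Let $\beta_{ij}$ be the functions on $\mathbb{R}^N$ defined from $(a_{ij})$ in the context and $$b_{ij}(\mathrm{U})=-\max\{\beta_{ij}(\mathrm{U})\,a_{ij},\,0,\,\beta_{ji}(\mathrm{U})\,a_{ji}\},\quad i\neq j,\qquad b_{ii}(\mathrm{U})=-\sum_{j\ne i}b_{ij}(\mathrm{U}),\qquad i,j=1,\dots,N.$$ Let $S_i=\{j\in\{1,\dots,N\}\setminus\{i\}\,;\ a_{ij}\neq0\text{ or }a_{ji}>0\}$ for $i=1,\dots,M$. Let $\mathrm{U}=(u_1,\dots,u_N)\in\mathbb{R}^N$ be any vector satisfying $$\sum_{j=1}^N (a_{ij}+b_{ij}(\mathrm{U}))\,u_j=g_i,\qquad i=1,\dots,M.$$ Then: (i) (local) for all $i=1,\dots,M$: $g_i\le0\Rightarrow u_i\le\max_{j\in S_i}u_j^+$, and $g_i\ge0\Rightarrow u_i\ge\min_{j\in S_i}u_j^-$. If $\sum_{j=1}^Na_{ij}=0$ for $i=1,\dots,M$, then for all $i=1,\dots,M$: $g_i\le0\Rightarrow u_i\le\max_{j\in S_i}u_j$, and $g_i\ge0\Rightarrow u_i\ge\min_{j\in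 S_i}u_j$. (ii) (general) for any nonempty $R\subset\{1,\dots,M\}$ such that, with $P:=R\cup\bigcup_{i\in R}S_i$, the set $Q:=P\setminus R$ is nonempty: if $g_i\le0$ for all $i\in R$, then $\max_{i\in P}u_i\le\max_{i\in Q}u_i^+$; if $g_i\ge0$ for all $i\in R$, then $\min_{i\in P}u_i\ge\min_{i\in Q}u_i^-$. If, in addition, $\sum_{j=1}^Na_{ij}=0$ for all $i\in R$, then $g_i\le0$ for all $i\in R$ implies $\max_{i\in P}u_i=\max_{i\in Q}u_i$, and $g_i\ge0$ for all $i\in R$ implies $\min_{i\in P}u_i=\min_{i\in Q}u_i$. (iii) (global) if $g_i\le0$ for $i=1,\dots,M$, then $\max_{1\le i\le N}u_i\le\max_{M+1\le i\le N}u_i^+$; if $g_i\ge0$ for $i=1,\dots,M$, then $\min_{1\le i\le N}u_i\ge\min_{M+1\le i\le N}u_i^-$. If, in addition, $\sum_{j=1}^Na_{ij}=0$ for $i=1,\dots,M$, then $g_i\le0$ for $i=1,\dots,M$ implies $\max_{1\le i\le N}u_i=\max_{M+1\le i\le N}u_i$, and $g_i\ge0$ for $i=1,\dots,M$ implies $\min_{1\le i\le N}u_i=\min_{M+1\le i\le N}u_i$. In particular, (i)–(iii) hold when $a_{ij}=a_h(\varphi_j,\varphi_i)$ ($i,j=1,\dots,N$) and $g_i=(g,\varphi_i)$ ($i=1,\dots,M$) arise from the finite element discretization described in the context, for either choice of $a_h$ and for any simplicial triangulation $\mathscr{T}_h$.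
   Context: For a real number $a$, $a^+=\max\{a,0\}$ and $a^-=\min\{a,0\}$. In (i), the sets $S_i$ are understood to be nonempty, so that the maxima and minima are defined. Definition of $\beta_{ij}=\beta_{ij}(\mathrm{U})$, $\mathrm{U}=(u_1,\dots,u_N)$: let $q_{ij}=\max\{|a_{ij}|,a_{ji}\}$. For $i\in\{1,\dots,M\}$ set $$P_i^{+}=\sum_{j:\,a_{ij}>0}a_{ij}(u_i-u_j)^{+},\quad P_i^{-}=\sum_{j:\,a_{ij}>0}a_{ij}(u_i-u_j)^{-},$$ $$Q_i^{+}=\sum_{j=1}^N q_{ij}(u_j-u_i)^{+},\quad Q_i^{-}=\sum_{j=1}^N q_{ij}(u_j-u_i)^{-},$$ $$R_i^{+}=\min\Big\{1,\frac{Q_i^{+}}{P_i^{+}}\Big\},\quad R_i^{-}=\min\Big\{1,\frac{Q_i^{-}}{P_i^{-}}\Big\},$$ where $j$ ranges over $\{1,\dots,N\}$; if $P_i^+=0$ (resp. $P_i^-=0$), then $R_i^+$ (resp. $R_i^-$) is assigned an arbitrary value in $[0,1]$. For $i=M+1,\dots,N$ set $R_i^+=R_i^-=1$. Then $$\beta_{ij}=\begin{cases}1-R_i^+ & \text{if } u_i>u_j,\\ 0 & \text{if } u_i=u_j,\\ 1-R_i^- & \text{if } u_i<u_j,\end{cases}\qquad i,j=1,\dots,N.$$ Finite element discretization: $\Omega\subset\mathbb{R}^d$, $d\ge1$, is a bounded domain with Lipschitz-continuous boundary, polyhedral if $d\ge2$; $\varepsilon>0$ is constant; $\boldsymbol{b}\in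 W^{1,\infty}(\Omega)^d$ with $\nabla\cdot\boldsymbol{b}=0$; $c\in L^\infty(\Omega)$ with $c\ge\sigma_0\ge0$ for a constant $\sigma_0$; $g\in L^2(\Omega)$; $(\cdot,\cdot)$ is the $L^2$ inner product. $\mathscr{T}_h$ is a (conforming) simplicial triangulation of $\overline\Omega$ with vertices $x_1,\dots,x_N$, where $x_1,\dots,x_M\in\Omega$ and $x_{M+1},\dots,x_N\in\partial\Omega$, $0<M<N$; $\varphi_1,\dots,\varphi_N$ are the continuous piecewise linear functions on $\mathscr{T}_h$ with $\varphi_i(x_j)=\delta_{ij}$. The form $a_h$ is either $$a(u,v)=\varepsilon(\nabla u,\nabla v)+(\boldsymbol{b}\cdot\nabla u,v)+(c\,u,v)$$ or $$a_h(u,v)=\varepsilon(\nabla u,\nabla v)+(\boldsymbol{b}\cdot\nabla u,v)+\sum_{i=1}^M(c,\varphi_i)\,u(x_i)\,v(x_i).$$ *)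

(* Defs.v *)
From HB Require Import structures.
From mathcomp Require Import all_boot all_order all_algebra.
From mathcomp Require Import all_classical all_reals all_analysis.

Set Implicit Arguments.
Unset Strict Implicit.
Unset Printing Implicit Defensive.

Import Order.TTheory GRing.Theory Num.Theory.
Import numFieldNormedType.Exports.

Local Open Scope ring_scope.

(* max / min of F over a nonempty finite set S (and 0 if S is empty). *)
Definition max_on (R : realType) (I : finType) (S : {set I}) (F : I -> R) : R :=
  if [pick j in S] is Some j0 then \big[Num.max/F j0]_(j in S) F j else 0.

Definition min_on (R : realType) (I : finType) (S : {set I}) (F : I -> R) : R :=
  if [pick j in S] is Some j0 then \big[Num.min/F j0]_(j in S) F j else 0.

Section algebraic_flux_correction.
Variables (R : realType) (N : nat).

Definition posp (a : R) : R := Num.max a 0.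
Definition negp (a : R) : R := Num.min a 0.

Variables (A : 'M[R]_N) (U : 'rV[R]_N).

Definition qcoef (i j : 'I_N) : R := Num.max `|A i j| (A j i).

Definition Pplus i : R := \sum_(j | 0 < A i j) A i j * posp (U 0 i - U 0 j).
Definition Pminus i : R := \sum_(j | 0 < A i j) A i j * negp (U 0 i - U 0 j).
Definition Qplus i : R := \sum_j qcoef i j * posp (U 0 j - U 0 i).
Definition Qminus i : R := \sum_j qcoef i j * negp (U 0 j - U 0 i).

Definition ratio_at (P Q r : R) : Prop :=
  (P != 0 -> r = Num.min 1 (Q / P)) /\ (P = 0 -> 0 <= r <= 1).

(* The values allowed for (R_i^+, R_i^-)_i at U: those at vanishing P_i^+,
   P_i^- are arbitrary in [0, 1].  The nodes 1, ..., M are the i < M. *)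
Definition limiter_at (M : nat) (Rp Rm : 'I_N -> R) : Prop :=
  forall i : 'I_N,
    ((i < M)%N -> ratio_at (Pplus i) (Qplus i) (Rp i) /\
                  ratio_at (Pminus i) (Qminus i) (Rm i)) /\
    ((M <= i)%N -> Rp i = 1 /\ Rm i = 1).

Definition beta (Rp Rm : 'I_N -> R) (i j : 'I_N) : R :=
  if U 0 j < U 0 i then 1 - Rp i
  else if U 0 i < U 0 j then 1 - Rm i
  else 0.

Definition bcoef_off (bt : 'I_N -> 'I_N -> R) (i j : 'I_N) : R :=
  - Num.max (Num.max (bt i j * A i j) 0) (bt j i * A j i).

Definition bcoef (bt : 'I_N -> 'I_N -> R) (i j : 'I_N) : R :=
  if i == j then - \sum_(k | k != i) bcoef_off bt i k else bcoef_off bt i j.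

End algebraic_flux_correction.

(* The node in {1, ..., N} underlying an interior node in {1, ..., M}. *)
Definition inn (M N : nat) (hMN : (M < N)%N) : 'I_M -> 'I_N :=
  widen_ord (ltnW hMN).

Definition limiter (R : realType) (M N : nat) (A : 'M[R]_N)
    (Rp Rm : 'rV[R]_N -> 'I_N -> R) : Prop :=
  forall U, limiter_at A U M (Rp U) (Rm U).

Definition afc_solution (R : realType) (M N : nat) (hMN : (M < N)%N)
    (A : 'M[R]_N) (g : 'rV[R]_M) (Rp Rm : 'rV[R]_N -> 'I_N -> R)
    (U : 'rV[R]_N) : Prop :=
  forall i : 'I_M,
    \sum_j (A (inn hMN i) j + bcoef A (beta U (Rp U) (Rm U)) (inn hMN i) j)
           * U 0 j = g 0 i.

Section maximum_principles.
Variables (R : realType) (M N : nat) (hMN : (M < N)%N).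
Variables (A : 'M[R]_N) (g : 'rV[R]_M) (U : 'rV[R]_N).

Let u (j : 'I_N) : R := U 0 j.
Let up (j : 'I_N) : R := posp (u j).
Let um (j : 'I_N) : R := negp (u j).

Definition row_sum (i : 'I_M) : R := \sum_j A (inn hMN i) j.

(* The set S_i. *)
Definition nbrs (i : 'I_M) : {set 'I_N} :=
  [set j | (j != inn hMN i)
           && ((A (inn hMN i) j != 0) || (0 < A j (inn hMN i)))]%SET.

Definition local_DMP : Prop :=
  (forall i : 'I_M, nbrs i != finset.set0 ->
     (g 0 i <= 0 -> u (inn hMN i) <= max_on (nbrs i) up) /\
     (0 <= g 0 i -> min_on (nbrs i) um <= u (inn hMN i)))
  /\
  ((forall i : 'I_M, row_sum i = 0) ->
   forall i : 'I_M, nbrs i != finset.set0 ->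
     (g 0 i <= 0 -> u (inn hMN i) <= max_on (nbrs i) u) /\
     (0 <= g 0 i -> min_on (nbrs i) u <= u (inn hMN i))).

Definition general_DMP : Prop :=
  forall Rs : {set 'I_M}, Rs != finset.set0 ->
  let Rn := imset (inn hMN) (mem Rs) in
  let P := (Rn :|: \bigcup_(i in Rs) nbrs i)%SET in
  let Q := (P :\: Rn)%SET in
  Q != finset.set0 ->
  [/\ (forall i, i \in Rs -> g 0 i <= 0) -> max_on P u <= max_on Q up,
      (forall i, i \in Rs -> 0 <= g 0 i) -> min_on Q um <= min_on P u
    & (forall i, i \in Rs -> row_sum i = 0) ->
      ((forall i, i \in Rs -> g 0 i <= 0) -> max_on P u = max_on Q u) /\
      ((forall i, i \in Rs -> 0 <= g 0 i) -> min_on P u = min_on Q u)].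

Definition global_DMP : Prop :=
  let all_nodes := [set: 'I_N]%SET in
  let bd_nodes := [set i : 'I_N | (M <= i)%N]%SET in
  [/\ (forall i, g 0 i <= 0) -> max_on all_nodes u <= max_on bd_nodes up,
      (forall i, 0 <= g 0 i) -> min_on bd_nodes um <= min_on all_nodes u
    & (forall i, row_sum i = 0) ->
      ((forall i, g 0 i <= 0) -> max_on all_nodes u = max_on bd_nodes u) /\
      ((forall i, 0 <= g 0 i) -> min_on all_nodes u = min_on bd_nodes u)].

End maximum_principles.

Local Open Scope classical_set_scope.
(* The product sigma-algebra on R^n, i.e. the Borel sets. *)
Definition coord_sets (R : realType) (n : nat) : set (set 'rV[R]_n) :=
  [set B | exists i, exists2 A : set R,
     measurable A & B = (fun x : 'rV[R]_n => x 0 i) @^-1` A].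

Arguments coord_sets : clear implicits.

HB.instance Definition _ (R : realType) (n : nat) :=
  @isMeasurable.Build (sigma_display (coord_sets R n)) 'rV[R]_n
    <<s coord_sets R n >> (@sigma_algebra0 _ setT _)
    (@sigma_algebraC _ _) (@sigma_algebra_bigcup _ setT _).

Section lebesgue_rV.
Variable R : realType.

Lemma measurable_coord n (i : 'I_n) :
  measurable_fun setT (fun x : 'rV[R]_n => x 0 i).
Proof.
by move=> _ A mA; rewrite setTI; apply: sub_sigma_algebra; exists i, A.
Qed.

Lemma measurable_fun_rV d (T : measurableType d) n (f : T -> 'rV[R]_n) :
  (forall i, measurable_fun setT (fun t => f t 0 i)) -> measurable_fun setT f.
Proof.
move=> mf; apply: (measurability (coord_sets R n)) => // _ [B [i [A mA ->]] <-].
exact: mf.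
Qed.

Definition cons_rV n (p : R * 'rV[R]_n) : 'rV[R]_n.+1 :=
  row_mx (const_mx p.1 : 'rV_1) p.2.

Definition uncons_rV n (x : 'rV[R]_n.+1) : R * 'rV[R]_n :=
  (x 0 0, rsubmx (x : 'rV_(1 + n))).

Lemma measurable_cons_rV n : measurable_fun setT (@cons_rV n).
Proof.
apply: measurable_fun_rV => i; rewrite /cons_rV.
have [j|j] := fintype.splitP (i : 'I_(1 + n)) => ij.
  have -> : (fun p : R * 'rV[R]_n =>
      (row_mx (const_mx p.1 : 'rV_1) p.2) 0 i) = fst.
    apply/funext => p.
    have -> : i = lshift n j :> 'I_(1 + n) by exact/val_inj.
    by rewrite row_mxEl mxE.
  exact: measurable_fst.
have -> : (fun p : R * 'rV[R]_n =>
    (row_mx (const_mx p.1 : 'rV_1) p.2) 0 i) = (fun x : 'rV[R]_n => x 0 j) \o snd.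
  apply/funext => p /=.
  have -> : i = rshift 1 j :> 'I_(1 + n) by exact/val_inj.
  by rewrite row_mxEr.
by apply: measurableT_comp; [exact: measurable_coord|exact: measurable_snd].
Qed.

Lemma measurable_uncons_rV n : measurable_fun setT (@uncons_rV n).
Proof.
apply: measurable_fun_pair; first exact: measurable_coord.
apply: measurable_fun_rV => i.
rewrite (_ : (fun _ => _) = fun x : 'rV[R]_n.+1 => x 0 (rshift 1 i)).
  exact: measurable_coord.
by apply/funext => x; rewrite mxE.
Qed.


Section step.
Variables (n : nat) (mu : {sigma_finite_measure set 'rV[R]_n -> \bar R}).

Definition lebesgueS : set 'rV[R]_n.+1 -> \bar R :=
  pushforward ((@lebesgue_measure R) \x mu)%E (@cons_rV n).

Let lebesgueS0 : lebesgueS set0 = 0%E.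
Proof. by rewrite /lebesgueS /pushforward preimage_set0 measure0. Qed.

Let lebesgueS_ge0 A : (0 <= lebesgueS A)%E.
Proof. by rewrite /lebesgueS /pushforward measure_ge0. Qed.

Let lebesgueS_sigma_additive : semi_sigma_additive lebesgueS.
Proof.
move=> F mF tF mUF; rewrite /lebesgueS /pushforward preimage_bigcup.
have mcF A : measurable A -> measurable (@cons_rV n @^-1` A).
  by move=> mA; rewrite -[X in measurable X]setTI; exact: measurable_cons_rV.
apply: measure_semi_sigma_additive.
- by move=> k; apply: mcF.
- apply/trivIsetP => /= i j _ _ ij; rewrite -preimage_setI.
  by move/trivIsetP : tF => /(_ _ _ _ _ ij) ->//; rewrite preimage_set0.
- by rewrite -preimage_bigcup; apply: mcF.
Qed.

HB.instance Definition _ := isMeasure.Build _ _ _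
  lebesgueS lebesgueS0 lebesgueS_ge0 lebesgueS_sigma_additive.

Let lebesgueS_sigma_finite : sigma_finite setT lebesgueS.
Proof.
have consK : cancel (@cons_rV n) (@uncons_rV n).
  move=> [a y]; rewrite /uncons_rV /cons_rV row_mxKr; congr pair => /=.
  by rewrite mxE; case: fintype.splitP => [k _|//]; rewrite mxE.
have /sigma_finiteP[F [TF ndF Foo]] :=
  sigma_finiteT (lebesgue_measure : {sigma_finite_measure set _ -> \bar R}).
have /sigma_finiteP[G [TG ndG Goo]] := sigma_finiteT mu.
exists (fun k => @uncons_rV n @^-1` (F k `*` G k)).
  apply/seteqP; split=> // x _.
  have [i _ Fi] : (\bigcup_k F k) (x 0 0) by rewrite -TF.
  have [j _ Gj] : (\bigcup_k G k) (rsubmx (x : 'rV_(1 + n))) by rewrite -TG.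
  exists (maxn i j) => //; split => /=.
    by move: Fi; apply/subsetPset/ndF/leq_maxl.
  by move: Gj; apply/subsetPset/ndG/leq_maxr.
move=> k; have [mF Fkoo] := Foo k; have [mG Gkoo] := Goo k; split.
  rewrite -[X in measurable X]setTI; apply: measurable_uncons_rV => //.
  exact: measurableX.
rewrite /lebesgueS /pushforward -comp_preimage.
rewrite (_ : _ \o _ = id); last by apply/funext => p /=; rewrite consK.
by rewrite /preimage/= product_measure1E// lte_mul_pinfty// ge0_fin_numE.
Qed.

HB.instance Definition _ := Measure_isSigmaFinite.Build _ _ _
  lebesgueS lebesgueS_sigma_finite.

End step.

(* d-dimensional Lebesgue measure (on Borel sets), as an iterated product. *)
Fixpoint lebesgue_rV n : {sigma_finite_measure set 'rV[R]_n -> \bar R} :=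
  if n is m.+1 then lebesgueS (lebesgue_rV m) else \d_(0 : 'rV[R]_0).

End lebesgue_rV.

Section finite_elements.
Variables (R : realType) (d : nat).
Implicit Types (Om : set 'rV[R]_d) (f h psi : 'rV[R]_d -> R) (k : 'I_d).

Definition boundary Om : set 'rV[R]_d := closure Om `\` interior Om.

Definition domain Om : Prop := [/\ open Om, connected Om & Om !=set0].

(* Near each boundary point, after an orthogonal change of coordinates O and
   the choice of a "vertical" coordinate k, Om is the strict epigraph of a
   Lipschitz function of the d - 1 other coordinates. *)
Definition lipschitz_boundary Om : Prop :=
  forall z, boundary Om z ->
  exists (O : 'M[R]_d) (k : 'I_d) (gam : 'rV[R]_d.-1 -> R),
  [/\ O *m O^T = 1%:M,
      [lipschitz gam y | y in setT]
    & \forall x \near z,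
        Om x <-> gam (col' k (x *m O)) < (x *m O) 0 k].

(* Convex hull of the points p i, i in t. *)
Definition hull (I : finType) (p : I -> 'rV[R]_d) (t : {set I}) :
    set 'rV[R]_d :=
  [set y | exists w : I -> R,
     [/\ forall i, 0 <= w i, forall i, i \notin t -> w i = 0,
         \sum_i w i = 1 & y = \sum_i w i *: p i]].

(* The closure of Om is a finite union of convex polytopes. *)
Definition polyhedral Om : Prop :=
  exists (n : nat) (p : 'I_n -> 'rV[R]_d) (K : {set {set 'I_n}}),
    closure Om = \bigcup_(t in [set` K]) hull p t.

Definition partial f k : 'rV[R]_d -> R := fun x => 'D_(delta_mx 0 k) f x.

(* All iterated partial derivatives exist and are continuous. *)
Definition smooth f : Prop :=
  forall s : seq 'I_d, let h := foldl partial f s in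
    continuous h /\ forall k x, derivable h x (delta_mx 0 k).

(* C_c^oo(Om) *)
Definition test_function Om psi : Prop :=
  [/\ smooth psi, compact (closure [set x | psi x != 0])
    & closure [set x | psi x != 0] `<=` Om].

Definition inner Om f h : R := \int[lebesgue_rV R d]_(x in Om) (f x * h x).

Definition in_Linf Om f : Prop :=
  measurable_fun Om f /\
  exists C : R, {ae lebesgue_rV R d, forall x, Om x -> `|f x| <= C}.

Definition in_L2 Om f : Prop :=
  measurable_fun Om f /\
  (\int[lebesgue_rV R d]_(x in Om) ((f x) ^+ 2)%:E < +oo)%E.

(* h is the k-th weak partial derivative of f in Om. *)
Definition weak_partial Om f k h : Prop :=
  forall psi, test_function Om psi ->
    inner Om f (partial psi k) = - inner Om h psi.

Definition in_W1inf Om f : Prop :=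
  in_Linf Om f /\
  forall k, exists2 h, in_Linf Om h & weak_partial Om f k h.

(* The divergence is the one formed with the weak partial derivatives. *)
Definition divergence_free Om (b : 'rV[R]_d -> 'rV[R]_d) : Prop :=
  exists D : 'I_d -> 'rV[R]_d -> R,
    (forall k, in_Linf Om (D k) /\ weak_partial Om (fun x => b x 0 k) k (D k))
    /\ {ae lebesgue_rV R d, forall x, Om x -> \sum_k D k x = 0}.

Section triangulation.
Variables (N : nat) (x : 'I_N -> 'rV[R]_d) (T : {set {set 'I_N}}).

(* A simplex of the triangulation is given by its set of d + 1 vertices. *)
Record triangulation Om : Prop := {
  tri_inj : injective x;
  tri_vertex : forall i, exists2 t, t \in T & i \in t;
  tri_card : forall t, t \in T -> #|t| = d.+1;
  (* affine independence of the vertices of t *)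
  tri_nondeg : forall t, t \in T -> forall w : 'I_N -> R,
    (forall i, i \notin t -> w i = 0) ->
    \sum_i w i = 0 -> \sum_i w i *: x i = 0 -> forall i, w i = 0;
  tri_cover : closure Om = \bigcup_(t in [set` T]) hull x t;
  tri_conforming : forall t1 t2, t1 \in T -> t2 \in T ->
    hull x t1 `&` hull x t2 = hull x (t1 :&: t2)%SET }.

(* Only the values on the closure of Om matter. *)
Definition nodal_basis Om (phi : 'I_N -> 'rV[R]_d -> R) : Prop :=
  forall i,
  [/\ forall j, phi i (x j) = (i == j)%:R,
      {within closure Om, continuous (phi i)}
    & forall t, t \in T -> exists (p : 'cV[R]_d) (q : R),
        forall y, hull x t y -> phi i y = (y *m p) 0 0 + q].

End triangulation.

Section forms.
Variables (Om : set 'rV[R]_d) (eps : R) (b : 'rV[R]_d -> 'rV[R]_d).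
Variable c : 'rV[R]_d -> R.

(* The arguments are piecewise linear functions; they have a classical gradient
   off the faces of the triangulation, i.e. almost everywhere, and the null set
   of faces does not affect the integrals. *)
Definition diff_conv (u v : 'rV[R]_d -> R) : R :=
  eps * (\int[lebesgue_rV R d]_(y in Om) \sum_k partial u k y * partial v k y)
  + inner Om (fun y => \sum_k b y 0 k * partial u k y) v.

Definition form_a (u v : 'rV[R]_d -> R) : R :=
  diff_conv u v + inner Om (fun y => c y * u y) v.

Definition form_lumped (M N : nat) (hMN : (M < N)%N) (x : 'I_N -> 'rV[R]_d)
    (phi : 'I_N -> 'rV[R]_d -> R) (u v : 'rV[R]_d -> R) : R :=
  diff_conv u v +
  \sum_(i < M) inner Om c (phi (inn hMN i)) * u (x (inn hMN i))
                                            * v (x (inn hMN i)).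

End forms.

(* a_ij = a(phi_j, phi_i) *)
Definition stiffness (N : nat) (a : ('rV[R]_d -> R) -> ('rV[R]_d -> R) -> R)
    (phi : 'I_N -> 'rV[R]_d -> R) : 'M[R]_N :=
  \matrix_(i, j) a (phi j) (phi i).

End finite_elements.

(* Main.v *)
Require Import Defs.
From mathcomp Require Import all_boot all_order all_algebra.
From mathcomp Require Import all_classical all_reals all_analysis.
From mathcomp Require Import measurable_realfun.
From mathcomp Require Import ring lra.

Set Implicit Arguments.
Unset Strict Implicit.
Unset Printing Implicit Defensive.

Import Order.TTheory GRing.Theory Num.Theory.
Import numFieldNormedType.Exports.

Local Open Scope classical_set_scope.
Local Open Scope ring_scope.

(** At an interior local maximum u_i the sum Q_i^+ vanishes, so R_i^+ = 0, beta_ij = 1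
    wherever u_j < u_i, and a_ij + b_ij <= 0 on the neighbours that carry a flux:
    every term (a_ij + b_ij) (u_j - u_i) of row i is nonnegative. On a plateau J
    violating the maximum principle all these terms vanish, hence so do the
    a_ij + b_ij with j outside J, which contradicts positive definiteness tested
    with the indicator vector of J. Minima follow by replacing U with - U.

    For finite elements, partition of unity gives the row sums, and positive
    definiteness reduces to the vanishing of the integral of (b . grad V) V for V
    piecewise linear and zero on the boundary. As div b = 0 holds only weakly, V^2
    has to be approximated by test functions: the square of the soft threshold of
    V has compact support in Om, and is smoothed by a tensor-product spline
    quasi-interpolant on a fine lattice, whose partial derivatives are convex
    combinations of difference quotients and therefore converge boundedly off the
    faces of the triangulation. *)

(** * Maximum principles for a matrix *)

(** The soft threshold is chosen for three properties. It vanishes for small |s|, so its composition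
    with V is supported away from the boundary, where V = 0. It stays within [de] of the identity,
    so letting [de] tend to 0 recovers V. Its square is continuously differentiable, with half the
    gradient of soft(V)^2 equal to soft(V) grad V. That V vanishes on the boundary has itself to be
    proved: [triangulation] refers to [Om] only through its closure, and it is the Lipschitz graph
    that rules out boundary points interior to the closure, as on a slit. All hypotheses that hold
    almost everywhere, together with the faces, are gathered in one null set, so that integrands are
    bounded at every remaining point and each splitting of an integral is legitimate. The two
    choices of a_h share diffusion and convection; their reaction terms enter through one sign
    property that covers both. *)

Section maximum_minimum_on.
Variables (R : realType) (I : finType).
Implicit Types (S : {set I}) (F : I -> R).

Lemma le_max_on S F j : j \in S -> F j <= max_on S F.
Proof.
move=> jS; rewrite /max_on; case: pickP => [j0 _|/(_ j)]; last by rewrite jS.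
by rewrite (bigD1 j jS) /= le_max lexx.
Qed.

Lemma max_on_mem S F : S != finset.set0 -> exists2 j, j \in S & max_on S F = F j.
Proof.
move=> /set0Pn[j jS]; rewrite /max_on; case: pickP => [j0 j0S|/(_ j)]; last first.
  by rewrite jS.
apply: (big_ind (fun x => exists2 k, k \in S & x = F k)).
- by exists j0.
- move=> x y [k kS ->] [l lS ->].
  by rewrite /Num.max; case: ifP => _; [exists l|exists k].
- by move=> i iS; exists i.
Qed.

Lemma max_on_leP S F x : S != finset.set0 ->
  (forall j, j \in S -> F j <= x) <-> max_on S F <= x.
Proof.
move=> S0; split=> [FS|mx j jS]; last exact: (le_trans (le_max_on _ jS)).
by have [j jS ->] := max_on_mem F S0; exact: FS.
Qed.

Lemma min_onE S F : min_on S F = - max_on S (fun j => - F j).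
Proof.
rewrite /min_on /max_on; case: pickP => [j0 _|_]; last by rewrite oppr0.
apply: (big_ind2 (fun x y => x = - y)) => [|x y x' y' -> ->|i _]; rewrite ?opprK//.
by rewrite oppr_max.
Qed.

End maximum_minimum_on.

Section discrete_maximum_principle.
Variables (R : realType) (M N : nat) (hMN : (M < N)%N).
Variables (A : 'M[R]_N) (g : 'rV[R]_M) (U : 'rV[R]_N) (rp rm : 'I_N -> R).

Let bt := beta U rp rm.
Let u (j : 'I_N) : R := U 0 j.
Let C i j : R := A i j + bcoef A bt i j.

Hypothesis lim : limiter_at A U M rp rm.
Hypothesis sol : forall i : 'I_M, \sum_j C (inn hMN i) j * u j = g 0 i.
Hypothesis sum0 : forall i : 'I_M, 0 <= row_sum hMN A i.
Hypothesis pos : forall v : 'rV[R]_M, v != 0 ->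
  0 < \sum_(i < M) \sum_(j < M) v 0 i * A (inn hMN i) (inn hMN j) * v 0 j.

Lemma beta_ge0 i j : 0 <= bt i j.
Proof.
have ratio_le1 P Q r : ratio_at P Q r -> r <= 1.
  move=> [r1 r2]; have [/r2/andP[]//|/r1 ->] := eqVneq P 0.
  by rewrite ge_min lexx.
have [rp1 rm1] : rp i <= 1 /\ rm i <= 1.
  have [limi bdi] := lim i; have [/limi[rpi rmi]|/bdi[-> ->]//] := ltnP i M.
  by split; [exact: ratio_le1 rpi|exact: ratio_le1 rmi].
by rewrite /bt /beta; case: ifP => _; [|case: ifP => _//]; rewrite subr_ge0.
Qed.

Lemma bcoef_off_le0 i j : bcoef_off A bt i j <= 0.
Proof. by rewrite oppr_le0 !le_max lexx orbT. Qed.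

Lemma nbrsE (i : 'I_M) j : j != inn hMN i ->
  (j \in nbrs hMN A i) = (A (inn hMN i) j != 0) || (0 < A j (inn hMN i)).
Proof. by move=> ji; rewrite inE ji. Qed.

(** The rows of b sum to zero, so C has the row sums of A. Row i thus becomes a row-sum term plus
    fluxes proportional to u_j - u_i, whose signs can be controlled. *)
Lemma sum_flux i :
  \sum_j C i j * u j = (\sum_j A i j) * u i + \sum_(j | j != i) C i j * (u j - u i).
Proof.
have Cs : \sum_j C i j = \sum_j A i j.
  rewrite big_split /= [X in _ + X](bigD1 i) //= /bcoef eqxx.
  rewrite [X in _ + (_ + X)](eq_bigr (bcoef_off A bt i)); last first.
    by move=> j ji; rewrite eq_sym (negbTE ji).
  by rewrite addNr addr0.
rewrite -Cs mulr_suml (bigD1 i) //= (bigD1 i (F := fun j => C i j * u i)) //=.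
rewrite -addrA; congr (_ + _); rewrite -big_split /=.
by apply: eq_bigr => j _; ring.
Qed.

(** Outside S_i, a_ij = 0 and beta_ji a_ji <= 0, so the maximum defining b_ij is 0. The condition
    a_ji > 0 in S_i accounts for the nodes that enter row i through b_ij alone. *)
Lemma not_nbr (i : 'I_M) j : j != inn hMN i -> j \notin nbrs hMN A i ->
  C (inn hMN i) j = 0.
Proof.
move=> ji; rewrite nbrsE// negb_or negbK -leNgt => /andP[/eqP Aij0 Aji].
rewrite /C /bcoef eq_sym (negbTE ji) /bcoef_off Aij0 mulr0 maxxx add0r.
apply/eqP; rewrite oppr_eq0; apply/eqP/max_idPl.
exact: mulr_ge0_le0 (beta_ge0 _ _) Aji.
Qed.

(* At a local maximum Q_i^+ vanishes, so the limiter is switched off (beta_ij = 1)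
   towards smaller neighbours and b_ij removes the positive entries of the row. *)
Lemma flux_ge0 (i : 'I_M) :
  (forall j, j \in nbrs hMN A i -> u j <= u (inn hMN i)) ->
  forall j, j != inn hMN i -> 0 <= C (inn hMN i) j * (u j - u (inn hMN i)).
Proof.
set k := inn hMN i => umax j jk.
have [jS|/not_nbr ->] := boolP (j \in nbrs hMN A i); rewrite ?mul0r//.
have [ujk|ukj|->] := ltgtP (u j) (u k); last 2 first.
- by have := umax _ jS; rewrite leNgt ukj.
- by rewrite subrr mulr0.
apply: mulr_le0; last by rewrite subr_le0 ltW.
rewrite /C /bcoef eq_sym (negbTE jk) /bcoef_off.
have [Akj|Akj] := leP (A k j) 0; first by have := bcoef_off_le0 k j; rewrite /bcoef_off; lra.
suff -> : bt k j = 1.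
  by rewrite mul1r subr_le0 !le_max lexx.
have [/(_ (ltn_ord i))[[rpk _] _] _] := lim k.
rewrite /bt /beta ujk.
suff -> : rp k = 0 by rewrite subr0.
have Q0 : Qplus A U k = 0.
  rewrite /Qplus big1// => l _; rewrite /posp /qcoef.
  have [->|lk] := eqVneq l k; first by rewrite subrr maxxx mulr0.
  have [lS|] := boolP (l \in nbrs hMN A i).
    have /max_idPr -> : U 0 l - U 0 k <= 0 by rewrite subr_le0 umax.
    by rewrite mulr0.
  (* A node outside S_i may lie above u_i, but its weight q is max(0, a_li) = 0. *)
  rewrite nbrsE// negb_or negbK -leNgt => /andP[/eqP -> Alk].
  by rewrite normr0 (max_idPl Alk) mul0r.
rewrite rpk; first by rewrite Q0 mul0r (min_idPr _).
(* The term of j makes P_i^+ positive, so R_i^+ is a genuine quotient and not an arbitrary value. *)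
apply: lt0r_neq0; rewrite /Pplus (bigD1 j) //= ltr_pwDl//.
  by rewrite mulr_gt0// lt_max subr_gt0 ujk.
by apply: sumr_ge0 => l /andP[Akl _]; rewrite mulr_ge0 ?(ltW Akl)// le_max lexx orbT.
Qed.

Lemma inn_inj : injective (inn hMN).
Proof. by move=> i j /(congr1 val) /= ij; exact: val_inj. Qed.

(* Testing positive definiteness with the indicator vector of J. *)
Lemma plateau_contra (J : {set 'I_M}) (m : R) : J != finset.set0 ->
  (forall i, i \in J -> u (inn hMN i) = m) ->
  (forall i, i \in J -> forall j, j \in nbrs hMN A i -> j \notin imset (inn hMN) (mem J) -> u j < m) ->
  (forall i, i \in J -> g 0 i <= 0) ->
  0 < m \/ (forall i, i \in J -> row_sum hMN A i = 0) -> False.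
Proof.
move=> /set0Pn[i0 i0J] um uJ gJ hm.
pose K := imset (inn hMN) (mem J).
have uK j : j \in K -> u j = m by move=> /imsetP[i iJ ->]; exact: um.
have C0 i : i \in J -> row_sum hMN A i = 0 /\ forall j, j \notin K -> C (inn hMN i) j = 0.
  move=> iJ; have ui := um _ iJ.
  have fl : forall j, j != inn hMN i -> 0 <= C (inn hMN i) j * (u j - u (inn hMN i)).
    apply: flux_ge0 => j jS; rewrite ui.
    by have [/uK ->//|jK] := boolP (j \in K); exact/ltW/(uJ i).
  have r0 : 0 <= row_sum hMN A i * m.
    case: hm => [m0|/(_ _ iJ) ->]; last by rewrite mul0r.
    by rewrite mulr_ge0 ?sum0// ltW.
  have s0 : 0 <= \sum_(j | j != inn hMN i) C (inn hMN i) j * (u j - u (inn hMN i)).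
    exact: sumr_ge0.
  (* The row-sum term and the fluxes are nonnegative and add up to g_i <= 0, so both vanish; for m >
     0 this forces the row sum itself to be 0. *)
  have := sol i; rewrite sum_flux ui -/(row_sum hMN A i) => e.
  have gi := gJ _ iJ; rewrite ui in s0 fl; split.
    case: hm => [m0|/(_ _ iJ)//].
    have : row_sum hMN A i * m = 0 by lra.
    by move=> /eqP; rewrite mulf_eq0 (gt_eqF m0) orbF => /eqP.
  have /eqP : \sum_(j | j != inn hMN i) C (inn hMN i) j * (u j - m) = 0 by lra.
  rewrite psumr_eq0// => /allP Cj j jK.
  have ji : j != inn hMN i.
    by apply: contraNneq jK => ->; exact: imset_f.
  have [jS|/not_nbr->//] := boolP (j \in nbrs hMN A i).
  have := Cj j (mem_index_enum _); rewrite ji /= mulf_eq0 => /orP[/eqP//|].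
  by rewrite subr_eq0 lt_eqF// (uJ i).
pose v : 'rV[R]_M := \row_i (i \in J)%:R.
have /pos : v != 0.
  by apply/eqP => /rowP/(_ i0); rewrite !mxE i0J => /eqP; rewrite oner_eq0.
have sumJ (F : 'I_M -> R) : \sum_i v 0 i * F i = \sum_(i in J) F i.
  rewrite [RHS]big_mkcond; apply: eq_bigr => i _; rewrite mxE.
  by case: ifP => _; rewrite ?mul1r ?mul0r.
rewrite (eq_bigr (fun i => v 0 i * \sum_(j in J) A (inn hMN i) (inn hMN j))); last first.
  by move=> i _; rewrite -sumJ mulr_sumr; apply: eq_bigr => j _; ring.
rewrite sumJ ltNge => /negP; apply; apply: sumr_le0 => i iJ.
have [r0 Ci] := C0 _ iJ.
have -> : \sum_(j in J) A (inn hMN i) (inn hMN j) = \sum_(j in K) A (inn hMN i) j.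
  by rewrite /K big_imset//=; apply: in2W; exact: inn_inj.
(* Since the row sum is 0, the entries inside K are traded for those outside, where a_ij = - b_ij >=
   0; the quadratic form at the indicator is therefore nonpositive. *)
have -> : \sum_(j in K) A (inn hMN i) j = - \sum_(j | j \notin K) A (inn hMN i) j.
  by move: r0; rewrite /row_sum (bigID (mem K)) /= => /eqP; rewrite addr_eq0 => /eqP.
rewrite oppr_le0; apply: sumr_ge0 => j jK.
have := Ci _ jK; rewrite /C => /eqP; rewrite addr_eq0 => /eqP ->.
rewrite /bcoef ifF; first by rewrite oppr_ge0 bcoef_off_le0.
by apply: contraNF jK => /eqP <-; exact: imset_f.
Qed.

Let up (j : 'I_N) : R := posp (u j).

Lemma le_up j : u j <= up j.
Proof. by rewrite /up /posp le_max lexx. Qed.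

Lemma up_ge0 j : 0 <= up j.
Proof. by rewrite /up /posp le_max lexx orbT. Qed.

Lemma max_up_ge0 S : S != finset.set0 -> 0 <= max_on S up.
Proof. by move=> /(max_on_mem up)[j _ ->]; exact: up_ge0. Qed.

Lemma max_u_le_up S : max_on S u <= max_on S up.
Proof.
have [->|S0] := eqVneq S finset.set0; last first.
  have [j jS ->] := max_on_mem u S0.
  exact: (le_trans (le_up j) (le_max_on _ jS)).
by rewrite /max_on; case: pickP => // j; rewrite finset.in_set0.
Qed.

(** The plateau is the singleton of i. With positive parts on the right, u_i <= 0 is immediate and
    u_i > 0 is the case m > 0 of the plateau argument. *)
Lemma local_max (i : 'I_M) : nbrs hMN A i != finset.set0 -> g 0 i <= 0 ->
  u (inn hMN i) <= max_on (nbrs hMN A i) up /\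
  (row_sum hMN A i = 0 -> u (inn hMN i) <= max_on (nbrs hMN A i) u).
Proof.
move=> S0 gi.
have main : 0 < u (inn hMN i) \/ row_sum hMN A i = 0 ->
    u (inn hMN i) <= max_on (nbrs hMN A i) u.
  move=> h; rewrite leNgt; apply/negP => lt.
  apply: (@plateau_contra [set i]%SET (u (inn hMN i))).
  - by apply/set0Pn; exists i; rewrite finset.in_set1.
  - by move=> k; rewrite finset.in_set1 => /eqP ->.
  - move=> k; rewrite finset.in_set1 => /eqP -> j jS _.
    exact: (le_lt_trans (le_max_on _ jS)).
  - by move=> k; rewrite finset.in_set1 => /eqP ->.
  - by case: h => h; [left|right=> k; rewrite finset.in_set1 => /eqP ->].
split=> [|r0]; last by apply: main; right.
have [u0|u0] := leP (u (inn hMN i)) 0; first exact: (le_trans u0 (max_up_ge0 S0)).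
by apply: (le_trans (main _)); [left|exact: max_u_le_up].
Qed.

(** Common source of the general and the global principle. The plateau consists of all interior
    nodes of P at which the maximum over P is attained; if the principle fails, none of them lies in
    Q. *)
Lemma region_max (P Q : {set 'I_N}) : Q != finset.set0 -> (Q \subset P)%SET ->
  (forall j, j \in P -> j \notin Q -> exists2 i, j = inn hMN i & g 0 i <= 0 /\
     {subset nbrs hMN A i <= P}) ->
  max_on P u <= max_on Q up /\
  ((forall i, inn hMN i \in P -> inn hMN i \notin Q -> row_sum hMN A i = 0) ->
   max_on P u = max_on Q u).
Proof.
move=> Q0 QP PQ.
have P0 : P != finset.set0.
  by have /set0Pn[j /(fintype.subsetP QP) jP] := Q0; apply/set0Pn; exists j.
have main : 0 < max_on P u \/
    (forall i, inn hMN i \in P -> inn hMN i \notin Q -> row_sum hMN A i = 0) ->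
    max_on P u <= max_on Q u.
  move=> h; rewrite leNgt; apply/negP => lt.
  have notQ j : u j = max_on P u -> j \notin Q.
    by move=> uj; apply: contraL lt => jQ; rewrite -leNgt -uj le_max_on.
  pose J := [set i : 'I_M | (inn hMN i \in P) && (u (inn hMN i) == max_on P u)]%SET.
  apply: (@plateau_contra J (max_on P u)).
  - have [j jP uj] := max_on_mem u P0.
    have [i ji _] := PQ _ jP (notQ _ (esym uj)).
    by apply/set0Pn; exists i; rewrite inE -ji jP uj /=.
  - by move=> i; rewrite inE => /andP[_ /eqP].
  - move=> i; rewrite inE => /andP[iP /eqP ui] j jS jK.
    have [i' /inn_inj <- [_ /(_ _ jS) jP]] := PQ _ iP (notQ _ ui).
    (* A neighbour that also attains the maximum lies in P but not in Q, hence is an interior node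
       and belongs to J already. *)
    rewrite lt_neqAle le_max_on// andbT; apply: contraNneq jK => uj.
    have [k jk _] := PQ _ jP (notQ _ uj).
    by rewrite jk; apply: imset_f; rewrite inE -jk jP uj /=.
  - move=> i; rewrite inE => /andP[iP /eqP ui].
    by have [i' /inn_inj <- []] := PQ _ iP (notQ _ ui).
  - case: h => [|h]; [by left|right => i].
    by rewrite inE => /andP[iP /eqP /notQ]; exact: h.
split=> [|r0].
  have [u0|u0] := leP (max_on P u) 0; first exact: (le_trans u0 (max_up_ge0 Q0)).
  by apply: (le_trans (main _)); [left|exact: max_u_le_up].
apply/eqP; rewrite eq_le main/=; last by right.
by apply/(max_on_leP _ _ Q0) => j /(fintype.subsetP QP); exact: le_max_on.
Qed.

End discrete_maximum_principle.

(** * Symmetry under U -> - U *)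

Section opposite.
Variables (R : realType) (N : nat) (A : 'M[R]_N) (U : 'rV[R]_N).

Lemma pospN (a : R) : posp (- a) = - negp a.
Proof. by rewrite /posp /negp oppr_min oppr0. Qed.

Lemma negpN (a : R) : negp (- a) = - posp a.
Proof. by rewrite /posp /negp oppr_max oppr0. Qed.

Lemma sub_oppU i j : (- U) 0 i - (- U) 0 j = - (U 0 i - U 0 j) :> R.
Proof. by rewrite !mxE opprD. Qed.

Lemma beta_opp rp rm : beta (- U) rm rp = beta U rp rm.
Proof.
apply/funext => i; apply/funext => j; rewrite /beta !mxE !ltrN2.
by case: ltgtP.
Qed.

(** Negating U exchanges the superscripts + and -, and each quotient keeps its value because
    numerator and denominator both change sign. *)
Lemma limiter_at_opp M rp rm : limiter_at A U M rp rm -> limiter_at A (- U) M rm rp.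
Proof.
have PpN i : Pplus A (- U) i = - Pminus A U i.
  by rewrite -sumrN; apply: eq_bigr => j _; rewrite sub_oppU pospN mulrN.
have PmN i : Pminus A (- U) i = - Pplus A U i.
  by rewrite -sumrN; apply: eq_bigr => j _; rewrite sub_oppU negpN mulrN.
have QpN i : Qplus A (- U) i = - Qminus A U i.
  by rewrite -sumrN; apply: eq_bigr => j _; rewrite sub_oppU pospN mulrN.
have QmN i : Qminus A (- U) i = - Qplus A U i.
  by rewrite -sumrN; apply: eq_bigr => j _; rewrite sub_oppU negpN mulrN.
have ratioN P Q r : ratio_at P Q r -> ratio_at (- P) (- Q) r.
  move=> [h1 h2]; split=> [|/eqP]; rewrite oppr_eq0.
    by move=> /h1; rewrite invrN mulrNN.
  by move=> /eqP/h2.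
move=> lim i; have [h1 h2] := lim i; split; last by move=> /h2[].
by move=> /h1[hp hm]; rewrite PpN PmN QpN QmN; split; exact: ratioN.
Qed.

End opposite.

Section discrete_maximum_principles.
Variables (R : realType) (M N : nat) (hMN : (M < N)%N).
Variables (A : 'M[R]_N) (g : 'rV[R]_M) (Rp Rm : 'rV[R]_N -> 'I_N -> R) (U : 'rV[R]_N).
Hypothesis sum0 : forall i : 'I_M, 0 <= \sum_j A (inn hMN i) j.
Hypothesis pos : forall v : 'rV[R]_M, v != 0 ->
  0 < \sum_(i < M) \sum_(j < M) v 0 i * A (inn hMN i) (inn hMN j) * v 0 j.
Hypothesis lim : limiter M A Rp Rm.
Hypothesis sol : afc_solution hMN A g Rp Rm U.

Let limN := limiter_at_opp (lim U).

Let solN (i : 'I_M) :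
  \sum_j (A (inn hMN i) j + bcoef A (beta (- U) (Rm U) (Rp U)) (inn hMN i) j) * (- U) 0 j
    = (- g) 0 i.
Proof.
rewrite beta_opp mxE -sol -sumrN; apply: eq_bigr => j _.
by rewrite mxE mulrN.
Qed.

Let local_le := @local_max _ _ _ hMN _ _ _ _ _ (lim U) sol sum0 pos.
Let local_ge := @local_max _ _ _ hMN _ _ _ _ _ limN solN sum0 pos.
Let region_le := @region_max _ _ _ hMN _ _ _ _ _ (lim U) sol sum0 pos.
Let region_ge := @region_max _ _ _ hMN _ _ _ _ _ limN solN sum0 pos.

Let minU S : min_on S (fun j => U 0 j) = - max_on S (fun j => (- U) 0 j).
Proof. by rewrite min_onE; congr (- max_on _ _); apply/funext => j; rewrite mxE. Qed.

Let minUm S : min_on S (fun j => negp (U 0 j)) = - max_on S (fun j => posp ((- U) 0 j)).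
Proof.
by rewrite min_onE; congr (- max_on _ _); apply/funext => j; rewrite mxE pospN.
Qed.

Let gN i : 0 <= g 0 i -> (- g) 0 i <= 0.
Proof. by rewrite mxE oppr_le0. Qed.

Lemma local_DMP_afc : local_DMP hMN A g U.
Proof.
have uN (i : 'I_N) : U 0 i = - (- U) 0 i by rewrite mxE opprK.
split=> [i Si|r0 i Si]; split=> gi.
- by have [] := local_le Si gi.
- by rewrite minUm [leRHS]uN lerN2; have [] := local_ge Si (gN gi).
- by have [_ ->] := local_le Si gi; rewrite // r0.
- by rewrite minU [leRHS]uN lerN2; have [_ ->] := local_ge Si (gN gi); rewrite // r0.
Qed.

Lemma region_DMP_afc (Rs : {set 'I_M}) (P Q : {set 'I_N}) :
  Q != finset.set0 -> (Q \subset P)%SET ->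
  (forall i, (inn hMN i \in P) && (inn hMN i \notin Q) -> i \in Rs) ->
  (forall j, j \in P -> j \notin Q -> exists2 i, j = inn hMN i & i \in Rs) ->
  (forall i, i \in Rs -> {subset nbrs hMN A i <= P}) ->
  [/\ (forall i, i \in Rs -> g 0 i <= 0) ->
        max_on P (fun j => U 0 j) <= max_on Q (fun j => posp (U 0 j)),
      (forall i, i \in Rs -> 0 <= g 0 i) ->
        min_on Q (fun j => negp (U 0 j)) <= min_on P (fun j => U 0 j)
    & (forall i, i \in Rs -> row_sum hMN A i = 0) ->
      ((forall i, i \in Rs -> g 0 i <= 0) ->
         max_on P (fun j => U 0 j) = max_on Q (fun j => U 0 j)) /\
      ((forall i, i \in Rs -> 0 <= g 0 i) ->
         min_on P (fun j => U 0 j) = min_on Q (fun j => U 0 j))].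
Proof.
move=> Q0 QP inR PQ RP.
have hle : (forall i, i \in Rs -> g 0 i <= 0) ->
    forall j, j \in P -> j \notin Q -> exists2 i, j = inn hMN i & g 0 i <= 0 /\
     {subset nbrs hMN A i <= P}.
  move=> gR j jP jQ; have [i ji iR] := PQ _ jP jQ.
  by exists i => //; split; [exact: gR|exact: RP].
have hge : (forall i, i \in Rs -> 0 <= g 0 i) ->
    forall j, j \in P -> j \notin Q -> exists2 i, j = inn hMN i & (- g) 0 i <= 0 /\
     {subset nbrs hMN A i <= P}.
  move=> gR j jP jQ; have [i ji iR] := PQ _ jP jQ.
  by exists i => //; split; [exact/gN/gR|exact: RP].
split=> [gR|gR|r0].
- by have [] := region_le Q0 QP (hle gR).
- by rewrite minU minUm lerN2; have [] := region_ge Q0 QP (hge gR).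
have r0' i : inn hMN i \in P -> inn hMN i \notin Q -> row_sum hMN A i = 0.
  by move=> iP iQ; apply/r0/inR; rewrite iP iQ.
split=> gR.
- by have [_ ->] := region_le Q0 QP (hle gR).
- by rewrite !minU; have [_ ->] := region_ge Q0 QP (hge gR).
Qed.

Lemma general_DMP_afc : general_DMP hMN A g U.
Proof.
move=> Rs _ Rn P Q Q0.
have PQR j : j \in P -> j \notin Q -> exists2 i, j = inn hMN i & i \in Rs.
  move=> jP; rewrite finset.in_setD jP andbT negbK => /imsetP[i iR ->].
  by exists i.
apply: region_DMP_afc => //.
- exact: finset.subsetDl.
- move=> i /andP[iP iQ]; have [k] := PQR _ iP iQ.
  by move=> /inn_inj ->.
- move=> i iR j jS; rewrite finset.in_setU; apply/orP; right.
  by apply/finset.bigcupP; exists i.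
Qed.

Lemma global_DMP_afc : global_DMP hMN A g U.
Proof.
have [||j _|i|i _ j _|h1 h2 h3] := @region_DMP_afc [set: 'I_M]%SET [set: 'I_N]%SET
    [set i : 'I_N | (M <= i)%N]%SET.
(* Nodes are counted from 0, so M is the first boundary node. *)
- by apply/set0Pn; exists (Ordinal hMN); rewrite inE /=.
- exact: finset.subsetT.
- by rewrite finset.in_setT.
- move=> _; rewrite inE -ltnNge => jM; exists (Ordinal jM); rewrite ?finset.in_setT//.
  exact: val_inj.
- by rewrite finset.in_setT.
split=> [gl|ge|r0].
- by apply: h1 => i _.
- by apply: h2 => i _.
by have [//|h4 h5] := h3; split => gg; [apply: h4|apply: h5] => i _.
Qed.

End discrete_maximum_principles.

(** * Lebesgue measure on row vectors *)

Section null_set.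
Context d (T : measurableType d) (R : realType) (mu : {measure set T -> \bar R}).
Import HBNNSimple.

(* Unlike [negligible_integral], no measurability of the integrand is needed: the
   integral is a supremum over simple functions, which may be cut off on N. *)
Lemma integral_setDnull (D N : set T) (f : T -> \bar R) :
  measurable N -> mu N = 0%E ->
  (\int[mu]_(x in D) f x = \int[mu]_(x in D `\` N) f x)%E.
Proof.
move=> mN N0.
have ge0 (k : T -> \bar R) : (forall x, 0 <= k x)%E ->
    (\int[mu]_(x in D) k x = \int[mu]_(x in D `\` N) k x)%E.
  move=> k0; rewrite !ge0_integralE//; apply/eqP; rewrite eq_le; apply/andP; split.
    apply: ge_ereal_sup => _ [h /= hk <-].
    have mC : measurable (~` N) by exact: measurableC.
    have -> : sintegral mu h = sintegral mu (proj_nnsfun h mC).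
      transitivity (\int[mu]_(x in setT) (h x)%:E)%E.
        by rewrite integral_nnsfun// patch_setT.
      rewrite (@ge0_negligible_integral _ _ _ _ _ N)//; last 2 first.
      - by exact/measurable_EFinP.
      - by move=> x _; rewrite lee_fin.
      by rewrite setTD integral_nnsfun// -mrestrict.
    apply: ereal_sup_ubound => /=; exists (proj_nnsfun h mC) => // x.
    have := hk x; rewrite -mrestrict !patchE in_setD in_setC.
    case: (x \in D) => /= hx; first by case: ifP.
    by case: ifP.
  apply: ge_ereal_sup => _ [h /= hk <-]; apply: ereal_sup_ubound => /=.
  exists h => //= x; apply: (le_trans (hk x)); rewrite !patchE in_setD.
  by case: (x \in D) => //=; case: ifP.
by rewrite integralE [RHS]integralE !ge0.
Qed.

Lemma Rintegral_setDnull (D N : set T) (f : T -> R) :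
  measurable N -> mu N = 0%E ->
  \int[mu]_(x in D) f x = \int[mu]_(x in D `\` N) f x.
Proof. by move=> mN N0; rewrite /Rintegral (integral_setDnull _ _ mN). Qed.

End null_set.

Section lebesgue_rV_theory.
Variable R : realType.

Lemma lebesgue_rVS n (A : set 'rV[R]_n.+1) :
  lebesgue_rV R n.+1 A =
  ((@lebesgue_measure R) \x (lebesgue_rV R n))%E (@cons_rV R n @^-1` A).
Proof. by []. Qed.

Lemma cons_rV0 n (p : R * 'rV[R]_n) : cons_rV p 0 0 = p.1.
Proof.
rewrite /cons_rV mxE; case: fintype.splitP => [k _|k //]; by rewrite mxE.
Qed.

Lemma cons_rV_lift n (p : R * 'rV[R]_n) i : cons_rV p 0 (lift 0 i) = p.2 0 i.
Proof.
rewrite /cons_rV; have -> : lift 0 i = rshift 1 i :> 'I_(1 + n) by exact: val_inj.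
exact: (row_mxEr (const_mx p.1 : 'rV_1) p.2 0 i).
Qed.

Definition box n (a b : 'I_n -> R) : set 'rV[R]_n :=
  [set x | forall i, a i < x 0 i < b i].

Lemma measurable_box n (a b : 'I_n -> R) : measurable (box a b).
Proof.
have -> : box a b = \bigcap_(i in [set: 'I_n]) ((fun x : 'rV[R]_n => x 0 i) @^-1` `]a i, b i[%classic).
  apply/seteqP; split=> [x ab i _|x ab i]; first by rewrite /= in_itv /=; exact: ab.
  by have := ab i I; rewrite /= in_itv.
apply: fin_bigcap_measurable => // i _.
rewrite -[X in measurable X]setTI; apply: measurable_coord => //.
Qed.

Lemma lebesgue_rV_box n (a b : 'I_n -> R) : (forall i, a i <= b i) ->
  lebesgue_rV R n (box a b) = (\prod_i (b i - a i))%:E.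
Proof.
elim: n a b => [|n IH] a b ab.
  rewrite big_ord0 /= diracE /= mem_set// => i; by case: i.
rewrite lebesgue_rVS.
have -> : @cons_rV R n @^-1` box a b =
    `]a 0, b 0[%classic `*` box (fun i => a (lift 0 i)) (fun i => b (lift 0 i)).
  apply/seteqP; split=> [p abp|p [p1 p2] i].
    split=> /=; first by rewrite in_itv /= -cons_rV0; exact: abp.
    by move=> i; rewrite -cons_rV_lift; exact: abp.
  have [j ->|->] := unliftP 0 i; first by rewrite cons_rV_lift; exact: p2.
  by rewrite cons_rV0; move: p1; rewrite /= in_itv.
rewrite product_measure1E//; last exact: measurable_box.
rewrite IH// big_ord_recl EFinM; congr (_ * _)%E.
  have := lebesgue_measure_itv `]a 0, b 0[; rewrite /= lte_fin => ->; rewrite -EFinB.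
  have [//|ba] := ltP (a 0) (b 0).
  by have -> : b 0 = a 0; [apply/eqP; rewrite eq_le ba ab|rewrite subrr].
Qed.

(** Row vectors carry the maximum norm: balls are open cubes, and their measure is explicit. *)
Lemma ball_rVP n (x y : 'rV[R]_n) e : 0 < e ->
  ball x e y <-> forall i, `|x 0 i - y 0 i| < e.
Proof.
move=> e0; split => [[_ b] i|b]; first exact: b.
by split=> // i j; rewrite ord1; exact: b.
Qed.

Lemma ball_box n (x : 'rV[R]_n) e : 0 < e ->
  ball x e = box (fun i => x 0 i - e) (fun i => x 0 i + e).
Proof.
move=> e0; apply/seteqP; split=> y.
  move=> /(ball_rVP _ _ e0) b i; have := b i; rewrite distrC ltr_norml.
  by move=> /andP[? ?]; apply/andP; split; lra.
move=> b; apply/(ball_rVP _ _ e0) => i; have := b i => /andP[? ?].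
by rewrite distrC ltr_norml; apply/andP; split; lra.
Qed.

Lemma lebesgue_rV_ball n (x : 'rV[R]_n) e : 0 < e ->
  lebesgue_rV R n (ball x e) = ((2 * e) ^+ n)%:E.
Proof.
move=> e0; rewrite ball_box// lebesgue_rV_box => [|i]; last by lra.
congr EFin; rewrite (eq_bigr (fun=> 2 * e)) => [|i _]; last by ring.
by rewrite prodr_const card_ord.
Qed.

Lemma lebesgue_rV_bounded n (A : set 'rV[R]_n) : measurable A -> bounded_set A ->
  (lebesgue_rV R n A < +oo)%E.
Proof.
move=> mA [M [Mr bM]].
have M1 : M < `|M| + 1 by rewrite ltr_pwDr// ler_norm.
have e0 : 0 < `|M| + 2 by rewrite ltr_wpDl.
apply: (@le_lt_trans _ _ (lebesgue_rV R n (ball 0 (`|M| + 2)))); last first.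
  by rewrite lebesgue_rV_ball// ltry.
apply: le_measure; rewrite ?inE//.
  by rewrite ball_box//; exact: measurable_box.
move=> x /(bM _ M1) /= xM; rewrite -ball_normE /= sub0r normrN.
by apply: (le_lt_trans xM); lra.
Qed.

(** The sigma-algebra is generated by the coordinates, so an open set has to be exhibited as a
    countable union of cubes, here with rational centres and radii 1/(k+1). Radii below r/2 suffice,
    since a cube of radius e containing x lies within 2e of x. *)
Lemma open_measurable_rV n (A : set 'rV[R]_n) : open A -> measurable A.
Proof.
move=> oA.
pose q (c : 'rV[rat]_n) : 'rV[R]_n := map_mx ratr c.
pose e (k : nat) : R := k.+1%:R^-1.
have e0 k : 0 < e k by rewrite invr_gt0.
pose I := [set ck : 'rV[rat]_n * nat | ball (q ck.1) (e ck.2) `<=` A].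
have -> : A = \bigcup_(ck in I) ball (q ck.1) (e ck.2).
  apply/seteqP; split=> [x Ax|x [ck Ick]]; last exact: Ick.
  have /nbhs_ballP[r /= r0 rA] : nbhs x A by exact: open_nbhs_nbhs.
  have [k ek] : exists k, e k < r / 2.
    have r20 : 0 < r / 2 by rewrite divr_gt0.
    have := near_infty_natSinv_lt (PosNum r20).
    by move=> [k _ /(_ k (leqnn k))]; exists k.
  have qP i : exists c : rat, `|x 0 i - ratr c| < e k.
    have [|c] := @rat_in_itvoo R (x 0 i - e k) (x 0 i + e k).
      by have := e0 k; lra.
    rewrite in_itv /= => /andP[? ?]; exists c.
    by rewrite distrC ltr_norml; apply/andP; split; lra.
  pose c := \row_i projT1 (cid (qP i)).
  have xc i : `|x 0 i - q c 0 i| < e k by rewrite !mxE; exact: (projT2 (cid (qP i))).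
  exists (c, k) => /=.
    move=> y /ball_rVP - /(_ (e0 k)) yc; apply: rA.
    apply/(ball_rVP _ _ r0) => i; have := xc i; have := yc i.
    rewrite !ltr_norml => /andP[? ?] /andP[? ?].
    by apply/andP; split; lra.
  by apply/(ball_rVP _ _ (e0 k)) => i; rewrite distrC; exact: xc.
rewrite bigcup_mkcond; apply: countable_bigcupT_measurable; first exact: countableP.
move=> ck; case: ifP => // _.
by rewrite ball_box//; exact: measurable_box.
Qed.

Lemma closed_measurable_rV n (A : set 'rV[R]_n) : closed A -> measurable A.
Proof.
move=> cA; rewrite -(setCK A); apply: measurableC; apply: open_measurable_rV.
exact: closed_openC.
Qed.

Lemma continuous_measurable_rV n (D : set 'rV[R]_n) (f : 'rV[R]_n -> R) :
  open D -> {in D, continuous f} -> measurable_fun D f.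
Proof.
move=> oD cf; apply: (measurability _ (RGenOpens.measurableE R)) => _ [_ [a [b ->] <-]].
apply: open_measurable_rV.
rewrite openE => x [Dx abx]; apply: filterI; first exact: open_nbhs_nbhs.
by apply: cf; [rewrite inE|apply: open_nbhs_nbhs; split => //; exact: interval_open].
Qed.

Definition aff n (p : 'cV[R]_n) (q : R) (x : 'rV[R]_n) : R := (x *m p) 0 0 + q.

Lemma affE n (p : 'cV[R]_n) q x : aff p q x = \sum_i x 0 i * p i 0 + q.
Proof. by rewrite /aff mxE. Qed.

Lemma continuous_aff n (p : 'cV[R]_n) q : continuous (aff p q).
Proof.
rewrite (_ : aff p q = fun x => \sum_i x 0 i * p i 0 + q); last first.
  by apply/funext => y; rewrite affE.
move=> x; apply: (@continuousD _ _ _ (fun y : 'rV[R]_n => \sum_i y 0 i * p i 0) (cst q));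
  last exact: cst_continuous.
apply: (@continuous_big R 'I_n +%R 0 xpredT (@add_continuous R) _ (index_enum _)
  (fun i (y : 'rV[R]_n) => y 0 i * p i 0)) => i _ y.
apply: (@continuousM _ _ (fun y : 'rV[R]_n => y 0 i) (cst (p i 0))).
  exact: coord_continuous.
exact: cst_continuous.
Qed.

Lemma measurable_hyperplane n (p : 'cV[R]_n) q : measurable [set x | aff p q x = 0].
Proof.
apply: closed_measurable_rV; rewrite (_ : [set _ | _] = aff p q @^-1` [set 0])//.
apply: preimage_closed; [by move=> x _; exact: continuous_aff|exact: closed_eq].
Qed.

(** Induction on the dimension through sections at a fixed first coordinate. If the remaining
    coefficients are not all 0, every section is a null hyperplane; otherwise the first coordinate
    is forced to be - q / p_0 and all other sections are empty. *)
Lemma lebesgue_rV_hyperplane n (p : 'cV[R]_n) q : p != 0 ->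
  lebesgue_rV R n [set x | aff p q x = 0] = 0%E.
Proof.
elim: n p q => [|n IH] p q p0.
  by move: p0; rewrite [p](_ : _ = 0) ?eqxx//; apply/matrixP => - [].
rewrite lebesgue_rVS /= /product_measure1.
pose p' : 'cV[R]_n := \col_i p (lift 0 i) 0.
have consE a y : aff p q (cons_rV (a, y)) = aff p' (a * p 0 0 + q) y.
  rewrite !affE big_ord_recl cons_rV0 /= addrA; congr (_ + _); rewrite addrC.
  by congr (_ + _); apply: eq_bigr => i _; rewrite cons_rV_lift mxE.
have xsE a : xsection (@cons_rV R n @^-1` [set x | aff p q x = 0]) a =
    [set y | aff p' (a * p 0 0 + q) y = 0].
  apply/seteqP; split=> y; rewrite /xsection /= ?inE /= consE//.
have [p'0|p'0] := eqVneq p' 0; last first.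
  by apply: integral0_eq => a _ /=; rewrite xsE IH.
have p00 : p 0 0 != 0.
  apply: contraNneq p0 => p00; apply/eqP/matrixP => i j; rewrite ord1 [RHS]mxE.
  have [k ->|->//] := unliftP 0 i.
  by move/matrixP: p'0 => /(_ k 0); rewrite !mxE.
pose a0 := - q / p 0 0.
have m1 : measurable [set a0 : R] by exact: measurable_set1.
rewrite (@integral_setDnull _ _ _ lebesgue_measure setT _ _ m1); last exact: lebesgue_measure_set1.
apply: integral0_eq => a [_ /= aa0]; rewrite xsE p'0.
rewrite (_ : [set _ | _] = set0) ?measure0//; apply/seteqP; split=> // y /=.
rewrite affE big1 => [e|i _]; last by rewrite mxE mulr0.
by apply: aa0; rewrite /a0; apply: (mulIf p00); rewrite divfK//; lra.
Qed.

End lebesgue_rV_theory.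

(** * Smooth approximation by splines *)

Section smooth_step.
Variable R : realType.
Implicit Types (f g : R -> R) (t : R).

(** The factor [t ^- k] makes the span of the family closed under differentiation, so a first
    derivative for each member, also at 0, yields all orders. *)
Definition flat (k : nat) t : R := if 0 < t then t ^- k * expR (- t^-1) else 0.

Lemma flat_le0 k t : t <= 0 -> flat k t = 0.
Proof. by rewrite /flat leNgt => /negbTE ->. Qed.

Lemma flat_ge0 k t : 0 <= flat k t.
Proof.
rewrite /flat; case: ifPn => // t0.
by rewrite mulr_ge0 ?expR_ge0// invr_ge0 exprn_ge0 ?ltW.
Qed.

Lemma flat_gt0 k t : 0 < t -> 0 < flat k t.
Proof. by move=> t0; rewrite /flat t0 mulr_gt0 ?expR_gt0// invr_gt0 exprn_gt0. Qed.

(** [expR t^-1] dominates the term of order [k.+2] of its series. A quadratic bound is what makes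
    the difference quotient at 0 tend to 0. *)
Lemma flat_le_sqr k t : flat k t <= (k.+2)`!%:R * t ^+ 2.
Proof.
have [t0|t0] := leP t 0.
  by rewrite flat_le0// mulr_ge0// sqr_ge0.
rewrite /flat t0 expRN.
have tV0 : 0 < t^-1 by rewrite invr_gt0.
have h : t ^- k.+2 / (k.+2)`!%:R <= expR t^-1.
  apply: le_trans (expR_ge1Dxn k.+1 (ltW tV0)).
  by rewrite exprVn ler_wpDl.
have f0 : (0 : R) < (k.+2)`!%:R by rewrite ltr0n fact_gt0.
have t2 : 0 < t ^+ k.+2 by rewrite exprn_gt0.
have tk : 0 < t ^+ k by rewrite exprn_gt0.
rewrite ler_pdivrMr ?expR_gt0//.
have c0 : 0 <= (k.+2)`!%:R * t ^+ 2 by rewrite mulr_ge0 ?ltW// exprn_gt0.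
apply: le_trans (ler_wpM2l c0 h); rewrite -[in leRHS]addn2 exprD.
rewrite le_eqVlt; apply/orP; left; apply/eqP; field.
by rewrite !gt_eqF// addn2.
Qed.

Lemma is_derive_flat k t :
  is_derive t 1 (flat k) (- k%:R * flat k.+1 t + flat k.+2 t).
Proof.
have [t0|t0|->] := ltgtP t 0.
- rewrite !flat_le0 ?ltW// mulr0 addr0.
  apply: (@near_eq_is_derive _ _ _ (cst 0)).
    near=> s; rewrite flat_le0//; near: s.
    by apply: filterS (lt_nbhsl t0) => ? /ltW.
- apply: (@near_eq_is_derive R R R (fun s : R => s ^- k * expR (- s^-1))).
    near=> s; rewrite /flat ifT//; near: s.
    exact: lt_nbhsr.
  have dV : is_derive t 1 (fun s : R => s^-1) (- t ^- 2 *: 1).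
    by apply: (@is_deriveV _ id); rewrite gt_eqF.
  have dk : is_derive t 1 (fun s => (s ^+ k)^-1) (- (t ^+ k) ^- 2 *: ((k%:R * t ^+ k.-1) *: 1)).
    apply: (@is_deriveV _ (fun s => s ^+ k)); first by rewrite gt_eqF// exprn_gt0.
    by have := @is_deriveX R R id k t 1 1 (is_derive_id _ _); rewrite exprfctE.
  have de : is_derive t 1 (expR \o (fun s => - s^-1)) (expR (- t^-1) * (- (- t ^- 2 *: 1))).
    apply: is_derive1_comp; exact: is_deriveN.
  apply: (is_derive_eq (is_deriveM dk de)).
  rewrite /flat t0 /GRing.scale /=.
  case: k {dk} => [|k] /=; rewrite ?exprS; field; rewrite ?expf_neq0 ?gt_eqF//.
- rewrite !flat_le0// mulr0 addr0.
  have h : (fun h : R => h^-1 *: ((flat k \o shift 0) (h *: 1) - flat k 0)) @ 0^' --> (0 : R).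
    apply/cvgr0Pnorm_lt => e e0.
    have c0 : (0 : R) < (k.+2)`!%:R by rewrite ltr0n fact_gt0.
    near=> h.
    have h0 : h != 0 by near: h; exact: nbhs_dnbhs_neq.
    rewrite /= (flat_le0 _ (lexx 0)) subr0 addr0 /GRing.scale /= mulr1 normrM normfV.
    rewrite ltr_pdivrMl ?normr_gt0// ger0_norm ?flat_ge0//.
    apply: (le_lt_trans (flat_le_sqr _ _)).
    rewrite -normr_gt0 in h0.
    rewrite -(real_normK (num_real h)) expr2 mulrCA ltr_pM2l// -ltr_pdivlMl// mulrC.
    near: h; apply: dnbhs0_lt; exact: divr_gt0.
  by constructor; [apply/cvg_ex; exists 0|exact/cvg_lim].
Unshelve. all: by end_near. Qed.

(* A class of functions closed under differentiation, hence consisting of smooth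
   functions, and rich enough to contain a smooth step and its primitive. *)
Inductive smooth1 : (R -> R) -> Prop :=
| smooth1_cst c : smooth1 (fun=> c)
| smooth1_id : smooth1 (fun t => t)
| smooth1_flat k : smooth1 (flat k)
| smooth1_affine f a b : smooth1 f -> smooth1 (fun t => f (a * t + b))
| smooth1D f g : smooth1 f -> smooth1 g -> smooth1 (fun t => f t + g t)
| smooth1M f g : smooth1 f -> smooth1 g -> smooth1 (fun t => f t * g t)
| smooth1V f : (forall t, f t != 0) -> smooth1 f -> smooth1 (fun t => (f t)^-1)
| smooth1_prim f g : smooth1 f -> (forall t, is_derive t 1 g (f t)) -> smooth1 g.

Lemma smooth1_derive f : smooth1 f ->
  exists2 f', smooth1 f' & forall t, is_derive t 1 f (f' t).
Proof.
elim=> {f} [c||k|f a b sf [f' sf' ff']|f g sf [f' sf' ff'] sg [g' sg' gg']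
  |f g sf [f' sf' ff'] sg [g' sg' gg']|f f0 sf [f' sf' ff']|f g sf _ fg].
- by exists (fun=> 0) => [|t]; [exact: smooth1_cst|exact: is_derive_cst].
- by exists (fun=> 1) => [|t]; [exact: smooth1_cst|exact: is_derive_id].
- exists (fun t => - k%:R * flat k.+1 t + flat k.+2 t); last exact: is_derive_flat.
  by apply: smooth1D; [apply: smooth1M|]; [exact: smooth1_cst|exact: smooth1_flat..].
- exists (fun t => f' (a * t + b) * a) => [|t].
    by apply: smooth1M; [exact: smooth1_affine|exact: smooth1_cst].
  apply: (is_derive1_comp (g := fun t => a * t + b)).
  apply: (is_derive_eq (is_deriveD (is_deriveZ a (is_derive_id t 1)) (is_derive_cst b t 1))).
  by rewrite addr0 /GRing.scale /= mulr1.
- exists (fun t => f' t + g' t) => [|t]; first exact: smooth1D.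
  exact: is_deriveD.
- exists (fun t => f t * g' t + g t * f' t) => [|t].
    by apply: smooth1D; exact: smooth1M.
  exact: is_deriveM.
- exists (fun t => - 1 * ((f t)^-1 * (f t)^-1) * f' t) => [|t].
    apply: smooth1M => //; apply: smooth1M; first exact: smooth1_cst.
    by apply: smooth1M; exact: smooth1V.
  apply: (is_derive_eq (is_deriveV (f0 t) (ff' t))).
  by rewrite /GRing.scale /= -expr2 exprVn mulN1r.
- by exists f.
Qed.

Lemma smooth1_continuous f : smooth1 f -> continuous f.
Proof.
move=> /smooth1_derive[f' _ ff'] t; apply: differentiable_continuous.
by apply/derivable1_diffP; case: (ff' t).
Qed.

Lemma smooth1_ndecr f f' : (forall t, is_derive t 1 f (f' t)) ->
  (forall t, 0 <= f' t) -> {homo f : s t / s <= t}.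
Proof.
move=> ff' f'0 s t st.
have [|c _ e] := @MVT_segment _ f f' _ _ st (fun x _ => ff' x).
  apply: continuous_subspaceT => x; apply: differentiable_continuous.
  by apply/derivable1_diffP; case: (ff' x).
by rewrite -subr_ge0 e mulr_ge0// subr_ge0.
Qed.

Lemma smooth1_const f f' : (forall t, is_derive t 1 f (f' t)) ->
  forall s t, s <= t -> (forall x, s <= x <= t -> f' x = 0) -> f s = f t.
Proof.
move=> ff' s t st f'0.
have [|c /f'0 c0 e] := @MVT_segment _ f f' _ _ st (fun x _ => ff' x).
  apply: continuous_subspaceT => x; apply: differentiable_continuous.
  by apply/derivable1_diffP; case: (ff' x).
by apply/eqP; rewrite eq_sym -subr_eq0 e c0 mul0r.
Qed.

(** A smooth transition from 0 on [t <= 0] to 1 on [1 <= t]; 1 - t is written in the form that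
    [smooth1_affine] expects. *)
Definition step t : R := flat 0 t * (flat 0 t + flat 0 (- 1 * t + 1))^-1.

Lemma step_den_gt0 t : 0 < flat 0 t + flat 0 (- 1 * t + 1).
Proof.
have [t0|t0] := leP t 0; last by rewrite ltr_pwDl ?flat_ge0// flat_gt0.
by rewrite ltr_wpDl ?flat_ge0// flat_gt0//; lra.
Qed.

Lemma smooth1_step : smooth1 step.
Proof.
apply: smooth1M; first exact: smooth1_flat.
apply: smooth1V; first by move=> t; rewrite gt_eqF// step_den_gt0.
by apply: smooth1D; [|apply: smooth1_affine]; exact: smooth1_flat.
Qed.

Lemma step_le0 t : t <= 0 -> step t = 0.
Proof. by move=> t0; rewrite /step flat_le0// mul0r. Qed.

Lemma step_ge1 t : 1 <= t -> step t = 1.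
Proof.
move=> t1; rewrite /step (@flat_le0 _ (- 1 * t + 1)) ?addr0 ?divff//; last by lra.
by rewrite gt_eqF// flat_gt0; lra.
Qed.

Lemma flat0_ndecr : {homo flat 0 : s t / s <= t}.
Proof.
move=> s t st; have [s0|s0] := leP s 0; first by rewrite flat_le0// flat_ge0.
have t0 := lt_le_trans s0 st.
by rewrite /flat s0 t0 !expr0 invr1 !mul1r ler_expR lerN2 lef_pV2.
Qed.

Lemma step_ndecr : {homo step : s t / s <= t}.
Proof.
move=> s t st; have := step_den_gt0 s; have := step_den_gt0 t.
rewrite /step; set b := flat 0 (_ + 1); set d := flat 0 (_ + 1) => bt ds.
rewrite ler_pdivrMr// mulrAC ler_pdivlMr//.
have st1 : flat 0 s <= flat 0 t by exact: flat0_ndecr.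
have bd : b <= d by apply: flat0_ndecr; lra.
have b0 : 0 <= b by exact: flat_ge0.
have := flat_ge0 0 s; have := flat_ge0 0 t.
by nra.
Qed.

Lemma step_primitive : exists2 G : R -> R, smooth1 G &
  forall t, is_derive t 1 G (step t).
Proof.
(* The lower end lies left of 0, where [step] vanishes: the fundamental theorem covers t >= 0, and G
   is constantly 0 near any t < 0. *)
pose G x := \int[lebesgue_measure]_(t in `[(-1 : R), x]) step t.
suff dG t : is_derive t 1 G (step t).
  by exists G => //; apply: smooth1_prim dG; exact: smooth1_step.
have [t0|t0] := ltP t 0; last first.
  have [| | | |d1 d2] := @continuous_FTC1_closed _ step (-1) t (t + 1).
  - by rewrite ltrDl.
  - apply: continuous_compact_integrable; first exact: segment_compact.
    by apply: continuous_subspaceT; exact: (smooth1_continuous smooth1_step).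
  - by lra.
  - exact: (smooth1_continuous smooth1_step).
  by constructor => //; rewrite -derive1E.
rewrite step_le0 ?ltW//.
apply: (@near_eq_is_derive _ _ _ (cst 0)).
  near=> s; apply/esym; rewrite /G /Rintegral integral0_eq// => x /=.
  rewrite in_itv /= => /andP[_ xs]; rewrite step_le0//; apply: (le_trans xs).
  near: s.
  by apply: filterS (lt_nbhsl t0) => ? /ltW.
Unshelve. all: by end_near. Qed.

End smooth_step.

Section smooth_functions.
Variables (R : realType) (d : nat).
Implicit Types (f g : 'rV[R]_d -> R) (k : 'I_d).

Lemma is_derive_line f (x v : 'rV[R]_d) l :
  is_derive (0 : R) 1 (fun s : R => f (s *: v + x)) l -> is_derive x v f l.
Proof.
have E : (fun h : R => h^-1 *: (((fun s : R => f (s *: v + x)) \o shift 0) (h *: 1)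
     - f (0 *: v + x))) = (fun h : R => h^-1 *: ((f \o shift x) (h *: v) - f x)).
  apply/funext => h /=.
  by rewrite addr0 scale0r add0r /GRing.scale /= mulr1.
move=> [dl lE]; constructor; first by move: dl; rewrite /derivable E.
by move: lE; rewrite /derive E.
Qed.

(** Sums of products of smooth functions of one coordinate: exactly the shape of tensor-product
    splines, and closed under partial differentiation. *)
Inductive smoothd : ('rV[R]_d -> R) -> Prop :=
| smoothd_cst c : smoothd (fun=> c)
| smoothd_coord h k : smooth1 h -> smoothd (fun x => h (x 0 k))
| smoothdD f g : smoothd f -> smoothd g -> smoothd (fun x => f x + g x)
| smoothdM f g : smoothd f -> smoothd g -> smoothd (fun x => f x * g x).

Lemma coord_line (x : 'rV[R]_d) k j (s : R) :
  (s *: delta_mx 0 k + x) 0 j = s * (j == k)%:R + x 0 j.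
Proof. by rewrite !mxE eqxx. Qed.

Lemma smoothd_derive f k : smoothd f ->
  exists2 f', smoothd f' & forall x, is_derive x (delta_mx 0 k) f (f' x).
Proof.
elim=> {f} [c|h j sh|f g sf [f' sf' ff'] sg [g' sg' gg']|f g sf [f' sf' ff'] sg [g' sg' gg']].
- by exists (fun=> 0) => [|x]; [exact: smoothd_cst|exact: is_derive_cst].
- have [h' sh' hh'] := smooth1_derive sh.
  exists (fun x => h' (x 0 j) * (j == k)%:R) => [|x].
    by apply: smoothdM; [exact: smoothd_coord|exact: smoothd_cst].
  apply: is_derive_line.
  rewrite (_ : (fun s => _) = h \o (fun s => s * (j == k)%:R + x 0 j)); last first.
    by apply/funext => s /=; rewrite coord_line.
  apply: is_derive1_comp; first by rewrite mul0r add0r.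
  have := is_deriveD (is_deriveM (is_derive_id (0 : R) (1 : R)) (is_derive_cst ((j == k)%:R : R) _ _))
    (is_derive_cst (x 0 j) _ _).
  by move/is_derive_eq; apply; rewrite addr0 scaler0 add0r /GRing.scale /= mulr1.
- exists (fun x => f' x + g' x) => [|x]; first exact: smoothdD.
  exact: is_deriveD.
- exists (fun x => f x * g' x + g x * f' x) => [|x]; last exact: is_deriveM.
  by apply: smoothdD; exact: smoothdM.
Qed.

Lemma smoothd_continuous f : smoothd f -> continuous f.
Proof.
elim=> {f} [c|h j sh|f g _ cf _ cg|f g _ cf _ cg] x.
- exact: cst_continuous.
- apply: (@continuous_comp _ _ _ (fun x : 'rV[R]_d => x 0 j) h).
    exact: coord_continuous.
  exact: smooth1_continuous.
- by apply: (@continuousD _ _ _ f g); [exact: cf|exact: cg].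
- by apply: (@continuousM _ _ f g); [exact: cf|exact: cg].
Qed.

Lemma smoothd_smooth f : smoothd f -> smooth f.
Proof.
move=> sf s; elim: s f sf => [|k s IH] f sf /=; last first.
  apply: IH; have [f' sf' ff'] := smoothd_derive k sf.
  rewrite (_ : partial f k = f')//; apply/funext => x.
  by rewrite /partial; case: (ff' x).
split=> [|k x]; first exact: smoothd_continuous.
by have [f' _ ff'] := smoothd_derive k sf; case: (ff' x).
Qed.

Lemma smoothd_sum (I : Type) (r : seq I) (F : I -> 'rV[R]_d -> R) :
  (forall i, smoothd (F i)) -> smoothd (fun x => \sum_(i <- r) F i x).
Proof.
move=> sF; elim: r => [|i r IH].
  by under eq_fun do rewrite big_nil; exact: smoothd_cst.
by under eq_fun do rewrite big_cons; exact: smoothdD.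
Qed.

Lemma smoothd_prod (I : Type) (r : seq I) (F : I -> 'rV[R]_d -> R) :
  (forall i, smoothd (F i)) -> smoothd (fun x => \prod_(i <- r) F i x).
Proof.
move=> sF; elim: r => [|i r IH].
  by under eq_fun do rewrite big_nil; exact: smoothd_cst.
by under eq_fun do rewrite big_cons; exact: smoothdM.
Qed.

End smooth_functions.

Lemma is_derive_bigsum (R : realType) (I : Type) (r : seq I) (F : I -> R -> R)
    (dF : I -> R) (t : R) : (forall i, is_derive t 1 (F i) (dF i)) ->
  is_derive t 1 (fun s => \sum_(i <- r) F i s) (\sum_(i <- r) dF i).
Proof.
move=> dFi; elim: r => [|i r IH].
  by under eq_fun do rewrite big_nil; rewrite big_nil; exact: is_derive_cst.
by under eq_fun do rewrite big_cons; rewrite big_cons; exact: is_deriveD.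
Qed.

(** * Quasi-interpolation by tensor-product splines *)

Section quasi_interpolation.
Variable R : realType.

(** K is a rising staircase step and H its increment: monotonicity gives H >= 0, and telescoping
    makes the integer translates of H sum to 1. The width 2 of the transition puts the support of H
    in [0, 3], whence the distances [3 * h] below. *)
Definition unit_partition (K H : R -> R) :=
  [/\ forall t, H t = K t - K (t - 1), {homo K : s t / s <= t},
      forall t, t <= 0 -> K t = 0 & forall t, 2 <= t -> K t = 1].

Lemma unit_partition_ge0 K H : unit_partition K H -> forall t, 0 <= H t.
Proof. by move=> [HK Kn _ _] t; rewrite HK subr_ge0 Kn// gerBl. Qed.

Lemma unit_partition_supp K H : unit_partition K H ->
  forall t, H t != 0 -> 0 <= t <= 3.
Proof.
move=> [HK _ K0 K1] t; rewrite HK.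
have [t0|t0] := ltP t 0; first by rewrite !K0 ?subrr ?eqxx//; lra.
by have [//|t3] := leP t 3; rewrite !K1 ?subrr ?eqxx//; lra.
Qed.

Lemma unit_partition_sum K H n t : unit_partition K H -> 2 <= t <= n%:R ->
  \sum_(j < n) H (t - j%:R) = 1.
Proof.
move=> [HK _ K0 K1] /andP[t2 tn].
transitivity (K t - K (t - n%:R)); last by rewrite K1// K0 ?subr0// subr_le0.
elim: n {tn} => [|n IH]; first by rewrite big_ord0 subr0 subrr.
have -> : t - n.+1%:R = t - n%:R - 1 by rewrite -natr1; ring.
by rewrite big_ord_recr /= IH HK; ring.
Qed.

(* th is the second difference of a primitive of the smooth step, i.e. a mollified
   hat function. *)
Lemma spline_exists : exists th H : R -> R,
  [/\ smooth1 th, exists K, unit_partition K th, exists K, unit_partition K H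
    & forall t : R, is_derive t 1 th (H t - H (t - 1))].
Proof.
have [G sG dG] := step_primitive R.
pose sh (f : R -> R) (t : R) := f (1 * t + - 1).
have shE f t : sh f t = f (t - 1) by rewrite /sh mul1r.
pose K t := G t + - 1 * sh G t.
have dsh f f' (t : R) : (forall t : R, is_derive t 1 f (f' t)) -> is_derive t 1 (sh f) (sh f' t).
  move=> ff'; rewrite -[X in is_derive _ _ _ X]mulr1 /sh.
  apply: (is_derive1_comp (g := fun t : R => 1 * t + -1)).
  apply: (is_derive_eq (is_deriveD (is_deriveZ 1 (is_derive_id t (1 : R))) (is_derive_cst (-1 : R) t 1))).
  by rewrite addr0 scale1r.
have dB f f' (t : R) : (forall t : R, is_derive t 1 f (f' t)) ->
    is_derive t 1 (fun t => f t + - 1 * sh f t) (f' t - f' (t - 1)).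
  move=> ff'; have h := dsh _ _ t ff'.
  apply: (is_derive_eq (is_deriveD (ff' t) (is_deriveZ (-1) h))).
  by rewrite shE /GRing.scale /= mulN1r.
have sB f : smooth1 f -> smooth1 (fun t => f t + - 1 * sh f t).
  move=> sf; apply: smooth1D => //; apply: smooth1M; first exact: smooth1_cst.
  exact: smooth1_affine.
pose H t := @step R t - step (t - 1).
have dK (t : R) : is_derive t 1 K (H t) by exact: dB.
have H0 t : 0 <= H t by rewrite subr_ge0 step_ndecr// gerBl.
have stepP : unit_partition (@step R) H.
  split=> // [|t t0|t t2]; first exact: step_ndecr.
    by rewrite step_le0.
  by rewrite step_ge1//; lra.
have K0 t : t <= 0 -> K t = 0.
  move=> t0; rewrite /K shE.
  rewrite (@smooth1_const _ G (@step R) dG (t - 1) t); first by rewrite mulN1r subrr.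
    by rewrite gerBl.
  by move=> x /andP[_ xt]; rewrite step_le0// (le_trans xt).
have K1 t : 2 <= t -> K t = 1.
  move=> t2.
  (* On [t - 1, t] with t >= 2 the step equals 1, so G minus the identity is constant there and K t
     = 1. *)
  have dGt (s : R) : is_derive s 1 (fun s => G s + - 1 * s) (@step R s - 1).
    apply: (is_derive_eq (is_deriveD (dG s) (is_deriveZ (-1) (is_derive_id s (1 : R))))).
    by rewrite /GRing.scale /= mulN1r.
  have := @smooth1_const _ _ _ dGt (t - 1) t.
  rewrite gerBl => /(_ ler01) h.
  have : G (t - 1) + -1 * (t - 1) = G t + -1 * t.
    apply: h => x /andP[tx _]; rewrite step_ge1 ?subrr//; lra.
  by rewrite /K shE; lra.
exists (fun t => K t + - 1 * sh K t), H; split.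
- exact/sB/sB.
- exists K; split=> // [t|]; first by rewrite shE mulN1r.
  exact: smooth1_ndecr dK H0.
- by exists (@step R).
- by move=> t; exact: dB.
Qed.

Variable d : nat.

(* The quasi-interpolant is a sum over the nodes h m - B', m integral, of a large
   box; a partial derivative of it is a convex combination of difference quotients
   of w at nearby nodes. *)
Lemma smooth_approximation (B h : R) (w : 'rV[R]_d -> R) : 0 < h ->
  exists psi : 'rV[R]_d -> R, [/\ smooth psi,
    forall x, psi x != 0 -> exists2 z : 'rV[R]_d, w z != 0 & forall j, `|z 0 j - x 0 j| <= 3 * h
  & forall (x : 'rV[R]_d) k a b, (forall j, `|x 0 j| <= B) ->
      (forall z : 'rV[R]_d, (forall j, `|z 0 j - x 0 j| <= 3 * h) ->
         a <= h^-1 * (w z - w (z - h *: delta_mx 0 k)) <= b) ->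
      a <= partial psi k x <= b].
Proof.
move=> h0.
have [th [H [sth [K1 thP] [K2 HP] dth]]] := spline_exists.
(* The margin makes [T x j] at least 3 on the box, one more than the partition of unity requires;
   the node that wraps around in the shift below needs the extra unit. *)
pose B' := B + 3 * h.
pose n := Num.truncn (`|2 * B' / h|).
pose T (x : 'rV[R]_d) j : R := h^-1 * x 0 j + B' / h.
pose z (m : {ffun 'I_d -> 'I_n.+1}) : 'rV[R]_d := \row_j (h * (m j)%:R - B').
pose psi x := \sum_(m : {ffun 'I_d -> 'I_n.+1}) w (z m) * \prod_j th (T x j - (m j)%:R).
have zT (x : 'rV[R]_d) m j : z m 0 j = x 0 j - h * (T x j - (m j)%:R).
  by rewrite mxE /T; field; rewrite gt_eqF.
have near_z (x : 'rV[R]_d) (m : {ffun 'I_d -> 'I_n.+1}) j : 0 <= T x j - (m j)%:R <= 3 -> `|z m 0 j - x 0 j| <= 3 * h.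
  move=> /andP[t0 t3]; rewrite (zT x) addrAC subrr sub0r normrN normrM gtr0_norm//.
  by rewrite ger0_norm// mulrC ler_pM2r.
exists psi; split.
- apply/smoothd_smooth/smoothd_sum => m; apply: smoothdM; first exact: smoothd_cst.
  apply: smoothd_prod => j.
  pose th' t := th (h^-1 * t + (B' / h - (m j)%:R)).
  rewrite (_ : (fun x => _) = (fun x : 'rV[R]_d => th' (x 0 j))); last first.
    by apply/funext => y; rewrite /T /th' addrA.
  exact/smoothd_coord/smooth1_affine.
- move=> x psix.
  have [m mx] : exists m, w (z m) * \prod_j th (T x j - (m j)%:R) != 0.
    by apply/not_existsP => h1; case/eqP: psix; apply: big1 => m _; have /negP/negPn/eqP := h1 m.
  move: mx; rewrite mulf_eq0 negb_or => /andP[wz /prodf_neq0 pz].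
  exists (z m) => // j; apply: near_z; apply: (unit_partition_supp thP).
  exact: pz.
move=> x k a b xB dq.
have Tx j : 3 <= T x j <= n.+1%:R.
  have := xB j; rewrite ler_norml => /andP[x1 x2].
  have n1 : 2 * B' / h <= n.+1%:R.
    apply: le_trans (ler_norm _) _; apply/ltW.
    by rewrite /n; have /truncn_itv/andP[] : 0 <= `|2 * B' / h| by exact: normr_ge0.
  have -> : T x j = (x 0 j + B') / h by rewrite /T; ring.
  apply/andP; split; first by rewrite ler_pdivlMr// /B'; lra.
  by apply: le_trans n1; rewrite ler_pM2r ?invr_gt0// /B'; lra.
(* The derivative of [th] is a difference of two translates of H. Summation by parts moves this
   difference onto w and leaves H, again a partition of unity, as the weight in direction k. *)
pose Phi j := if j == k then H else th.
have PhiP j : exists K, unit_partition K (Phi j).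
  by rewrite /Phi; case: ifP => _; [exists K2|exists K1].
pose W (m : {ffun 'I_d -> 'I_n.+1}) := \prod_j Phi j (T x j - (m j)%:R).
have W0 m : 0 <= W m.
  by apply: prodr_ge0 => j _; have [K Kp] := PhiP j; exact: (unit_partition_ge0 Kp).
have W1 : \sum_m W m = 1.
  rewrite -(bigA_distr_bigA (fun j (i : 'I_n.+1) => Phi j (T x j - i%:R))) /=.
  apply: big1 => j _; have [K Kp] := PhiP j; apply: (unit_partition_sum Kp).
  by have /andP[T3 ->] := Tx j; rewrite andbT; lra.
have Wz m : W m != 0 -> a <= h^-1 * (w (z m) - w (z m - h *: delta_mx 0 k)) <= b.
  move=> /prodf_neq0 Wm; apply: dq => j; apply: near_z.
  by have [K Kp] := PhiP j; apply: (unit_partition_supp Kp); exact: Wm.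
pose P1 (m : {ffun 'I_d -> 'I_n.+1}) := \prod_(j | j != k) th (T x j - (m j)%:R).
have WE m : W m = H (T x k - (m k)%:R) * P1 m.
  rewrite /W (bigD1 k)//= {1}/Phi eqxx; congr (_ * _).
  by apply: eq_bigr => j /negbTE jk; rewrite /Phi jk.
have dpsi : is_derive x (delta_mx 0 k) psi
    (\sum_m w (z m) * (h^-1 * (H (T x k - (m k)%:R) - H (T x k - (m k)%:R - 1)) * P1 m)).
  apply: is_derive_line; apply: is_derive_bigsum => m.
  rewrite (_ : (fun s => _) = (fun s => (w (z m) * P1 m) * th (h^-1 * s + (T x k - (m k)%:R)))); last first.
    apply/funext => s; rewrite (bigD1 k)//= /T coord_line eqxx mulr1 [RHS]mulrAC -mulrA.
    congr (_ * (th _ * _)); first by ring.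
    apply: eq_bigr => j /negbTE jk; congr (th _).
    by rewrite coord_line jk mulr0 add0r.
  have dth' : is_derive (0 : R) 1 (th \o (fun s => h^-1 * s + (T x k - (m k)%:R)))
      ((H (T x k - (m k)%:R) - H (T x k - (m k)%:R - 1)) * h^-1).
    apply: is_derive1_comp; first by rewrite mulr0 add0r.
    apply: (is_derive_eq (is_deriveD (is_deriveZ h^-1 (is_derive_id (0 : R) (1 : R))) (is_derive_cst _ _ _))).
    by rewrite addr0 /GRing.scale /= mulr1.
  apply: (is_derive_eq (is_deriveZ (w (z m) * P1 m) dth')).
  by rewrite /GRing.scale /=; ring.
have -> : partial psi k x = \sum_m W m * (h^-1 * (w (z m) - w (z m - h *: delta_mx 0 k))).
  rewrite /partial; have [_ ->] := dpsi.
  (* The shift by one node is made cyclic to be a bijection of the finite index set; at the node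
     that wraps around, H is 0 on both sides. *)
  pose sg (m : {ffun 'I_d -> 'I_n.+1}) : {ffun 'I_d -> 'I_n.+1} :=
    [ffun j => if j == k then ordS (m j) else m j].
  have sg_inj : injective sg.
    move=> m m' /ffunP e; apply/ffunP => j; have := e j; rewrite !ffunE.
    by case: ifP => // _ /ordS_inj.
  have P1sg m : P1 (sg m) = P1 m.
    by apply: eq_bigr => j /negbTE jk; rewrite ffunE jk.
  have shift : \sum_m w (z m) * (H (T x k - (m k)%:R - 1) * P1 m) =
      \sum_m w (z m - h *: delta_mx 0 k) * W m.
    rewrite [RHS](reindex_inj sg_inj) /=; apply: eq_bigr => m _.
    rewrite WE P1sg /sg ffunE eqxx.
    have [mn|mn] := ltnP (m k) n.
      have mk1 : ordS (m k) = (m k).+1 :> nat by rewrite /= modn_small.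
      rewrite mk1 -natr1 opprD addrA; congr (w _ * _).
      apply/rowP => j; rewrite !mxE /= ffunE.
      have [->|jk] := eqVneq j k; last by rewrite mulr0 subr0.
      by rewrite ?eqxx mk1 -natr1 /= mulr1; ring.
    have mkn : m k = n :> nat by apply/eqP; rewrite eqn_leq mn -ltnS ltn_ord.
    have mk1 : ordS (m k) = 0%N :> nat by rewrite /= mkn modnn.
    rewrite mk1 subr0 mkn.
    have [HK _ K20 K21] := HP.
    have /andP[T2 Tn] := Tx k.
    have -> : H (T x k - n%:R - 1) = 0.
      have -> : T x k - n%:R - 1 = T x k - n.+1%:R by rewrite -natr1; ring.
      by rewrite HK !K20 ?subrr//; lra.
    by rewrite HK !K21 ?subrr ?mul0r ?mulr0//; lra.
  transitivity (h^-1 * (\sum_m w (z m) * W m - \sum_m w (z m) * (H (T x k - (m k)%:R - 1) * P1 m))).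
    rewrite -sumrB mulr_sumr; apply: eq_bigr => m _; rewrite WE; ring.
  by rewrite shift -sumrB mulr_sumr; apply: eq_bigr => m _; ring.
have -> : a = \sum_m W m * a by rewrite -mulr_suml W1 mul1r.
have -> : b = \sum_m W m * b by rewrite -mulr_suml W1 mul1r.
apply/andP; split; apply: ler_sum => m _.
  have [->|/Wz/andP[am _]] := eqVneq (W m) 0; first by rewrite !mul0r.
  exact: ler_wpM2l.
have [->|/Wz/andP[_ mb]] := eqVneq (W m) 0; first by rewrite !mul0r.
exact: ler_wpM2l.
Qed.

End quasi_interpolation.

(** * Lipschitz domains and piecewise linear functions *)

Section continuity_rV.
Variable R : realType.

Lemma continuous_rV (X : topologicalType) n (f : X -> 'rV[R]_n) (x : X) :
  (forall i, {for x, continuous (fun y => f y 0 i)}) -> {for x, continuous f}.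
Proof.
move=> cf; apply/cvg_ballP => e e0.
have /filter_forall : forall i, \forall y \near x, `|f x 0 i - f y 0 i| < e.
  by move=> i; have /cvgrPdist_lt := cf i; exact.
by apply: filterS => y fy; apply/(ball_rVP _ _ e0).
Qed.

Lemma continuous_mulmxr m n (O : 'M[R]_(m, n)) :
  continuous (fun x : 'rV[R]_m => x *m O).
Proof.
move=> x; apply: continuous_rV => i.
rewrite (_ : (fun y : 'rV_m => _) = aff (col i O) 0); first exact: continuous_aff.
by apply/funext => y; rewrite affE mxE addr0; apply: eq_bigr => j _; rewrite mxE.
Qed.

Lemma continuous_homothety n (c : 'rV[R]_n) s :
  continuous (fun x : 'rV[R]_n => c + s *: (x - c)).
Proof.
move=> x; apply: continuous_rV => i.
rewrite (_ : (fun y => _) = aff (s *: delta_mx i 0) ((1 - s) * c 0 i)).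
  exact: continuous_aff.
apply/funext => y; rewrite affE (bigD1 i)//= big1 => [|j /negbTE ji]; rewrite !mxE ?ji ?eqxx /=.
  by ring.
by rewrite !mulr0.
Qed.

Lemma continuous_line n (y v : 'rV[R]_n) : continuous (fun s : R => s *: v + y).
Proof.
move=> s; apply: continuous_rV => i.
rewrite (_ : (fun t => _) = (fun t : R => t * v 0 i + y 0 i)); last first.
  by apply/funext => t; rewrite !mxE.
apply: (@continuousD _ _ _ (fun t : R => t * v 0 i) (cst (y 0 i))).
  by apply: (@continuousM _ _ id (cst (v 0 i))) => //; exact: cst_continuous.
exact: cst_continuous.
Qed.

End continuity_rV.

Section affine_functions.
Variables (R : realType) (d : nat).
Implicit Types (p : 'cV[R]_d) (q : R) (y z : 'rV[R]_d).

Lemma aff_comb (I : finType) p q (w : I -> R) (x : I -> 'rV[R]_d) : \sum_i w i = 1 ->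
  aff p q (\sum_i w i *: x i) = \sum_i w i * aff p q (x i).
Proof.
move=> w1; rewrite /aff mulmx_suml summxE -[in LHS](mulr1 q) -{1}w1 mulr_sumr -big_split.
by apply: eq_bigr => i _; rewrite -scalemxAl mxE /=; ring.
Qed.

Lemma aff_homothety p q y z s :
  aff p q (y + s *: (z - y)) = (1 - s) * aff p q y + s * aff p q z.
Proof. by rewrite /aff mulmxDl -scalemxAl mulmxBl !mxE; ring. Qed.

Lemma aff_line p q y k s : aff p q (s *: delta_mx 0 k + y) = s * p k 0 + aff p q y.
Proof. by rewrite /aff mulmxDl -scalemxAl -rowE !mxE; ring. Qed.

Lemma is_derive_aff p q y k : is_derive y (delta_mx 0 k) (aff p q) (p k 0).
Proof.
apply: is_derive_line; under eq_fun do rewrite aff_line.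
apply: (is_derive_eq (is_deriveD (is_deriveM (is_derive_id (0 : R) (1 : R))
  (is_derive_cst (p k 0 : R) _ _)) (is_derive_cst _ _ _))).
by rewrite addr0 scaler0 add0r /GRing.scale /= mulr1.
Qed.

Lemma aff_sum (I : finType) (v : I -> R) (p : I -> 'cV[R]_d) (q : I -> R) y :
  \sum_i v i * aff (p i) (q i) y = aff (\sum_i v i *: p i) (\sum_i v i * q i) y.
Proof.
rewrite /aff mulmx_sumr summxE -big_split; apply: eq_bigr => i _.
by rewrite -scalemxAr [in RHS]mxE /=; ring.
Qed.

End affine_functions.

Section lipschitz_domain.
Variables (R : realType) (d : nat) (Om : set 'rV[R]_d).
Hypothesis oOm : open Om.
Hypothesis lipOm : lipschitz_boundary Om.

Lemma lipschitz_setT_continuous n (gam : 'rV[R]_n -> R) :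
  [lipschitz gam y | y in setT] -> continuous gam.
Proof.
move=> [M [_ ML]] y; apply/(@cvgrPdist_lt _ _ _ (nbhs y) _ gam) => e e0.
pose L := `|M| + 1.
have L0 : 0 < L by rewrite ltr_wpDl.
have ML' : forall a b : 'rV[R]_n, `|gam a - gam b| <= L * `|a - b|.
  have : M < L by rewrite (le_lt_trans (ler_norm M))// ltrDl.
  by move=> /ML h a b; apply: (h (a, b)).
near=> z; apply: (le_lt_trans (ML' _ _)); rewrite -ltr_pdivlMl//.
near: z; apply/nbhs_ballP; exists (L^-1 * e); first by rewrite /= mulr_gt0// invr_gt0.
by move=> z; rewrite -ball_normE.
Unshelve. all: by end_near. Qed.

(* Straight below a boundary point the domain is absent, because it lies locally
   strictly above a graph. *)
Lemma boundary_not_interior_closure y : boundary Om y -> ~ nbhs y (closure Om).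
Proof.
move=> By; have [Qm [k [gam [QQ gamL nearE]]]] := lipOm By.
have cgam := lipschitz_setT_continuous gamL.
have nOmy : ~ Om y by case: By => _; rewrite (proj1 (interior_id Om) oOm).
move=> cly.
have cG : continuous (fun x : 'rV[R]_d => gam (col' k (x *m Qm)) - (x *m Qm) 0 k).
  have ccoord j : continuous (fun x : 'rV[R]_d => (x *m Qm) 0 j).
    move=> x; apply: (@continuous_comp _ _ _ (fun x : 'rV[R]_d => x *m Qm) (fun x : 'rV[R]_d => x 0 j)).
      exact: continuous_mulmxr.
    exact: coord_continuous.
  move=> x.
  apply: (@continuousB _ _ _ (fun x : 'rV[R]_d => gam (col' k (x *m Qm))) (fun x => (x *m Qm) 0 k)).
    apply: (@continuous_comp _ _ _ (fun x : 'rV[R]_d => col' k (x *m Qm)) gam).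
      apply: continuous_rV => j.
      rewrite (_ : (fun _ => _) = (fun x : 'rV[R]_d => (x *m Qm) 0 (lift k j))); first exact: ccoord.
      by apply/funext => z; rewrite mxE.
    exact: cgam.
  exact: ccoord.
(* The downward vertical direction, pulled back through the orthogonal change of coordinates. *)
pose v : 'rV[R]_d := - (delta_mx 0 k *m Qm^T).
have vQ : v *m Qm = - delta_mx 0 k.
  by rewrite mulNmx -mulmxA (mulmx1C QQ) mulmx1.
(* A point below y at which both neighbourhood facts still hold. It is strictly below the graph, an
   open condition, so no point of [Om] is near it although it lies in the closure. *)
have [s [s0 near1 near2]] : exists s : R, [/\ 0 < s, closure Om (s *: v + y) &
    nbhs (s *: v + y) (fun x => Om x <-> gam (col' k (x *m Qm)) < (x *m Qm) 0 k)].
  have c0 := @continuous_line R d y v 0.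
  have E0 : 0 *: v + y = y by rewrite scale0r add0r.
  have nE : nbhs (0 *: v + y) (fun x => nbhs x (fun x => Om x <-> gam (col' k (x *m Qm)) < (x *m Qm) 0 k)).
    by rewrite E0; exact: nbhs_interior.
  have ncl : nbhs (0 *: v + y) (closure Om) by rewrite E0.
  have : \forall s \near (0 : R), closure Om (s *: v + y) /\
      nbhs (s *: v + y) (fun x => Om x <-> gam (col' k (x *m Qm)) < (x *m Qm) 0 k).
    by apply: filterI; [exact: c0 ncl|exact: c0 nE].
  move=> /nbhs_ballP[e /= e0 eP].
  have [] := eP (e / 2).
    by rewrite -ball_normE /= sub0r normrN gtr0_norm ?divr_gt0// gtr_pMr// invf_lt1// ltr1n.
  by exists (e / 2); split=> //; exact: divr_gt0.
have below : 0 < gam (col' k ((s *: v + y) *m Qm)) - ((s *: v + y) *m Qm) 0 k.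
  have : ~ gam (col' k (y *m Qm)) < (y *m Qm) 0 k.
    by move=> h; apply: nOmy; apply/(nbhs_singleton nearE).
  move/negP; rewrite -leNgt mulmxDl -scalemxAl vQ.
  have -> : col' k (s *: - delta_mx 0 k + y *m Qm) = col' k (y *m Qm).
    apply/rowP => j; rewrite !mxE /= [lift k j == k]eq_sym (negbTE (neq_lift _ _)).
    by rewrite ?andbF oppr0 mulr0 add0r.
  by move=> h; rewrite !(mxE, eqxx) /= in h *; lra.
have nb : nbhs (s *: v + y) (fun x => 0 < gam (col' k (x *m Qm)) - (x *m Qm) 0 k).
  exact: (cG (s *: v + y) _ (lt_nbhsr below)).
have [z [Omz [/= z1 z2]]] := near1 _ (filterI near2 nb).
by have := z1.1 Omz; lra.
Qed.

End lipschitz_domain.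

(** * Barycentric coordinates and finite element functions *)

Section finite_element_space.
Variables (R : realType) (d : nat) (Om : set 'rV[R]_d) (N : nat).
Variables (x : 'I_N -> 'rV[R]_d) (T : {set {set 'I_N}}) (phi : 'I_N -> 'rV[R]_d -> R).
Hypothesis d0 : (0 < d)%N.
Hypothesis oOm : open Om.
Hypothesis lipOm : lipschitz_boundary Om.
Hypothesis tri : triangulation x T Om.
Hypothesis nod : nodal_basis x T Om phi.

(** Membership in T sits inside the existential, with default (0, 0), so that [slope] and [offset]
    can be chosen as total functions of t. *)
Lemma local_affine (t : {set 'I_N}) (i : 'I_N) : exists pq : 'cV[R]_d * R,
  t \in T -> forall y, hull x t y -> phi i y = aff pq.1 pq.2 y.
Proof.
have [tT|tT] := boolP (t \in T); last by exists (0, 0).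
have [_ _ /(_ _ tT)[p [q pq]]] := nod i.
by exists (p, q).
Qed.

Definition slope t i : 'cV[R]_d := (projT1 (cid (local_affine t i))).1.
Definition offset t i : R := (projT1 (cid (local_affine t i))).2.
(** The affine extension of phi_i from t to the whole space. For t in T this is the barycentric
    coordinate of the vertex x_i, or 0 if x_i is not a vertex of t. *)
Definition lam t i : 'rV[R]_d -> R := aff (slope t i) (offset t i).

Lemma phi_hull t i y : t \in T -> hull x t y -> phi i y = lam t i y.
Proof. by rewrite /lam /slope /offset; case: cid => pq /= + tT; apply. Qed.

Lemma hull_vertex (t : {set 'I_N}) i : i \in t -> hull x t (x i).
Proof.
move=> it; exists (fun j => (j == i)%:R); split=> [j|j jt||].
- exact: ler0n.
- by apply/eqP; rewrite pnatr_eq0 eqb0; apply: contraNneq jt => ->.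
- by rewrite (bigD1 i)//= eqxx big1 ?addr0// => j /negbTE ->.
- by rewrite (bigD1 i)//= eqxx scale1r big1 ?addr0// => j /negbTE ->; rewrite scale0r.
Qed.

Lemma lam_vertex t i j : t \in T -> j \in t -> lam t i (x j) = (i == j)%:R.
Proof.
move=> tT jt; rewrite -phi_hull//; last exact: hull_vertex.
by have [->] := nod i.
Qed.

(** The matrix with rows (1, x_i), i in t, is square because t has d + 1 vertices; affine
    independence makes it row free, hence row full. Signs of the weights are left open, so y ranges
    over the whole space. *)
Lemma barycentric (t : {set 'I_N}) (y : 'rV[R]_d) : t \in T -> exists w : 'I_N -> R,
  [/\ forall i, i \notin t -> w i = 0, \sum_i w i = 1 & y = \sum_i w i *: x i].
Proof.
move=> tT.
have sumt (V : nmodType) (F : 'I_N -> V) : (forall i, i \notin t -> F i = 0) ->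
    \sum_i F i = \sum_(i < #|t|) F (enum_val i).
  move=> F0; rewrite (bigID (mem t)) /= [X in _ + X]big1// addr0.
  by rewrite big_enum_val.
pose X : 'M[R]_(#|t|, 1 + d) := \matrix_i row_mx 1%:M (x (enum_val i)).
pose ext (v : 'rV[R]_#|t|) (i : 'I_N) : R :=
  if pselect (i \in t) is left it then v 0 (enum_rank_in it i) else 0.
have ext_val v i : ext v (enum_val i) = v 0 i.
  rewrite /ext; case: pselect => [it|]; last by rewrite enum_valP.
  by rewrite enum_valK_in.
have ext0 v i : i \notin t -> ext v i = 0.
  by rewrite /ext; case: pselect => // it; rewrite it.
have Xl i : X i (lshift d 0) = 1 by rewrite mxE row_mxEl mxE.
have Xr i k : X i (rshift 1 k) = x (enum_val i) 0 k by rewrite mxE row_mxEr.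
have extX0 v : (v *m X) 0 (lshift d 0) = \sum_i ext v i.
  rewrite (sumt R (ext v)); last exact: ext0.
  by rewrite mxE; apply: eq_bigr => i _; rewrite Xl mulr1 ext_val.
have extX v k : (v *m X) 0 (rshift 1 k) = (\sum_i ext v i *: x i) 0 k.
  rewrite (sumt _ (fun i => ext v i *: x i)); last by move=> i /ext0 ->; rewrite scale0r.
  rewrite summxE mxE; apply: eq_bigr => i _.
  by rewrite Xr ext_val [RHS]mxE.
have freeX : row_free X.
  apply: inj_row_free => v vX0; apply/rowP => i; rewrite [RHS]mxE -ext_val.
  apply: (tri_nondeg tri tT) => [||].
  - exact: ext0.
  - by rewrite -extX0 vX0 mxE.
  - by apply/rowP => k; rewrite -extX vX0 !mxE.
have fullX : row_full X.
  by move: freeX; rewrite /row_free /row_full => /eqP ->; rewrite (tri_card tri tT).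
have /submxP[v vE] : (row_mx (1%:M : 'M[R]_1) y <= X)%MS by exact: submx_full.
exists (ext v); split.
- exact: ext0.
- by rewrite -extX0 -vE row_mxEl mxE.
- by apply/rowP => k; rewrite -extX -vE row_mxEr.
Qed.

Lemma lam_barycentric (t : {set 'I_N}) (w : 'I_N -> R) j : t \in T ->
  (forall i, i \notin t -> w i = 0) -> \sum_i w i = 1 ->
  lam t j (\sum_i w i *: x i) = w j.
Proof.
move=> tT w0 w1; rewrite /lam aff_comb// (bigID (mem t)) /= [X in _ + X]big1 ?addr0; last first.
  by move=> i /w0 ->; rewrite mul0r.
under eq_bigr do rewrite -/(lam t j _).
rewrite (eq_bigr (fun i => w i * (j == i)%:R)); last first.
  by move=> i it; rewrite lam_vertex.
have [jt|jt] := boolP (j \in t).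
  by rewrite (bigD1 j)//= eqxx mulr1 big1 ?addr0// => i /andP[_ /negbTE]; rewrite eq_sym => ->; rewrite mulr0.
rewrite w0// big1// => i it; have [ji|_] := eqVneq j i; last by rewrite mulr0.
by rewrite ji it in jt.
Qed.

Lemma lam_notin (t : {set 'I_N}) i y : t \in T -> i \notin t -> lam t i y = 0.
Proof.
by move=> tT it; have [w [w0 w1 ->]] := barycentric y tT; rewrite lam_barycentric// w0.
Qed.

Lemma sum_lam (t : {set 'I_N}) y : t \in T -> \sum_i lam t i y = 1.
Proof.
move=> tT; have [w [w0 w1 ->]] := barycentric y tT; rewrite -[RHS]w1.
by apply: eq_bigr => i _; rewrite lam_barycentric.
Qed.

Lemma hullP (t : {set 'I_N}) y : t \in T ->
  hull x t y <-> forall i, i \in t -> 0 <= lam t i y.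
Proof.
move=> tT; split=> [[w [wge w0 w1 ->]] i it|lam0]; first by rewrite lam_barycentric.
have [w [w0 w1 yE]] := barycentric y tT; exists w; split=> // i.
have [it|/w0 ->//] := boolP (i \in t).
by have := lam0 _ it; rewrite yE lam_barycentric.
Qed.

Lemma phi_ge0 i y : closure Om y -> 0 <= phi i y.
Proof.
rewrite (tri_cover tri) => -[t /= tT yt]; rewrite (phi_hull _ tT yt).
have [it|it] := boolP (i \in t); last by rewrite lam_notin.
by have /hullP := yt; apply.
Qed.

Lemma sum_phi y : closure Om y -> \sum_i phi i y = 1.
Proof.
rewrite (tri_cover tri) => -[t /= tT yt].
by rewrite -(sum_lam y tT); apply: eq_bigr => i _; exact: phi_hull.
Qed.

Lemma phi_le1 i y : closure Om y -> phi i y <= 1.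
Proof.
move=> yOm; rewrite -(sum_phi yOm) (bigD1 i)//= lerDl sumr_ge0// => j _.
exact: phi_ge0.
Qed.

Lemma slope_neq0 (t : {set 'I_N}) i : t \in T -> i \in t -> slope t i != 0.
Proof.
move=> tT it; apply/eqP => s0.
have [j jt ji] : exists2 j, j \in t & j != i.
  have : (1 < #|t|)%N by rewrite (tri_card tri tT).
  by rewrite (cardsD1 i) it ltnS => /card_gt0P[j]; rewrite finset.in_setD1 => /andP[ji jt]; exists j.
have := lam_vertex i tT it; have := lam_vertex i tT jt.
rewrite /lam /aff s0 !mulmx0 !mxE eqxx eq_sym (negbTE ji) => ->.
by move/eqP; rewrite eq_sym oner_eq0.
Qed.

Definition simplex_int (t : {set 'I_N}) : set 'rV[R]_d :=
  [set y | forall i, i \in t -> 0 < lam t i y].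

Lemma continuous_lam t i : continuous (lam t i).
Proof. exact: continuous_aff. Qed.

Lemma open_simplex_int t : open (simplex_int t).
Proof.
rewrite openE => y yt.
have /filter_forall : forall i, \forall z \near y, i \in t -> 0 < lam t i z.
  move=> i; have [it|it] := boolP (i \in t); last exact: (filterE (F := nbhs y)).
  have := @continuous_lam t i y _ (lt_nbhsr (yt _ it)).
  by apply: (@filterS _ (nbhs y)) => z h _.
by apply: (@filterS _ (nbhs y)) => z.
Qed.

Lemma simplex_int_hull t : t \in T -> simplex_int t `<=` hull x t.
Proof. by move=> tT y yt; apply/hullP => // i it; exact/ltW/yt. Qed.

(** Whole hyperplanes spanned by the facets, a set that is visibly closed and null, and off which
    each point of [closure Om] is in an open simplex. *)
Definition faces : set 'rV[R]_d :=
  \bigcup_(ti in [set ti : {set 'I_N} * 'I_N | (ti.1 \in T) && (ti.2 \in ti.1)])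
    [set y | lam ti.1 ti.2 y = 0].

Lemma closed_faces : closed faces.
Proof.
apply: closed_bigcup => [|[t i] _]; first exact: finite_finset.
rewrite (_ : [set _ | _] = lam t i @^-1` [set 0])//.
by apply: preimage_closed; [move=> y _; exact: continuous_lam|exact: closed_eq].
Qed.

Lemma measurable_faces : measurable faces.
Proof. apply: closed_measurable_rV; exact: closed_faces. Qed.

Lemma lebesgue_faces : lebesgue_rV R d faces = 0%E.
Proof.
apply/negligibleP; first exact: measurable_faces.
rewrite /faces.
have -> : [set ti : {set 'I_N} * 'I_N | (ti.1 \in T) && (ti.2 \in ti.1)] =
    [set` [seq ti <- enum [set: {set 'I_N} * 'I_N]%SET | (ti.1 \in T) && (ti.2 \in ti.1)]].
  by apply/seteqP; split=> ti /=; rewrite mem_filter mem_enum finset.in_setT andbT.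
rewrite bigcup_seq big_seq.
apply: (big_ind (fun A => (lebesgue_rV R d).-negligible A)).
- exact: negligible_set0.
- by move=> A B; exact: negligibleU.
- move=> [t i]; rewrite mem_filter /= => /andP[/andP[tT it] _].
  apply/negligibleP; first exact: measurable_hyperplane.
  by apply: lebesgue_rV_hyperplane; exact: slope_neq0.
Qed.

Lemma not_faces y : closure Om y -> ~ faces y -> exists2 t, t \in T & simplex_int t y.
Proof.
rewrite (tri_cover tri) => -[t /= tT yt] yf; exists t => // i it.
rewrite lt_neqAle; apply/andP; split; last by have /hullP := yt; apply.
by apply/eqP => e; apply: yf; exists (t, i) => //=; rewrite tT it.
Qed.

Lemma partial_phi t i k y : t \in T -> simplex_int t y ->
  partial (phi i) k y = slope t i k 0.
Proof.
move=> tT yt; have : is_derive y (delta_mx 0 k) (phi i) (slope t i k 0).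
  apply: (@near_eq_is_derive _ _ _ (lam t i)); last exact: is_derive_aff.
  have := @open_simplex_int t; rewrite openE => /(_ _ yt).
  apply: (@filterS _ (nbhs y)) => z zt; rewrite -phi_hull//; exact: simplex_int_hull.
by rewrite /partial => -[].
Qed.

Lemma phi_continuous_in i y : Om y -> {for y, continuous (phi i)}.
Proof.
move=> yOm; have [_ cphi _] := nod i.
have : {within Om, continuous (phi i)}.
  by apply: continuous_subspaceW cphi; exact: subset_closure.
by rewrite continuous_open_subspace// => /(_ y); apply; rewrite inE.
Qed.

(* Shrinking towards x_i maps a neighbourhood of y into the star of x_i, and the
   inverse dilation keeps the barycentric coordinates nonnegative. *)
Lemma support_interior i (y : 'rV[R]_d) : Om (x i) -> closure Om y -> phi i y != 0 ->
  nbhs y (closure Om).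
Proof.
move=> xiOm yOm phi0.
have [t tT yt] : exists2 t, t \in T & hull x t y.
  by move: (yOm); rewrite (tri_cover tri) => -[t /= tT yt]; exists t.
have it : i \in t.
  by apply: contraNT phi0 => it; rewrite (phi_hull _ tT yt) lam_notin.
pose ci s (z : 'rV[R]_d) := x i + s *: (z - x i).
have lam_ci (t' : {set 'I_N}) j s z : t' \in T -> i \in t' ->
    lam t' j (ci s z) = (1 - s) * (j == i)%:R + s * lam t' j z.
  by move=> tT' it'; rewrite /lam aff_homothety -!/(lam t' j _) lam_vertex.
have nci : nbhs (ci 0 y) Om.
  by rewrite /ci scale0r addr0; exact: open_nbhs_nbhs.
have [s [s0 s1 yOms]] : exists s : R, [/\ 0 < s, s < 1 & Om (ci s y)].
  have cc : {for (0 : R), continuous (fun s : R => ci s y)}.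
    have := @continuous_line R d (x i) (y - x i) 0.
    by under eq_fun do rewrite addrC.
  have /nbhs_ballP[e /= e0 eP] := cc _ nci.
  exists (Num.min (e / 2) (1 / 2)); split.
  - by rewrite lt_min !divr_gt0.
  - by rewrite gt_min; apply/orP; right; lra.
  apply: eP; rewrite -ball_normE /= sub0r normrN gtr0_norm; last by rewrite lt_min !divr_gt0.
  by rewrite gt_min ltr_pdivrMr// ltr_pMr// ltr1n.
(* The contraction sends coordinate i to (1 - s) + s * lam, so exceeding 1 - s says that the
   coordinate of the original point is positive; this open condition passes to all z near y. *)
have phis : 1 - s < phi i (ci s y).
  have cit : hull x t (ci s y).
    apply/hullP => // j jt; rewrite lam_ci//.
    have /hullP := yt => /(_ tT j jt) lj.
    by rewrite addr_ge0// mulr_ge0// ?ltW// subr_gt0.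
  rewrite (phi_hull _ tT cit) lam_ci// eqxx mulr1 ltrDl mulr_gt0//.
  by rewrite -(phi_hull i tT yt) lt_neqAle eq_sym phi0 phi_ge0.
have nz : nbhs (ci s y) (fun z => Om z /\ 1 - s < phi i z).
  apply: filterI; first exact: open_nbhs_nbhs.
  exact: (phi_continuous_in yOms (lt_nbhsr phis)).
have := @continuous_homothety R d (x i) s y _ nz.
apply: (@filterS _ (nbhs y)) => z [cz phiz].
rewrite (tri_cover tri).
have : closure Om (ci s z) by exact: subset_closure.
rewrite (tri_cover tri) => -[t' /= tT' zt']; exists t' => //=.
have it' : i \in t'.
  apply: contraLR phiz => it'; rewrite -leNgt (phi_hull _ tT' zt') lam_notin//.
  by rewrite subr_ge0 ltW.
move: phiz; rewrite (phi_hull _ tT' zt') lam_ci// eqxx mulr1 ltrDl pmulr_rgt0// => phiz.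
apply/hullP => // j jt'; have [->|ji] := eqVneq j i; first exact: ltW.
have /hullP := zt' => /(_ tT' j jt'); rewrite lam_ci// (negbTE ji) mulr0 add0r.
by rewrite pmulr_rge0.
Qed.

(** Boundary faces are not marked in the triangulation. Instead, a boundary point with phi_i nonzero
    would be interior to [closure Om], which the Lipschitz graph forbids. *)
Lemma phi_boundary i y : Om (x i) -> boundary Om y -> phi i y = 0.
Proof.
move=> xiOm yB; apply/eqP/negPn/negP => phi0.
apply: (boundary_not_interior_closure oOm lipOm yB).
by apply: (support_interior xiOm) phi0; case: yB.
Qed.

Definition fe (v : 'I_N -> R) (y : 'rV[R]_d) : R := \sum_i v i * phi i y.
Definition fe_slope (v : 'I_N -> R) t : 'cV[R]_d := \sum_i v i *: slope t i.
Definition fe_offset (v : 'I_N -> R) t : R := \sum_i v i * offset t i.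

Lemma fe_hull v t y : t \in T -> hull x t y -> fe v y = aff (fe_slope v t) (fe_offset v t) y.
Proof.
by move=> tT yt; rewrite -aff_sum; apply: eq_bigr => i _; rewrite (phi_hull _ tT yt).
Qed.

Lemma fe_vertex v i : fe v (x i) = v i.
Proof.
rewrite /fe (bigD1 i)//= big1 => [|j ji]; have [phix _ _] := nod i.
  by rewrite phix eqxx mulr1 addr0.
have [phij _ _] := nod j; by rewrite phij (negbTE ji) mulr0.
Qed.

Lemma fe_boundary v y : (forall i, v i != 0 -> Om (x i)) -> boundary Om y -> fe v y = 0.
Proof.
move=> vOm yB; apply: big1 => i _; have [->|/vOm xiOm] := eqVneq (v i) 0.
  by rewrite mul0r.
by rewrite phi_boundary// mulr0.
Qed.

Lemma fe_bound v y : closure Om y -> `|fe v y| <= \sum_i `|v i|.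
Proof.
move=> yOm; apply: (le_trans (ler_norm_sum _ _ _)); apply: ler_sum => i _.
by rewrite normrM (ger0_norm (phi_ge0 i yOm)) ler_piMr// phi_le1.
Qed.

Lemma fe_continuous v : {within closure Om, continuous (fe v)}.
Proof.
apply: (@continuous_big R 'I_N +%R 0 xpredT (@add_continuous R) (subspace (closure Om))
  (index_enum _) (fun i y => v i * phi i y)) => i _ y.
apply: (@continuousM R (subspace (closure Om)) (cst (v i)) (phi i) y); first exact: cst_continuous.
by have [_ cphi _] := nod i; exact: cphi.
Qed.

Lemma fe_partial v t k y : t \in T -> simplex_int t y ->
  \sum_i v i * partial (phi i) k y = fe_slope v t k 0.
Proof.
move=> tT yt; rewrite /fe_slope summxE; apply: eq_bigr => i _.
by rewrite (partial_phi _ _ tT yt) mxE.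
Qed.

End finite_element_space.

(** Continuous induction on the set of points up to which the bound holds: its supremum belongs to
    it and can be pushed further right. The local bound compares r with the centre s alone. *)
Lemma pointwise_lipschitz (R : realType) (g : R -> R) (L a b : R) : a <= b ->
  (forall s, a <= s <= b -> \forall r \near s, a <= r <= b -> `|g r - g s| <= L * `|r - s|) ->
  `|g b - g a| <= L * (b - a).
Proof.
move=> ab loc.
pose E := [set s | a <= s <= b /\ `|g s - g a| <= L * (s - a)].
have Ea : E a by split; rewrite ?lexx ?ab// !subrr normr0 mulr0.
have supE : has_sup E by split; [exists a|exists b => s [/andP[]]].
pose c := sup E.
have ac : a <= c by exact: sup_upper_bound.
have cb : c <= b by apply: ge_sup; [exists a|move=> s [/andP[]]].
have acb : a <= c <= b by rewrite ac cb.
have /nbhs_ballP[e /= e0 eP] := loc c acb.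
have Ec : E c.
  have [s Es cs] := sup_adherent e0 supE.
  have sc : s <= c by exact: sup_upper_bound.
  have [/andP[as_ sb] gs] := Es.
  have := eP s; rewrite -ball_normE /= ger0_norm ?subr_ge0// => h.
  have {h} : `|g s - g c| <= L * `|s - c|.
    by apply: h; rewrite ?as_ ?sb// -/c in cs *; lra.
  rewrite [in X in _ <= X]distrC (ger0_norm (x := c - s)) ?subr_ge0// distrC => gsc.
  split=> //; have := ler_distD (g s) (g c) (g a); lra.
have [//|bc] := leP b c; last first.
  have r0 : 0 < Num.min (e / 2) (b - c) by rewrite lt_min divr_gt0// subr_gt0.
  set r := Num.min _ _ in r0.
  have re : r < e by rewrite gt_min ltr_pdivrMr// ltr_pMr// ltr1n.
  have rb : r <= b - c by rewrite ge_min lexx orbT.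
  have : E (c + r).
    have crb : a <= c + r <= b by apply/andP; split; lra.
    have := eP (c + r); rewrite -ball_normE /= opprD addNKr normrN gtr0_norm// => /(_ re crb).
    have -> : c + r - c = r by ring.
    rewrite (gtr0_norm r0) => gr.
    case: Ec => _ gc; split=> //; have := ler_distD (g c) (g (c + r)) (g a); lra.
  by move=> /(sup_upper_bound supE); rewrite -/c; lra.
move=> bc; have -> : b = c by apply/eqP; rewrite eq_le bc cb.
by case: Ec.
Qed.

(** * The convective term *)

Section soft_threshold.
Variables (R : realType) (de : R).
Hypothesis de0 : 0 < de.
Implicit Types a b m e s : R.

Definition soft s : R := if de <= s then s - de else if s <= - de then s + de else 0.

Lemma soft_err s : `|s - soft s| <= de.
Proof.
rewrite /soft; case: ifPn => [_|]; first by rewrite opprB addrC subrK gtr0_norm.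
rewrite -ltNge => sd; case: ifPn => [_|].
  by rewrite opprD addrA subrr sub0r normrN gtr0_norm.
by rewrite -ltNge subr0 ler_norml => ds; rewrite !ltW.
Qed.

Lemma soft_eq0 s : `|s| < de -> soft s = 0.
Proof.
rewrite ltr_norml => /andP[s1 s2]; rewrite /soft.
by rewrite leNgt s2 leNgt s1.
Qed.

Lemma soft_lip a b : `|soft a - soft b| <= `|a - b|.
Proof.
wlog ba : a b / b <= a.
  by move=> h; have [/h//|/ltW/h] := leP b a; rewrite distrC [leRHS]distrC.
have [s1 s2] : 0 <= soft a - soft b /\ soft a - soft b <= a - b.
  rewrite /soft; case: (leP de a) => ?; case: (leP de b) => ?;
  case: (leP a (- de)) => ?; case: (leP b (- de)) => ? /=; have := de0; split; lra.
by rewrite !ger0_norm// subr_ge0.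
Qed.

Lemma soft0 : soft 0 = 0.
Proof. by rewrite soft_eq0// normr0. Qed.

Lemma soft_norm s : `|soft s| <= `|s|.
Proof. by have := soft_lip s 0; rewrite soft0 !subr0. Qed.

Lemma soft_continuous : continuous soft.
Proof.
move=> s; apply/cvgrPdist_lt => e e0; near=> r.
apply: (le_lt_trans (soft_lip _ _)); near: r.
exact: cvgr_dist_lt.
Unshelve. all: by end_near. Qed.

(* soft ^+ 2 is convex with derivative 2 * soft. *)
Lemma soft_sqr_convex a b : 2 * soft b * (a - b) <= soft a ^+ 2 - soft b ^+ 2.
Proof.
have : 0 <= soft b * ((b - soft b) - (a - soft a)).
  have := soft_err a; rewrite ler_norml => /andP[a1 a2].
  rewrite {1 2}/soft; case: ifPn => [b1|_]; first by apply: mulr_ge0; lra.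
  by case: ifPn => [b1|_]; [apply: mulr_le0; lra|rewrite mul0r].
have := sqr_ge0 (soft a - soft b); nra.
Qed.

(** Convexity applied at both ends encloses the increment between 2 soft(b) (a - b) and 2 soft(a) (a
    - b). With m = 0 this gives a Lipschitz bound, with m = soft(V y) the limit of difference
    quotients at y. *)
Lemma soft_sqr_diff a b m e : `|soft a - m| <= e -> `|soft b - m| <= e ->
  `|soft a ^+ 2 - soft b ^+ 2 - 2 * m * (a - b)| <= 2 * e * `|a - b|.
Proof.
wlog ba : a b / b <= a.
  move=> h ea eb; have [ba|/ltW ab] := leP b a; first exact: h.
  have := h _ _ ab eb ea; rewrite (distrC b a); congr (_ <= _).
  by rewrite -[LHS]normrN; congr (`|_|); ring.
move=> ea eb; have := soft_sqr_convex a b; have := soft_sqr_convex b a.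
rewrite (ger0_norm (x := a - b)) ?subr_ge0//.
move: ea eb; rewrite !ler_norml => /andP[? ?] /andP[? ?] ? ?.
by apply/andP; split; nra.
Qed.

End soft_threshold.

(** * Bounded measurable functions on a set of finite measure *)

Section bounded_measurable.
Variables (dd : measure_display) (X : measurableType dd) (R : realType).
Variables (mu : {measure set X -> \bar R}) (E : set X).
Hypothesis mE : measurable E.
Hypothesis fE : (mu E < +oo)%E.
Implicit Types f g : X -> R.

(** The bound holds at every point of E, which makes the class closed under sums and products; on a
    set of finite measure its members are integrable. *)
Definition bmeas f := measurable_fun E f /\ exists C, forall x, E x -> `|f x| <= C.

Lemma bmeas_cst r : bmeas (fun=> r).
Proof. by split; [exact: measurable_cst|exists `|r|]. Qed.

Lemma bmeasD f g : bmeas f -> bmeas g -> bmeas (fun x => f x + g x).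
Proof.
move=> [mf [C fC]] [mg [C' gC]]; split; first exact: measurable_funD.
exists (C + C') => x Ex; apply: (le_trans (ler_normD _ _)).
by rewrite lerD ?fC ?gC.
Qed.

Lemma bmeasM f g : bmeas f -> bmeas g -> bmeas (fun x => f x * g x).
Proof.
move=> [mf [C fC]] [mg [C' gC]]; split; first exact: measurable_funM.
by exists (C * C') => x Ex; rewrite normrM ler_pM ?fC ?gC.
Qed.

Lemma bmeas_sum (I : Type) (r : seq I) (F : I -> X -> R) :
  (forall i, bmeas (F i)) -> bmeas (fun x => \sum_(i <- r) F i x).
Proof.
move=> bF; elim: r => [|i r IH].
  by under eq_fun do rewrite big_nil; exact: bmeas_cst.
by under eq_fun do rewrite big_cons; exact: bmeasD.
Qed.

Lemma bmeas_integrable f : bmeas f -> mu.-integrable E (EFin \o f).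
Proof.
move=> [mf [C fC]]; apply: measurable_bounded_integrable => //.
exists C; split; first exact: num_real.
by move=> y Cy x Ex; apply: (le_trans (fC _ Ex)); exact: ltW.
Qed.

Lemma bmeas_int_sum (I : Type) (r : seq I) (F : I -> X -> R) :
  (forall i, bmeas (F i)) ->
  \int[mu]_(x in E) (\sum_(i <- r) F i x) = \sum_(i <- r) \int[mu]_(x in E) F i x.
Proof.
move=> bF; elim: r => [|i r IH].
  by under eq_Rintegral do rewrite big_nil; rewrite big_nil Rintegral_cst// mul0r.
under eq_Rintegral do rewrite big_cons.
rewrite big_cons -IH RintegralD//; apply: bmeas_integrable => //.
exact: bmeas_sum.
Qed.

Lemma bmeas_intZ r f : bmeas f -> \int[mu]_(x in E) (r * f x) = r * \int[mu]_(x in E) f x.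
Proof. by move=> bf; rewrite RintegralZl//; exact: bmeas_integrable. Qed.

Lemma bmeas_int_norm f C : bmeas f -> (forall x, E x -> `|f x| <= C) ->
  `|\int[mu]_(x in E) f x| <= C * fine (mu E).
Proof.
move=> bf fC; apply: (le_trans (le_normr_Rintegral _ _)) => //.
  exact: bmeas_integrable.
rewrite -Rintegral_cst//; apply: le_Rintegral => //; last exact: bmeas_integrable (bmeas_cst C).
apply: bmeas_integrable; have [mf [C' fC']] := bf; split.
  exact: measurableT_comp.
by exists C' => x Ex; rewrite normr_id fC'.
Qed.

Lemma bmeas_cvg (F : nat -> X -> R) f C : (forall n, bmeas (F n)) -> bmeas f ->
  (forall n x, E x -> `|F n x| <= C) ->
  (forall x, E x -> F n x @[n --> \oo] --> f x) ->
  \int[mu]_(x in E) F n x @[n --> \oo] --> \int[mu]_(x in E) f x.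
Proof.
move=> bF bf FC Ff.
have mF n : measurable_fun E (EFin \o F n) by apply/measurable_EFinP; case: (bF n).
have mf : measurable_fun E (EFin \o f) by apply/measurable_EFinP; case: bf.
have cF : {ae mu, forall x, E x -> (EFin \o F n) x @[n --> \oo] --> (EFin \o f) x}.
  by apply: aeW => x Ex; apply: cvg_EFin; [exact: nearW|exact: Ff].
have FC' : {ae mu, forall x n, E x -> (`|(EFin \o F n) x| <= cst C%:E x)%E}.
  by apply: aeW => x n Ex; rewrite lee_fin FC.
have [_ _ h] := dominated_convergence mE mF mf cF (bmeas_integrable (bmeas_cst C)) FC'.
apply: fine_cvg; rewrite /Rintegral fineK; first exact: h.
exact: integrable_fin_num (bmeas_integrable bf).
Qed.

End bounded_measurable.

(** * The square of the soft threshold of V and its difference quotients *)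

Section cut_off_square.
Variables (R : realType) (d : nat) (Om : set 'rV[R]_d) (N : nat).
Variables (x : 'I_N -> 'rV[R]_d) (T : {set {set 'I_N}}) (phi : 'I_N -> 'rV[R]_d -> R).
Hypothesis oOm : open Om.
Hypothesis bOm : bounded_set Om.
Hypothesis lipOm : lipschitz_boundary Om.
Hypothesis tri : triangulation x T Om.
Hypothesis nod : nodal_basis x T Om phi.

Lemma closed_hull t : t \in T -> closed (hull x t).
Proof.
move=> tT.
have -> : hull x t = \bigcap_(i in [set i | i \in t]) (lam nod t i @^-1` [set r | 0 <= r]).
  apply/seteqP; split=> y.
    by move=> /(hullP tri nod _ tT) h i /= it; exact: h.
  by move=> h; apply/(hullP tri nod _ tT) => i it; exact: h.
apply: closed_bigI => i _; apply: preimage_closed; last exact: closed_ge.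
by move=> y _; exact: continuous_lam.
Qed.

Variable v : 'I_N -> R.

Definition fe_lip : R := \sum_t \sum_k `|fe_slope nod v t k 0|.

Lemma fe_lip_ge0 : 0 <= fe_lip.
Proof. by apply: sumr_ge0 => t _; apply: sumr_ge0. Qed.

Lemma fe_slope_le t k : `|fe_slope nod v t k 0| <= fe_lip.
Proof.
rewrite /fe_lip (bigD1 t)//= (bigD1 k)//= -addrA lerDl addr_ge0//; first exact: sumr_ge0.
by apply: sumr_ge0 => s _; apply: sumr_ge0.
Qed.

(** Simplices are closed and finite in number, so any simplex met sufficiently near a point of the
    segment contains that point: the two values come from one affine function. *)
Lemma fe_segment_le (L : R) k (y : 'rV[R]_d) (a b : R) : a <= b ->
  (forall t, t \in T -> `|fe_slope nod v t k 0| <= L) ->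
  (forall s, a <= s <= b -> closure Om (s *: delta_mx 0 k + y)) ->
  `|fe phi v (b *: delta_mx 0 k + y) - fe phi v (a *: delta_mx 0 k + y)| <= L * (b - a).
Proof.
move=> ab sL seg.
pose g s := fe phi v (s *: delta_mx 0 k + y).
apply: (@pointwise_lipschitz R g L a b ab) => s sab.
have /filter_forall : forall t, \forall r \near s, t \in T ->
    hull x t (r *: delta_mx 0 k + y) -> hull x t (s *: delta_mx 0 k + y).
  move=> t; have [ts|ts] := pselect (hull x t (s *: delta_mx 0 k + y)).
    by apply: (filterE (F := nbhs s)).
  have [tT|tT] := boolP (t \in T); last exact: (filterE (F := nbhs s)).
  have : nbhs (s *: delta_mx 0 k + y) (~` hull x t).
    by apply: open_nbhs_nbhs; split=> //; exact/closed_openC/closed_hull.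
  move=> /(@continuous_line R d y (delta_mx 0 k) s).
  by apply: (@filterS _ (nbhs s)) => r h _.
apply: (@filterS _ (nbhs s)) => r hr rab.
have := seg r rab; rewrite (tri_cover tri) => -[t /= tT tr].
have ts := hr _ tT tr.
rewrite /g !(fe_hull nod _ tT)// !aff_line opprD addrACA subrr addr0 -mulrBl mulrC normrM.
by rewrite ler_wpM2r// sL.
Qed.

Hypothesis vOm : forall i, v i != 0 -> Om (x i).
Variable de : R.
Hypothesis de0 : 0 < de.

Let V := fe phi v.

Lemma fe_continuous_in y : Om y -> {for y, continuous V}.
Proof.
move=> yOm; have : {within Om, continuous V}.
  by apply: continuous_subspaceW (@fe_continuous _ _ _ _ _ _ _ nod v); exact: subset_closure.
by rewrite continuous_open_subspace// => /(_ y); apply; rewrite inE.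
Qed.

(** The points of [closure Om] with |V| >= de form a compact set that misses the boundary, where V =
    0; compactness makes the distance uniform. *)
Lemma core_radius : exists2 rho, 0 < rho &
  forall z : 'rV[R]_d, Om z -> de <= `|V z| -> ball z rho `<=` Om.
Proof.
pose K := closure Om `&` [set z | de <= `|V z|].
have bK : bounded_set (closure Om).
  have [M [Mr bM]] := bOm; exists M; split=> // r /bM rM y.
  have cl : closed [set z : 'rV[R]_d | `|z| <= r].
    rewrite (_ : [set _ | _] = Num.norm @^-1` [set s | s <= r])//.
    by apply: preimage_closed; [move=> ? _; exact: norm_continuous|exact: closed_le].
  by move=> /(closureS rM); rewrite -(proj1 (closure_id _) cl).
have cK : compact K.
  apply: bounded_closed_compact.
    by have [M [Mr bM]] := bK; exists M; split=> // r /bM h z [zOm _]; exact: h.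
  have -> : K = \bigcup_(t in [set` T])
      (hull x t `&` [set z | de <= `|aff (fe_slope nod v t) (fe_offset nod v t) z|]).
    apply/seteqP; split=> [z [] | z [t /= tT [tz dz]]]; last first.
      split; first by rewrite (tri_cover tri); exists t.
      by rewrite /= /V (fe_hull nod _ tT tz).
    rewrite (tri_cover tri) => -[t /= tT tz] dz; exists t => //; split=> //=.
    by rewrite -(fe_hull nod _ tT tz).
  apply: closed_bigcup => [|t /= tT]; first exact: finite_finset.
  apply: closedI; first exact: closed_hull.
  rewrite (_ : [set _ | _] =
    (fun z => `|aff (fe_slope nod v t) (fe_offset nod v t) z|) @^-1` [set r | de <= r])//.
  apply: preimage_closed; last exact: closed_ge.
  move=> z _; apply: (@continuous_comp _ _ _ (aff (fe_slope nod v t) (fe_offset nod v t)) Num.norm).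
    exact: continuous_aff.
  exact: norm_continuous.
have KOm z : K z -> Om z.
  move=> [zOm dez]; apply: contrapT => nOm.
  have : boundary Om z by split=> //; rewrite (proj1 (interior_id Om) oOm).
  move=> /(fe_boundary oOm lipOm tri nod vOm) Vz0.
  by move: dez; rewrite /V /= Vz0 normr0 leNgt de0.
have : \forall r \near (0 : R)^'+, K `<=` (fun z => ball z r `<=` Om).
  apply: ((compact_near_coveringP K).1 cK _ ((0 : R)^'+) (fun r z => ball z r `<=` Om)).
  move=> z /KOm zOm.
  have /nbhs_ballP[e /= e0 eOm] : nbhs z Om by exact: open_nbhs_nbhs.
  have e20 : 0 < e / 2 by rewrite divr_gt0.
  exists (ball z (e / 2), [set r | r < e / 2]) => [|[z' r] /= [zz' re] y yr].
    by split=> /=; [exact: nbhsx_ballx|exact: nbhs_right_lt].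
  apply: eOm; rewrite [e](splitr e); apply: (ball_triangle zz').
  exact: le_ball (ltW re) _ yr.
move=> h; have [rho [hr /= r0]] := filter_ex (filterI h (nbhs_right_gt (0 : R))).
exists rho => // z zOm dz; apply: hr; split=> //; exact: subset_closure.
Qed.

(** Set to 0 outside [Om], because the basis functions are unspecified off the closure while the
    spline samples all lattice nodes. *)
Definition cut_sqr (z : 'rV[R]_d) : R := if `[< Om z >] then soft de (V z) ^+ 2 else 0.

Lemma cut_sqr_neq0 z : cut_sqr z != 0 -> Om z /\ de <= `|V z|.
Proof.
rewrite /cut_sqr; case: asboolP => [zOm sz|]; last by rewrite eqxx.
by split=> //; rewrite leNgt; apply: contra sz => /(soft_eq0) ->; rewrite expr0n.
Qed.

Let Bv : R := \sum_i `|v i|.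

(** If one end has a nonzero value, its ball of radius rho lies in [Om] and contains the segment, so
    the slopes of V apply along it; otherwise both values are 0. *)
Lemma cut_sqr_lip rho (h : R) k (z : 'rV[R]_d) :
  (forall z : 'rV[R]_d, Om z -> de <= `|V z| -> ball z rho `<=` Om) ->
  0 < h < rho -> `|cut_sqr z - cut_sqr (z - h *: delta_mx 0 k)| <= 2 * Bv * fe_lip * h.
Proof.
move=> core /andP[h0 hrho]; set z' := z - _.
have Bv0 : 0 <= Bv by exact: sumr_ge0.
have rho0 : 0 < rho by exact: lt_trans hrho.
have seg : (forall s, 0 <= s <= h -> Om (s *: delta_mx 0 k + z')) ->
    `|cut_sqr z - cut_sqr z'| <= 2 * Bv * fe_lip * h.
  move=> hs; have := @fe_segment_le fe_lip k z' 0 h (ltW h0).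
  have zE : h *: delta_mx 0 k + z' = z by rewrite addrC subrK.
  rewrite scale0r add0r zE subr0 => hV.
  have zOm : Om z by rewrite -zE; apply: hs; rewrite lexx ltW.
  have z'Om : Om z' by have := hs 0; rewrite scale0r add0r; apply; rewrite lexx ltW.
  rewrite /cut_sqr !asboolT//.
  have sV y : Om y -> `|soft de (V y) - 0| <= Bv.
    move=> yOm; rewrite subr0; apply: (le_trans (soft_norm de0 _)).
    by apply: (fe_bound tri nod); exact: subset_closure.
  have := soft_sqr_diff de0 (sV _ zOm) (sV _ z'Om).
  rewrite mulr0 mul0r subr0 => /le_trans; apply.
  rewrite -[leRHS]mulrA ler_wpM2l ?mulr_ge0//; apply: hV.
    by move=> t _; exact: fe_slope_le.
  by move=> s /hs; exact: subset_closure.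
have line s r (y : 'rV[R]_d) : `|s - r| < rho -> ball (r *: delta_mx 0 k + y) rho (s *: delta_mx 0 k + y).
  move=> srr; apply/(ball_rVP _ _ rho0) => j; rewrite !coord_line opprD addrACA subrr addr0 -mulrBl normrM distrC.
  apply: le_lt_trans srr; rewrite ler_piMr//.
  by case: (j == k); rewrite ?normr1 ?normr0.
have [wz0|/cut_sqr_neq0[zOm dz]] := eqVneq (cut_sqr z) 0; last first.
  apply: seg => s /andP[s0 sh]; apply: (core _ zOm dz).
  have sh' : `|s - h| < rho by rewrite distrC ger0_norm ?subr_ge0//; lra.
  by have := line s h z' sh'; rewrite [h *: _ + _]addrC subrK.
have [wz'0|/cut_sqr_neq0[zOm dz]] := eqVneq (cut_sqr z') 0; last first.
  apply: seg => s /andP[s0 sh]; apply: (core _ zOm dz).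
  have s0' : `|s - 0| < rho by rewrite subr0 ger0_norm//; lra.
  by have := line s 0 z' s0'; rewrite scale0r add0r.
by rewrite wz0 wz'0 subrr normr0 !mulr_ge0// ?fe_lip_ge0// ltW.
Qed.

Lemma cut_sqr_difference t k (y : 'rV[R]_d) (e : R) : t \in T -> simplex_int nod t y -> Om y ->
  0 < e -> \forall h \near (0 : R)^'+, forall z : 'rV[R]_d,
    (forall j, `|z 0 j - y 0 j| <= 3 * h) ->
    `|h^-1 * (cut_sqr z - cut_sqr (z - h *: delta_mx 0 k)) -
      2 * soft de (V y) * fe_slope nod v t k 0| <= e.
Proof.
move=> tT yt yOm e0; set s := fe_slope nod v t k 0.
pose eta := e / (2 * (`|s| + 1)).
have s1 : 0 < `|s| + 1 by rewrite ltr_wpDl.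
have eta0 : 0 < eta by rewrite divr_gt0// mulr_gt0.
have : nbhs y (fun z => [/\ Om z, simplex_int nod t z & `|V y - V z| < eta]).
  have n1 : nbhs y Om by exact: open_nbhs_nbhs.
  have n2 : nbhs y (simplex_int nod t).
    by apply: open_nbhs_nbhs; split=> //; exact: open_simplex_int.
  have n3 : nbhs y (fun z => `|V y - V z| < eta).
    by have /(@cvgrPdist_lt _ _ _ (nbhs y) _ V)/(_ _ eta0) := fe_continuous_in yOm.
  by apply: (@filterS3 _ (nbhs y) _ _ _ _ _ _ n1 n2 n3).
move=> /nbhs_ballP[r /= r0 rP].
(* z is within 3h of y and z - h e_k within 4h, both below r when h < r/5. *)
have r50 : 0 < r / 5 by rewrite divr_gt0.
near=> h.
have h0 : 0 < h by near: h; exact: nbhs_right_gt.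
have hr : h < r / 5 by near: h; exact: nbhs_right_lt.
move=> z zy; set z' := z - _.
have zb : ball y r z.
  by apply/(ball_rVP _ _ r0) => j; rewrite distrC; apply: (le_lt_trans (zy j)); lra.
have z'b : ball y r z'.
  apply/(ball_rVP _ _ r0) => j; rewrite !mxE eqxx /= opprB addrCA.
  apply: (le_lt_trans (ler_normD _ _)).
  have h1 : `|h * (j == k)%:R| <= h.
    by case: (j == k); rewrite ?mulr1 ?mulr0 ?normr0 ?gtr0_norm// ltW.
  by have := zy j; rewrite distrC => h2; lra.
have [zOm zt zV] := rP _ zb; have [z'Om z't z'V] := rP _ z'b.
have VV : V z - V z' = h * s.
  have zE : z = h *: delta_mx 0 k + z' by rewrite addrC subrK.
  have hull_z := simplex_int_hull tri tT zt; have hull_z' := simplex_int_hull tri tT z't.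
  rewrite /V (fe_hull nod v tT hull_z) (fe_hull nod v tT hull_z') {1}zE aff_line.
  by rewrite addrK.
have sd u : `|V y - V u| < eta -> `|soft de (V u) - soft de (V y)| <= eta.
  by move=> /ltW; rewrite distrC; apply: le_trans; exact: soft_lip.
have := soft_sqr_diff de0 (sd _ zV) (sd _ z'V); rewrite VV.
rewrite /cut_sqr !asboolT// => hd.
have -> : h^-1 * (soft de (V z) ^+ 2 - soft de (V z') ^+ 2) - 2 * soft de (V y) * s =
    h^-1 * (soft de (V z) ^+ 2 - soft de (V z') ^+ 2 - 2 * soft de (V y) * (h * s)).
  by field; rewrite gt_eqF.
rewrite normrM normfV (gtr0_norm h0) ler_pdivrMl//; apply: (le_trans hd).
rewrite normrM (gtr0_norm h0) mulrCA ler_pM2l//.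
have <- : eta * (2 * (`|s| + 1)) = e by rewrite divfK// gt_eqF// mulr_gt0.
have := normr_ge0 s; nra.
Unshelve. all: by end_near. Qed.

End cut_off_square.

Section convection.
Variables (R : realType) (d : nat) (Om : set 'rV[R]_d) (N : nat).
Variables (x : 'I_N -> 'rV[R]_d) (T : {set {set 'I_N}}) (phi : 'I_N -> 'rV[R]_d -> R).
Hypothesis oOm : open Om.
Hypothesis bOm : bounded_set Om.
Hypothesis lipOm : lipschitz_boundary Om.
Hypothesis tri : triangulation x T Om.
Hypothesis nod : nodal_basis x T Om phi.

Let mu := lebesgue_rV R d.

(* E is Om up to a null set containing the faces. *)
Variable Z : set 'rV[R]_d.
Hypothesis mZ : measurable Z.
Hypothesis Z0 : mu Z = 0%E.
Hypothesis facesZ : faces nod `<=` Z.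
Let E := Om `\` Z.

Lemma measurable_essential : measurable E.
Proof. by apply: measurableD => //; exact: open_measurable_rV. Qed.

Lemma essential_finite : (mu E < +oo)%E.
Proof.
apply: lebesgue_rV_bounded; first exact: measurable_essential.
have [M [Mr bM]] := bOm; exists M; split=> // r /bM h z [zOm _]; exact: h.
Qed.

Lemma inner_essential f h : inner Om f h = \int[mu]_(y in E) (f y * h y).
Proof. exact: Rintegral_setDnull. Qed.

Lemma essential_simplex y : E y -> exists2 t, t \in T & simplex_int nod t y.
Proof.
move=> [yOm yZ]; apply: (not_faces tri); first exact: subset_closure.
by move=> /facesZ.
Qed.

Lemma bmeas_continuous_in (f : 'rV[R]_d -> R) : (forall y, Om y -> {for y, continuous f}) ->
  (exists C, forall y, Om y -> `|f y| <= C) -> bmeas E f.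
Proof.
move=> cf [C fC]; split; last by exists C => y [yOm _]; exact: fC.
apply: (@measurable_funS _ _ _ _ Om); first exact: open_measurable_rV.
  by move=> y [].
by apply: continuous_measurable_rV => // y; rewrite inE => yOm; exact: cf.
Qed.

Lemma bmeas_continuous (f : 'rV[R]_d -> R) : continuous f -> bmeas E f.
Proof.
move=> cf; apply: bmeas_continuous_in => [y _|]; first exact: cf.
have [M [Mr bM]] := bOm.
pose r := `|M| + 1.
have Mlt : M < r by rewrite (le_lt_trans (ler_norm M))// ltrDl.
pose K := [set z : 'rV[R]_d | `|z| <= r].
have cK : compact K.
  apply: bounded_closed_compact.
    by exists r; split; [exact: num_real|move=> s rs z /= zr; exact: (le_trans zr (ltW rs))].
  rewrite (_ : K = Num.norm @^-1` [set s | s <= r])//.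
  by apply: preimage_closed; [move=> ? _; exact: norm_continuous|exact: closed_le].
have /compact_bounded[C [Cr bC]] : compact (f @` K).
  by apply: continuous_compact => //; exact: continuous_subspaceT.
exists (C + 1) => y yOm; apply: bC; first by rewrite ltrDl.
by exists y => //; exact: bM.
Qed.

Lemma bmeas_phi i : bmeas E (phi i).
Proof.
apply: bmeas_continuous_in => [y yOm|]; first exact: (phi_continuous_in oOm nod).
exists 1 => y /subset_closure yOm.
by rewrite ger0_norm ?(phi_ge0 tri nod)// (phi_le1 tri nod).
Qed.

(** Off the closed set [faces] the partial derivative is locally constant, hence continuous on an
    open set containing E. *)
Lemma bmeas_partial_phi i k : bmeas E (partial (phi i) k).
Proof.
split; last first.
  exists (\sum_t `|slope nod t i k 0|) => y /essential_simplex[t tT yt].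
  by rewrite (partial_phi tri _ _ tT yt) (bigD1 t)//= lerDl sumr_ge0.
have oOf : open (Om `\` faces nod).
  by apply: openI => //; apply: closed_openC; exact: closed_faces.
apply: (@measurable_funS _ _ _ _ (Om `\` faces nod)); first exact: open_measurable_rV.
  by move=> y [yOm yZ]; split=> // /facesZ.
apply: continuous_measurable_rV => // y; rewrite inE => -[yOm yf].
have [t tT yt] := not_faces tri (subset_closure yOm) yf.
have ny : nbhs y (simplex_int nod t).
  by apply: open_nbhs_nbhs; split=> //; exact: open_simplex_int.
apply/(@cvgrPdist_lt _ _ _ (nbhs y) _ (partial (phi i) k)) => e e0.
apply: (@filterS _ (nbhs y) _ _ _ _ ny) => z zt.
by rewrite (partial_phi tri i k tT yt) (partial_phi tri i k tT zt) subrr normr0.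
Qed.

Variables (b : 'rV[R]_d -> 'rV[R]_d) (Dv : 'I_d -> 'rV[R]_d -> R).
Hypothesis bb : forall k, bmeas E (fun y => b y 0 k).
Hypothesis bD : forall k, bmeas E (Dv k).
Hypothesis weakD : forall k, weak_partial Om (fun y => b y 0 k) k (Dv k).
Hypothesis div0 : forall y, E y -> \sum_k Dv k y = 0.

Lemma test_divergence psi : test_function Om psi ->
  \int[mu]_(y in E) (\sum_k b y 0 k * partial psi k y) = 0.
Proof.
move=> tpsi; have [spsi _ _] := tpsi.
have cpsi : continuous psi by have [] := spsi [::].
have cdpsi k : continuous (partial psi k) by have [] := spsi [:: k].
have bpsi := bmeas_continuous cpsi.
have bdpsi k := bmeas_continuous (cdpsi k).
have mE := measurable_essential; have fE := essential_finite.
rewrite (bmeas_int_sum mE fE); last by move=> k; apply: bmeasM.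
under eq_bigr do rewrite -inner_essential weakD// inner_essential.
rewrite sumrN -(bmeas_int_sum mE fE); last by move=> k; apply: bmeasM.
rewrite (@eq_Rintegral _ _ _ _ _ (cst 0)); first by rewrite Rintegral_cst// mul0r oppr0.
by move=> y; rewrite inE => yE; rewrite -mulr_suml div0// mul0r.
Qed.

Variable v : 'I_N -> R.
Hypothesis vOm : forall i, v i != 0 -> Om (x i).

Let V := fe phi v.
Let G k y := \sum_i v i * partial (phi i) k y.

Lemma bmeas_fe : bmeas E V.
Proof.
by apply: bmeas_sum => i; apply: bmeasM; [exact: bmeas_cst|exact: bmeas_phi].
Qed.

Lemma bmeas_grad k : bmeas E (G k).
Proof.
by apply: bmeas_sum => i; apply: bmeasM; [exact: bmeas_cst|exact: bmeas_partial_phi].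
Qed.

Lemma bmeas_soft (de : R) : 0 < de -> bmeas E (fun y => soft de (V y)).
Proof.
move=> de0; apply: bmeas_continuous_in => [y yOm|].
  apply: (@continuous_comp _ _ _ V (soft de)); first exact: (fe_continuous_in oOm nod).
  exact: soft_continuous.
exists (\sum_i `|v i|) => y /subset_closure yOm.
by apply: (le_trans (soft_norm de0 _)); exact: (fe_bound tri nod).
Qed.

Lemma coord_bounded : exists B, forall y, Om y -> forall j, `|y 0 j| <= B.
Proof.
have [M [Mr bM]] := bOm.
have Mlt : M < `|M| + 1 by rewrite (le_lt_trans (ler_norm M))// ltrDl.
have e0 : 0 < `|M| + 2 by rewrite ltr_wpDl.
exists (`|M| + 2) => y /(bM _ Mlt) yM j.
have /(ball_rVP _ _ e0)/(_ j) : ball (0 : 'rV[R]_d) (`|M| + 2) y.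
  by rewrite -ball_normE /= sub0r normrN; apply: (le_lt_trans yM); lra.
by rewrite mxE sub0r normrN => /ltW.
Qed.

Lemma cut_test_function (de rho h : R) (psi : 'rV[R]_d -> R) : 0 < de -> 0 < rho ->
  (forall z : 'rV[R]_d, Om z -> de <= `|V z| -> ball z rho `<=` Om) -> 8 * h <= rho ->
  smooth psi ->
  (forall y, psi y != 0 -> exists2 z : 'rV[R]_d, cut_sqr Om phi v de z != 0 &
     forall j, `|z 0 j - y 0 j| <= 3 * h) ->
  test_function Om psi.
Proof.
move=> de0 rho0 core hrho spsi supp.
have clOm : closure [set y | psi y != 0] `<=` Om.
  (* A point of the closed support is within rho/4 + 3h <= 5 rho/8 of a point where the cut-off
     square is nonzero. *)
  move=> y; have r4 : 0 < rho / 4 by rewrite divr_gt0.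
  move=> /(_ _ (nbhsx_ballx y _ r4))[y' [/= /supp[z wz zy'] yy']].
  have [zOm dz] := cut_sqr_neq0 wz.
  apply: (core _ zOm dz); apply/(ball_rVP _ _ rho0) => j.
  have /(ball_rVP _ _ r4)/(_ j) := yy'; have := zy' j.
  have := ler_distD (y' 0 j) (z 0 j) (y 0 j); rewrite (distrC (y' 0 j)) => h1 h2 h3.
  lra.
split=> //; apply: bounded_closed_compact; last exact: closed_closure.
have [M [Mr bM]] := bOm; exists M; split=> // r /bM hr z /clOm; exact: hr.
Qed.

(** The integrand pairs b with the gradient of soft(V)^2, a bounded pointwise limit on E of
    gradients of test functions, and each of these gives integral 0. *)
Lemma convection_cut (de : R) : 0 < de ->
  \int[mu]_(y in E) (\sum_k b y 0 k * (2 * soft de (V y) * G k y)) = 0.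
Proof.
move=> de0.
have mE := measurable_essential; have fE := essential_finite.
have [rho rho0 core] := core_radius oOm bOm lipOm tri nod vOm de0.
have [B yB] := coord_bounded.
pose h (n : nat) : R := rho / 8 * n.+1%:R^-1.
have h0 n : 0 < h n by rewrite mulr_gt0 ?invr_gt0// divr_gt0.
have h8 n : 8 * h n <= rho.
  rewrite /h mulrA mulrCA divff ?mulr1 ?pnatr_eq0// ler_pdivrMr ?ltr0n//.
  by rewrite ler_peMr ?(ltW rho0)// ler1n.
pose psi n := projT1 (cid (smooth_approximation B (cut_sqr Om phi v de) (h0 n))).
have psiP n := projT2 (cid (smooth_approximation B (cut_sqr Om phi v de) (h0 n))).
pose L := 2 * (\sum_i `|v i|) * fe_lip nod v.
have psiL n y k : Om y -> `|partial (psi n) k y| <= L.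
  move=> yOm; have [_ _ /(_ y k (- L) L (yB _ yOm)) hL] := psiP n.
  rewrite ler_norml; apply: hL => z _; rewrite -ler_norml normrM normfV (gtr0_norm (h0 n)).
  rewrite ler_pdivrMl// [leRHS]mulrC; apply: (cut_sqr_lip tri nod de0 _ _ core).
  by rewrite h0 /=; have := h8 n; have := h0 n; lra.
have psit n : test_function Om (psi n).
  by have [s1 s2 _] := psiP n; exact: (cut_test_function de0 rho0 core (h8 n)).
have bdpsi n k : bmeas E (partial (psi n) k).
  by have [spsi _ _] := psit n; apply: bmeas_continuous; have [] := spsi [:: k].
have psicvg y k : E y ->
    partial (psi n) k y @[n --> \oo] --> 2 * soft de (V y) * G k y.
  move=> yE; have [yOm _] := yE; have [t tT yt] := essential_simplex yE.
  apply/cvgrPdist_le => e e0.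
  have := @cut_sqr_difference _ _ _ _ _ _ _ oOm tri nod v _ de0 t k y e tT yt yOm e0.
  rewrite -(fe_partial tri v k tT yt) -/(G k y) => nearP.
  have /nbhs_ballP[r /= r0 rP] := nearP.
  have near_h : \forall n \near \oo, h n < r.
    have rr : 0 < r / (rho / 8) by rewrite !divr_gt0.
    have := near_infty_natSinv_lt (PosNum rr).
    by apply: filterS => n /=; rewrite /h ltr_pdivlMr ?divr_gt0// mulrC.
  apply: filterS near_h => n hn.
  have hb : ball (0 : R) r (h n) by rewrite -ball_normE /= sub0r normrN gtr0_norm.
  have Ph := rP (h n) hb (h0 n).
  (* The enclosure that gave the uniform bound L is used again, now with an interval of radius e
     around the limit. *)
  have [_ _ /(_ y k (2 * soft de (V y) * G k y - e) (2 * soft de (V y) * G k y + e) (yB _ yOm)) hpsi] := psiP n.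
  rewrite distrC ler_distl; apply: hpsi => z zy; rewrite -ler_distl.
  exact: Ph.
have bsum (H : 'I_d -> 'rV[R]_d -> R) : (forall k, bmeas E (H k)) ->
    bmeas E (fun y => \sum_k b y 0 k * H k y).
  by move=> bH; apply: bmeas_sum => k; exact: bmeasM.
have [Cb Cbb] : exists Cb : 'I_d -> R, forall k y, E y -> `|b y 0 k| <= Cb k.
  have ex k : exists C, forall y, E y -> `|b y 0 k| <= C by have [_] := bb k.
  by exists (fun k => projT1 (cid (ex k))) => k; exact: (projT2 (cid (ex k))).
have lim : \int[mu]_(y in E) (\sum_k b y 0 k * partial (psi n) k y) @[n --> \oo] -->
    \int[mu]_(y in E) (\sum_k b y 0 k * (2 * soft de (V y) * G k y)).
  apply: (@bmeas_cvg _ _ _ mu E mE fE (fun n y => \sum_k b y 0 k * partial (psi n) k y)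
    (fun y => \sum_k b y 0 k * (2 * soft de (V y) * G k y)) (\sum_k Cb k * L)).
  - by move=> n; exact: bsum.
  - apply: bsum => k; apply: bmeasM; last exact: bmeas_grad.
    by apply: bmeasM; [exact: bmeas_cst|exact: bmeas_soft].
  - move=> n y yE; have [yOm _] := yE; apply: (le_trans (ler_norm_sum _ _ _)).
    by apply: ler_sum => k _; rewrite normrM ler_pM ?Cbb ?psiL.
  - move=> y yE; apply: cvg_big => [|k _]; first exact: add_continuous.
    by apply: cvgM; [exact: cvg_cst|exact: psicvg].
have : (fun n => \int[mu]_(y in E) (\sum_k b y 0 k * partial (psi n) k y)) = cst 0.
  by apply/funext => n; exact: test_divergence.
move=> e0; move: lim; rewrite e0 => lim.
apply: (cvg_unique (@Rhausdorff R) lim); exact: cvg_cst.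
Qed.

(** Replacing V by its soft threshold changes the integral by at most a constant times [de], and
    [de] is arbitrary. *)
Lemma convection_zero : \int[mu]_(y in E) (\sum_k b y 0 k * G k y * V y) = 0.
Proof.
have mE := measurable_essential; have fE := essential_finite.
set X := (LHS).
have bW : bmeas E (fun y => \sum_k b y 0 k * G k y).
  by apply: bmeas_sum => k; apply: bmeasM => //; exact: bmeas_grad.
have [_ [C WC]] := bW.
have XE : X = \int[mu]_(y in E) ((\sum_k b y 0 k * G k y) * V y).
  by apply: eq_Rintegral => y _; rewrite mulr_suml.
have le de : 0 < de -> `|X| <= `|C| * fine (mu E) * de.
  move=> de0; have bs := bmeas_soft de0.
  have := convection_cut de0.
  rewrite (@eq_Rintegral _ _ _ _ _ (fun y => 2 * ((\sum_k b y 0 k * G k y) * soft de (V y)))); last first.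
    by move=> y _; rewrite mulr_suml mulr_sumr; apply: eq_bigr => k _; ring.
  rewrite (bmeas_intZ mE fE); last exact: bmeasM.
  move=> /eqP; rewrite mulf_eq0 pnatr_eq0 /= => /eqP s0.
  have -> : X = \int[mu]_(y in E) ((\sum_k b y 0 k * G k y) * (V y + (-1) * soft de (V y))).
    rewrite (@eq_Rintegral _ _ _ _ _ (fun y => (\sum_k b y 0 k * G k y) * V y +
        (-1) * ((\sum_k b y 0 k * G k y) * soft de (V y)))); last by move=> y _; ring.
    have bWs := bmeasM bW bs.
    rewrite RintegralD//; last 2 first.
    - by apply: bmeas_integrable => //; apply: bmeasM => //; exact: bmeas_fe.
    - by apply: bmeas_integrable => //; apply: bmeasM => //; exact: bmeas_cst.
    by rewrite (bmeas_intZ mE fE)// s0 mulr0 addr0.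
  rewrite mulrAC; apply: (bmeas_int_norm mE fE).
    apply: bmeasM => //; apply: bmeasD; first exact: bmeas_fe.
    by apply: bmeasM => //; exact: bmeas_cst.
  move=> y yE; rewrite normrM mulN1r ler_pM ?soft_err//.
  exact: (le_trans (WC _ yE) (ler_norm _)).
have A0 : 0 <= `|C| * fine (mu E) by rewrite mulr_ge0// fine_ge0.
apply/eqP; rewrite -normr_le0; apply/ler_addgt0Pr => e e0; rewrite add0r.
have A1 : 0 < `|C| * fine (mu E) + 1 by rewrite ltr_wpDl.
apply: (le_trans (le (e / (`|C| * fine (mu E) + 1)) _)); first exact: divr_gt0.
rewrite mulrA ler_pdivrMr// mulrC ler_pM2l//; lra.
Qed.

End convection.

(** * The stiffness matrix *)

Section gradient_energy.
Variables (R : realType) (d : nat) (Om : set 'rV[R]_d) (N : nat).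
Variables (x : 'I_N -> 'rV[R]_d) (T : {set {set 'I_N}}) (phi : 'I_N -> 'rV[R]_d -> R).
Hypothesis d0 : (0 < d)%N.
Hypothesis oOm : open Om.
Hypothesis bOm : bounded_set Om.
Hypothesis lipOm : lipschitz_boundary Om.
Hypothesis tri : triangulation x T Om.
Hypothesis nod : nodal_basis x T Om phi.

(** Follow a coordinate direction up to the infimum of the parameters outside [Om], which exist
    because [Om] is bounded. *)
Lemma exit_point (y : 'rV[R]_d) k : Om y -> exists c : R,
  [/\ 0 <= c, boundary Om (c *: delta_mx 0 k + y) &
      forall s, 0 <= s <= c -> closure Om (s *: delta_mx 0 k + y)].
Proof.
move=> yOm; pose l (s : R) := s *: delta_mx 0 k + y.
have lc : continuous l by exact: continuous_line.
pose C := [set s : R | 0 <= s /\ ~ Om (l s)].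
have [B OmB] := coord_bounded bOm.
have Cne : C !=set0.
  exists (`|y 0 k| + `|B| + 1); split.
    by rewrite !addr_ge0.
  move=> /OmB/(_ k); rewrite /l coord_line eqxx mulr1.
  have := ler_norm (`|y 0 k| + `|B| + 1 + y 0 k); have := ler_norm B.
  have := ler_norm (- y 0 k); rewrite normrN; lra.
have Cinf : has_inf C by split=> //; exists 0 => s [].
pose c := inf C.
have c0 : 0 <= c by apply: lb_le_inf => // s [].
have below s : 0 <= s < c -> Om (l s).
  move=> /andP[s0 sc]; apply: contrapT => nOm.
  by have := ge_inf (proj2 Cinf) (conj s0 nOm); rewrite leNgt sc.
have nOmc : ~ Om (l c).
  move=> cOm; have /lc/nbhs_ballP[e /= e0 eOm] : nbhs (l c) Om by exact: open_nbhs_nbhs.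
  have [s Cs sc] := inf_adherent e0 Cinf.
  have [_] := Cs; apply; apply: eOm.
  have cs : c <= s by exact: (ge_inf (proj2 Cinf) Cs).
  by rewrite -ball_normE /= distrC ger0_norm ?subr_ge0// ltrBlDl.
have cgt0 : 0 < c.
  rewrite lt_neqAle c0 andbT; apply/eqP => c00; apply: nOmc.
  by rewrite -c00 /l scale0r add0r.
have clc : closure Om (l c).
  move=> U /lc/nbhs_ballP[e /= e0 eU].
  have e20 : 0 < Num.min (e / 2) c by rewrite lt_min divr_gt0.
  set r := Num.min _ _ in e20.
  have rc : r <= c by rewrite ge_min lexx orbT.
  have re : r < e by rewrite gt_min ltr_pdivrMr// ltr_pMr// ltr1n.
  exists (l (c - r)); split; first by apply: below; apply/andP; split; lra.
  by apply: eU; rewrite -ball_normE /= subKr gtr0_norm.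
exists c; split=> //.
  by split=> //; rewrite (proj1 (interior_id Om) oOm).
move=> s /andP[s0]; rewrite le_eqVlt => /orP[/eqP -> //|sc].
by apply: subset_closure; apply: below; rewrite s0.
Qed.

Variable v : 'I_N -> R.
Hypothesis vOm : forall i, v i != 0 -> Om (x i).

(** With zero slopes V is constant along a segment in the closure from x_i to a boundary point,
    where it vanishes. *)
Lemma slopes_zero : (forall t k, t \in T -> fe_slope nod v t k 0 = 0) -> forall i, v i = 0.
Proof.
move=> s0 i; apply/eqP/negPn/negP => vi.
have k := Ordinal d0.
have [c [c0 cB cl]] := exit_point k (vOm vi).
have hs t : t \in T -> `|fe_slope nod v t k 0| <= 0 by move=> tT; rewrite s0// normr0.
have := @fe_segment_le _ _ _ _ _ _ _ tri nod v 0 k (x i) 0 c c0 hs cl.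
rewrite scale0r add0r mul0r (fe_vertex nod) (fe_boundary oOm lipOm tri nod vOm cB).
by rewrite sub0r normrN normr_le0 (negbTE vi).
Qed.

Let mu := lebesgue_rV R d.
Variable Z : set 'rV[R]_d.
Hypothesis mZ : measurable Z.
Hypothesis Z0 : mu Z = 0%E.
Hypothesis facesZ : faces nod `<=` Z.
Let E := Om `\` Z.
Let G k y := \sum_i v i * partial (phi i) k y.

Lemma simplex_int_nonempty t : t \in T -> exists y, simplex_int nod t y.
Proof.
move=> tT; pose w (i : 'I_N) : R := if i \in t then d.+1%:R^-1 else 0.
exists (\sum_i w i *: x i) => i it.
rewrite (lam_barycentric nod i tT).
- by rewrite /w it invr_gt0.
- by move=> j; rewrite /w => /negbTE ->.
- rewrite /w -big_mkcond sumr_const (tri_card tri tT) -[LHS]mulr_natr mulVf ?pnatr_eq0//.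
Qed.

(** Some simplex has a nonzero slope s, and the integrand is at least s^2 on a cube inside [Om] and
    that simplex; removing the null set Z keeps the measure of the cube. *)
Lemma energy_gt0 : (exists i, v i != 0) ->
  0 < \int[mu]_(y in E) (\sum_k G k y * G k y).
Proof.
move=> [i vi]; rewrite ltNge; apply/negP => I0.
have mE := measurable_essential oOm mZ; have fE := essential_finite oOm bOm mZ.
have bG k : bmeas E (G k) by apply: (@bmeas_grad _ _ _ _ _ _ _ oOm tri nod Z facesZ).
move/eqP: vi; apply; apply: slopes_zero => t k tT.
apply/eqP/negPn/negP => s0; set s := fe_slope _ _ _ _ _ in s0.
have [y yt] := simplex_int_nonempty tT.
have nt : nbhs y (simplex_int nod t).
  by apply: open_nbhs_nbhs; split=> //; exact: open_simplex_int.
have clOmy : closure Om y.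
  by rewrite (tri_cover tri); exists t => //; exact: (simplex_int_hull tri tT yt).
have [z [zOm zt]] := clOmy _ nt.
have : nbhs z (Om `&` simplex_int nod t).
  apply: filterI; first exact: open_nbhs_nbhs.
  by apply: open_nbhs_nbhs; split=> //; exact: open_simplex_int.
move=> /nbhs_ballP[r /= r0 rP].
have mb : measurable (ball z r) by rewrite ball_box//; exact: measurable_box.
have bind : bmeas E (\1_(ball z r) : 'rV[R]_d -> R).
  split; first exact: measurable_indic.
  by exists 1 => u _; rewrite indicE; case: (_ \in _); rewrite ?normr1 ?normr0.
suff : 0 < \int[mu]_(u in E) (s ^+ 2 * \1_(ball z r) u).
  apply/negP; rewrite -leNgt; apply: le_trans I0.
  apply: le_Rintegral => //.
  - by apply: bmeas_integrable => //; apply: bmeasM => //; exact: bmeas_cst.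
  - by apply: bmeas_integrable => //; apply: bmeas_sum => j; exact: bmeasM.
  move=> u uE; rewrite indicE.
  have [ub|ub] := pselect (ball z r u); last first.
    by rewrite memNset// mulr0; apply: sumr_ge0 => j _; rewrite -expr2 sqr_ge0.
  have [_ ut] := rP _ ub; rewrite mem_set// mulr1 (bigD1 k)//=.
  rewrite {1 2}/G !(fe_partial tri v k tT ut) -/s -expr2 lerDl.
  by apply: sumr_ge0 => j _; rewrite -expr2 sqr_ge0.
rewrite (bmeas_intZ mE fE)// pmulr_rgt0; last by rewrite exprn_even_gt0.
rewrite /Rintegral integral_indic//.
rewrite [X in fine X](_ : _ = ((2 * r) ^+ d)%:E) /=; first by rewrite exprn_gt0// mulr_gt0.
rewrite -(lebesgue_rV_ball z r0).
have -> : ball z r `&` E = ball z r `\` Z.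
  by apply/seteqP; split=> u [ub uE]; [case: uE|split=> //; split=> //; case: (rP _ ub)].
have zZ : mu (ball z r `&` Z) = 0%E.
  by apply: (subset_measure0 _ _ _ Z0) => //; exact: measurableI.
have := measureDI mu mb mZ.
by rewrite [X in (_ + X)%E](_ : _ = 0%E) ?adde0 => // ->.
Qed.

End gradient_energy.

Section stiffness_matrix.
Variables (R : realType) (d : nat) (Om : set 'rV[R]_d) (M N : nat) (hMN : (M < N)%N).
Variables (x : 'I_N -> 'rV[R]_d) (T : {set {set 'I_N}}) (phi : 'I_N -> 'rV[R]_d -> R).
Hypothesis d0 : (0 < d)%N.
Hypothesis oOm : open Om.
Hypothesis bOm : bounded_set Om.
Hypothesis lipOm : lipschitz_boundary Om.
Hypothesis tri : triangulation x T Om.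
Hypothesis nod : nodal_basis x T Om phi.
Hypothesis xOm : forall i : 'I_N, (i < M)%N -> Om (x i).

Let mu := lebesgue_rV R d.
Variable Z : set 'rV[R]_d.
Hypothesis mZ : measurable Z.
Hypothesis Z0 : mu Z = 0%E.
Hypothesis facesZ : faces nod `<=` Z.
Let E := Om `\` Z.

Variables (eps : R) (b : 'rV[R]_d -> 'rV[R]_d) (Dv : 'I_d -> 'rV[R]_d -> R).
Variable c : 'rV[R]_d -> R.
Hypothesis eps0 : 0 < eps.
Hypothesis bb : forall k, bmeas E (fun y => b y 0 k).
Hypothesis bD : forall k, bmeas E (Dv k).
Hypothesis weakD : forall k, weak_partial Om (fun y => b y 0 k) k (Dv k).
Hypothesis div0 : forall y, E y -> \sum_k Dv k y = 0.
Hypothesis bc : bmeas E c.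
Hypothesis c0 : forall y, E y -> 0 <= c y.

Let mE := measurable_essential oOm mZ.
Let fE := essential_finite oOm bOm mZ.
Let bphi := @bmeas_phi _ _ _ _ _ _ _ oOm tri nod Z.
Let bdphi := @bmeas_partial_phi _ _ _ _ _ _ _ oOm tri nod Z facesZ.
Let G (v : 'I_N -> R) k y := \sum_i v i * partial (phi i) k y.

Lemma bilinear_integral (F : 'I_N -> 'I_N -> 'rV[R]_d -> R) (w v : 'I_N -> R) :
  (forall i j, bmeas E (F i j)) ->
  \sum_i \sum_j v i * (\int[mu]_(y in E) F i j y) * w j =
  \int[mu]_(y in E) (\sum_i \sum_j v i * w j * F i j y).
Proof.
move=> bF; have bF' i j : bmeas E (fun y => v i * w j * F i j y).
  by apply: bmeasM => //; exact: bmeas_cst.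
rewrite (bmeas_int_sum mE fE); last by move=> i; apply: bmeas_sum.
apply: eq_bigr => i _; rewrite (bmeas_int_sum mE fE)//.
by apply: eq_bigr => j _; rewrite (bmeas_intZ mE fE)//; ring.
Qed.

(** As a_ij = a(phi_j, phi_i), the column coefficients w belong to the trial function and the row
    coefficients v to the test function. *)
Lemma sum_diff_conv (w v : 'I_N -> R) :
  \sum_i \sum_j v i * diff_conv Om eps b (phi j) (phi i) * w j =
  eps * (\int[mu]_(y in E) (\sum_k G w k y * G v k y)) +
  \int[mu]_(y in E) ((\sum_k b y 0 k * G w k y) * fe phi v y).
Proof.
pose F1 i j y := \sum_k partial (phi j) k y * partial (phi i) k y.
pose F2 i j y := (\sum_k b y 0 k * partial (phi j) k y) * phi i y.
have bF1 i j : bmeas E (F1 i j) by apply: bmeas_sum => k; exact: bmeasM.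
have bF2 i j : bmeas E (F2 i j).
  by apply: bmeasM => //; apply: bmeas_sum => k; exact: bmeasM.
have dcE i j : diff_conv Om eps b (phi j) (phi i) =
    eps * (\int[mu]_(y in E) F1 i j y) + \int[mu]_(y in E) F2 i j y.
  rewrite /diff_conv (inner_essential Om mZ Z0); congr (eps * _ + _).
  exact: Rintegral_setDnull.
transitivity (eps * (\sum_i \sum_j v i * (\int[mu]_(y in E) F1 i j y) * w j) +
    \sum_i \sum_j v i * (\int[mu]_(y in E) F2 i j y) * w j).
  rewrite mulr_sumr -big_split; apply: eq_bigr => i _.
  rewrite mulr_sumr -big_split; apply: eq_bigr => j _.
  by rewrite dcE /=; ring.
rewrite !bilinear_integral//; congr (eps * _ + _); apply: eq_Rintegral => y _.
  transitivity (\sum_i \sum_k v i * partial (phi i) k y * G w k y).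
    apply: eq_bigr => i _.
    under eq_bigr do rewrite /F1 mulr_sumr.
    rewrite exchange_big; apply: eq_bigr => k _; rewrite /G mulr_sumr.
    by apply: eq_bigr => j _; ring.
  rewrite exchange_big; apply: eq_bigr => k _.
  by rewrite [RHS]mulrC /G mulr_suml.
rewrite /fe mulr_sumr; apply: eq_bigr => i _.
transitivity ((\sum_k \sum_j b y 0 k * (w j * partial (phi j) k y)) * (v i * phi i y)).
  rewrite exchange_big mulr_suml; apply: eq_bigr => j _.
  rewrite /F2 !mulr_suml mulr_sumr; apply: eq_bigr => k _; ring.
by congr (_ * _); apply: eq_bigr => k _; rewrite /G mulr_sumr.
Qed.

(** The property shared by the consistent and the lumped reaction term. Row sums use it with the
    pair (1, phi_i), positive definiteness with w = v. *)
Definition nonneg_reaction (r : 'I_N -> 'I_N -> R) := forall w v : 'I_N -> R,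
  (forall y, closure Om y -> 0 <= fe phi w y * fe phi v y) ->
  0 <= \sum_i \sum_j v i * r i j * w j.

Lemma reaction_ge0 : nonneg_reaction (fun i j => inner Om (fun y => c y * phi j y) (phi i)).
Proof.
move=> w v wv.
under eq_bigr do under eq_bigr do rewrite (inner_essential Om mZ Z0).
rewrite (bilinear_integral (F := fun i j y => c y * phi j y * phi i y)); last first.
  by move=> i j; apply: bmeasM => //; exact: bmeasM.
apply: Rintegral_ge0 => y yE; have [yOm _] := yE.
have -> : \sum_i \sum_j v i * w j * (c y * phi j y * phi i y) = c y * (fe phi w y * fe phi v y).
  rewrite /fe mulr_suml mulr_sumr exchange_big; apply: eq_bigr => j _.
  by rewrite !mulr_sumr; apply: eq_bigr => i _; ring.
by rewrite mulr_ge0 ?c0// wv//; exact: subset_closure.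
Qed.

Lemma lumped_reaction_ge0 : nonneg_reaction (fun i j =>
  \sum_(l < M) inner Om c (phi (inn hMN l)) * phi j (x (inn hMN l)) * phi i (x (inn hMN l))).
Proof.
move=> w v wv.
have -> : \sum_i \sum_j v i * (\sum_(l < M) inner Om c (phi (inn hMN l)) *
      phi j (x (inn hMN l)) * phi i (x (inn hMN l))) * w j =
    \sum_(l < M) inner Om c (phi (inn hMN l)) *
      (fe phi w (x (inn hMN l)) * fe phi v (x (inn hMN l))).
  transitivity (\sum_i \sum_j \sum_(l < M) v i * (inner Om c (phi (inn hMN l)) *
      phi j (x (inn hMN l)) * phi i (x (inn hMN l))) * w j).
    by apply: eq_bigr => i _; apply: eq_bigr => j _; rewrite mulr_sumr mulr_suml.
  under eq_bigr do rewrite exchange_big.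
  rewrite exchange_big; apply: eq_bigr => l _.
  rewrite /fe mulr_suml mulr_sumr exchange_big; apply: eq_bigr => j _.
  by rewrite !mulr_sumr; apply: eq_bigr => i _; ring.
apply: sumr_ge0 => l _; have xl : closure Om (x (inn hMN l)).
  by apply: subset_closure; apply: xOm; exact: (ltn_ord l).
rewrite mulr_ge0 ?wv// (inner_essential Om mZ Z0); apply: Rintegral_ge0 => y yE.
have [yOm _] := yE.
by rewrite mulr_ge0 ?c0// (phi_ge0 tri nod)//; exact: subset_closure.
Qed.

Variable r : 'I_N -> 'I_N -> R.
Hypothesis r0 : nonneg_reaction r.
Variable A : 'M[R]_N.
Hypothesis AE : forall i j, A i j = diff_conv Om eps b (phi j) (phi i) + r i j.

Lemma sum_stiffness (w v : 'I_N -> R) : \sum_i \sum_j v i * A i j * w j =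
  \sum_i \sum_j v i * diff_conv Om eps b (phi j) (phi i) * w j +
  \sum_i \sum_j v i * r i j * w j.
Proof.
rewrite -big_split; apply: eq_bigr => i _; rewrite -big_split; apply: eq_bigr => j _.
by rewrite AE /=; ring.
Qed.

Lemma grad_one k y : E y -> G (fun=> 1) k y = 0.
Proof.
move=> yE; have [t tT yt] := essential_simplex tri facesZ yE.
rewrite /G (fe_partial tri _ k tT yt).
have aff1 z : aff (fe_slope nod (fun=> 1) t) (fe_offset nod (fun=> 1) t) z = 1.
  transitivity (\sum_i lam nod t i z); last exact: (sum_lam tri).
  by rewrite -aff_sum; apply: eq_bigr => i _; rewrite mul1r.
(* The affine function is 1 on the whole space; comparing two points a unit vector apart shows that
   its slope is 0. *)
have := aff_line (fe_slope nod (fun=> 1) t) (fe_offset nod (fun=> 1) t) y k 1.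
by rewrite !aff1 mul1r => h; lra.
Qed.

(** By partition of unity the row sum is the form at the pair (1, phi_i); the gradient of 1 is 0, so
    just the reaction term remains. *)
Lemma stiffness_row_sum i : 0 <= \sum_j A i j.
Proof.
pose v (k : 'I_N) : R := (k == i)%:R.
have fev y : fe phi v y = phi i y.
  rewrite /fe (bigD1 i)//= /v eqxx mul1r big1 ?addr0// => j /negbTE ->.
  by rewrite mul0r.
have -> : \sum_j A i j = \sum_k \sum_j v k * A k j * 1.
  rewrite [RHS](bigD1 i)//= [X in _ + X]big1 ?addr0.
    by apply: eq_bigr => j _; rewrite /v eqxx mul1r mulr1.
  by move=> k /negbTE ki; apply: big1 => j _; rewrite /v ki !mul0r.
rewrite (sum_stiffness (fun=> 1) v) addr_ge0//.
  rewrite sum_diff_conv [X in eps * X](_ : _ = 0) ?[X in _ + X](_ : _ = 0) ?mulr0 ?addr0//.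
    rewrite (@eq_Rintegral _ _ _ _ _ (cst 0)) ?Rintegral_cst ?mul0r// => y; rewrite inE => yE.
    by rewrite big1 ?mul0r// => k _; rewrite grad_one// mulr0.
  rewrite (@eq_Rintegral _ _ _ _ _ (cst 0)) ?Rintegral_cst ?mul0r// => y; rewrite inE => yE.
  by rewrite big1// => k _; rewrite grad_one// mul0r.
apply: (r0 (w := fun=> 1)) => y yOm; rewrite fev mulr_ge0 ?(phi_ge0 tri nod)//.
by apply: sumr_ge0 => j _; rewrite mul1r (phi_ge0 tri nod).
Qed.

Lemma stiffness_posdef (v : 'rV[R]_M) : v != 0 ->
  0 < \sum_(i < M) \sum_(j < M) v 0 i * A (inn hMN i) (inn hMN j) * v 0 j.
Proof.
(* Extension by 0 to the boundary nodes, so that the finite element function vanishes on the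
   boundary. *)
move=> v0; pose w (i : 'I_N) : R := if insub (i : nat) is Some m then v 0 m else 0.
have winn i : w (inn hMN i) = v 0 i by rewrite /w /= valK.
have wM i : w i != 0 -> (i < M)%N by rewrite /w; case: insubP => //=; rewrite eqxx.
have sumw (F : 'I_N -> R) : (forall i, w i = 0 -> F i = 0) ->
    \sum_i F i = \sum_(i < M) F (inn hMN i).
  move=> F0; rewrite -(big_ord_narrow (ltnW hMN) (F := F)) (bigID (fun i : 'I_N => (i < M)%N)) /=.
  rewrite [X in _ + X]big1 ?addr0// => i iM; apply: F0.
  by apply/eqP; apply: contraNT iM; exact: wM.
have -> : \sum_(i < M) \sum_(j < M) v 0 i * A (inn hMN i) (inn hMN j) * v 0 j =
    \sum_i \sum_j w i * A i j * w j.
  rewrite sumw => [|i wi0]; last by apply: big1 => j _; rewrite wi0 !mul0r.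
  apply: eq_bigr => i _; rewrite sumw => [|j wj0]; last by rewrite wj0 mulr0.
  by apply: eq_bigr => j _; rewrite !winn.
have wOm i : w i != 0 -> Om (x i) by move=> /wM; exact: xOm.
rewrite sum_stiffness ltr_pwDl//; last by apply: r0 => y _; rewrite -expr2 sqr_ge0.
rewrite sum_diff_conv.
rewrite [X in _ + X](_ : _ = 0) ?addr0.
  have wN0 : exists i, w i != 0.
    by have /rV0Pn[i vi] := v0; exists (inn hMN i); rewrite winn.
  rewrite mulr_gt0//.
  exact: (@energy_gt0 _ _ _ _ _ _ _ d0 oOm bOm lipOm tri nod w wOm Z mZ Z0 facesZ wN0).
apply: etrans (convection_zero oOm bOm lipOm tri mZ Z0 facesZ bb bD weakD div0 wOm).
by apply: eq_Rintegral => y _; rewrite mulr_suml.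
Qed.

End stiffness_matrix.

Lemma in_Linf_ae (R : realType) d (Om : set 'rV[R]_d) f : in_Linf Om f ->
  exists C : R, {ae lebesgue_rV R d, forall y, Om y -> `|f y| <= C}.
Proof. by case. Qed.

Theorem mainTheorem8 (R : realType) :
  (forall (M N : nat) (hM : (0 < M)%N) (hMN : (M < N)%N)
     (A : 'M[R]_N) (g : 'rV[R]_M),
     (forall i : 'I_M, 0 <= \sum_j A (inn hMN i) j) ->
     (forall v : 'rV[R]_M, v != 0 ->
        0 < \sum_(i < M) \sum_(j < M)
              v 0 i * A (inn hMN i) (inn hMN j) * v 0 j) ->
   forall (Rp Rm : 'rV[R]_N -> 'I_N -> R) (U : 'rV[R]_N),
     limiter M A Rp Rm ->
     afc_solution hMN A g Rp Rm U ->
     [/\ local_DMP hMN A g U, general_DMP hMN A g U & global_DMP hMN A g U])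
  /\
  (forall (d : nat) (hd : (0 < d)%N) (Om : set 'rV[R]_d)
     (eps sigma0 : R) (b : 'rV[R]_d -> 'rV[R]_d) (c gf : 'rV[R]_d -> R),
     domain Om -> bounded_set Om -> lipschitz_boundary Om ->
     ((2 <= d)%N -> polyhedral Om) ->
     0 < eps ->
     (forall k, in_W1inf Om (fun y => b y 0 k)) -> divergence_free Om b ->
     in_Linf Om c -> 0 <= sigma0 ->
     {ae lebesgue_rV R d, forall y, Om y -> sigma0 <= c y} ->
     in_L2 Om gf ->
   forall (M N : nat) (hM : (0 < M)%N) (hMN : (M < N)%N)
     (x : 'I_N -> 'rV[R]_d) (T : {set {set 'I_N}})
     (phi : 'I_N -> 'rV[R]_d -> R),
     triangulation x T Om ->
     (forall i : 'I_N, (i < M)%N -> Om (x i)) ->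
     (forall i : 'I_N, (M <= i)%N -> boundary Om (x i)) ->
     nodal_basis x T Om phi ->
   forall (A : 'M[R]_N) (g : 'rV[R]_M),
     A = stiffness (form_a Om eps b c) phi \/
     A = stiffness (form_lumped Om eps b c hMN x phi) phi ->
     g = \row_(i < M) inner Om gf (phi (inn hMN i)) ->
   forall (Rp Rm : 'rV[R]_N -> 'I_N -> R) (U : 'rV[R]_N),
     limiter M A Rp Rm ->
     afc_solution hMN A g Rp Rm U ->
     [/\ local_DMP hMN A g U, general_DMP hMN A g U & global_DMP hMN A g U]).
Proof.
split=> [M N hM hMN A g sum0 pos Rp Rm U lim sol|].
  by split; [exact: local_DMP_afc sol|exact: general_DMP_afc sol|exact: global_DMP_afc sol].
move=> d d0 Om eps sigma0 b c gf [oOm _ _] bOm lipOm _ eps0 bW [Dv [Dv1 Dv2]] cL s0 cs _.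
move=> M N hM hMN x T phi tri xOm _ nod A g AE _ Rp Rm U lim sol.
have bL k : in_Linf Om (fun y => b y 0 k) by have [] := bW k.
have DL k : in_Linf Om (Dv k) by have [] := Dv1 k.
have [Cb Cbb] : exists Cb : 'I_d -> R, forall k,
    {ae lebesgue_rV R d, forall y, Om y -> `|b y 0 k| <= Cb k}.
  by exists (fun k => projT1 (cid (in_Linf_ae (bL k)))) => k; exact: (projT2 (cid (in_Linf_ae (bL k)))).
have [CD CDD] : exists CD : 'I_d -> R, forall k,
    {ae lebesgue_rV R d, forall y, Om y -> `|Dv k y| <= CD k}.
  by exists (fun k => projT1 (cid (in_Linf_ae (DL k)))) => k; exact: (projT2 (cid (in_Linf_ae (DL k)))).
have [Cc Ccc] := in_Linf_ae cL.
have faces_ae : {ae lebesgue_rV R d, forall y, ~ faces nod y}.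
  exists (faces nod); split; [exact: measurable_faces|exact: lebesgue_faces|].
  by move=> y /contrapT.
have aeF := ae_filter_ringOfSetsType (lebesgue_rV R d).
have aeI := @filterI _ _ aeF.
(* A single measurable null set containing the faces and the exceptional sets of the bounds on b,
   its weak derivatives and c, of c >= sigma0, and of div b = 0. *)
have [Z [mZ Z0 PZ]] := aeI _ _ faces_ae (aeI _ _ (filter_forall aeF Cbb)
  (aeI _ _ (filter_forall aeF CDD) (aeI _ _ Ccc (aeI _ _ cs Dv2)))).
have facesZ : faces nod `<=` Z.
  by move=> y yf; apply: PZ => -[].
have good y : (Om `\` Z) y -> [/\ forall k, `|b y 0 k| <= Cb k, forall k, `|Dv k y| <= CD k,
    `|c y| <= Cc, 0 <= c y & \sum_k Dv k y = 0].
  move=> [yOm yZ]; have /contrapT[_ [g1 [g2 [g3 [g4 g5]]]]] := contra_not (@PZ y) yZ.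
  split=> [k|k|||]; [exact: g1|exact: g2|exact: g3| |exact: g5].
  exact: le_trans s0 (g4 yOm).
have bm f C : in_Linf Om f -> (forall y, (Om `\` Z) y -> `|f y| <= C) -> bmeas (Om `\` Z) f.
  move=> [mf _] fC; split; last by exists C.
  apply: measurable_funS mf; first exact: open_measurable_rV.
  by move=> y [].
have bb k : bmeas (Om `\` Z) (fun y => b y 0 k).
  by apply: (bm _ (Cb k)) => // y /good[].
have bD k : bmeas (Om `\` Z) (Dv k) by apply: (bm _ (CD k)) => // y /good[].
have bc : bmeas (Om `\` Z) c by apply: (bm _ Cc) => // y /good[].
have c0 y : (Om `\` Z) y -> 0 <= c y by move=> /good[].
have div0 y : (Om `\` Z) y -> \sum_k Dv k y = 0 by move=> /good[].
have weakD k : weak_partial Om (fun y => b y 0 k) k (Dv k) by have [] := Dv1 k.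
have [r r0 AE'] : exists2 r : 'I_N -> 'I_N -> R, nonneg_reaction Om phi r &
    forall i j, A i j = diff_conv Om eps b (phi j) (phi i) + r i j.
  case: AE => ->.
    exists (fun i j => inner Om (fun y => c y * phi j y) (phi i)).
      exact: (reaction_ge0 oOm bOm tri nod mZ Z0 bc c0).
    by move=> i j; rewrite mxE.
  exists (fun i j => \sum_(l < M) inner Om c (phi (inn hMN l)) *
      phi j (x (inn hMN l)) * phi i (x (inn hMN l))).
    exact: (lumped_reaction_ge0 hMN tri nod xOm mZ Z0 c0).
  by move=> i j; rewrite mxE.
have sum0 (i : 'I_M) : 0 <= \sum_j A (inn hMN i) j.
  exact: (stiffness_row_sum oOm bOm tri mZ Z0 facesZ bb r0 AE').
have pos (v : 'rV[R]_M) : v != 0 ->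
    0 < \sum_(i < M) \sum_(j < M) v 0 i * A (inn hMN i) (inn hMN j) * v 0 j.
  exact: (@stiffness_posdef _ _ _ _ _ hMN _ _ _ d0 oOm bOm lipOm tri nod xOm Z mZ Z0 facesZ _ _ _ eps0 bb bD weakD div0 _ r0 _ AE').
by split; [exact: local_DMP_afc sol|exact: general_DMP_afc sol|exact: global_DMP_afc sol].
Qed.
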